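(* For every vertex $V\in\mathcal V$ let $\sigma_h^V\in\Sigma_h^V$ be the stress component of the solution of the local problem on the vertex patch $\omega_V$ (extended by zero outside $\omega_V$). Let $$\sigma_h^{\mathrm{LEQ}}:=\bar\sigma_h-\sigma_h^\Delta,\qquad \sigma_h^\Delta:=\sum_{V\in\mathcal V}\sigma_h^V,\qquad \bar\sigma_h:=\nu\nabla\bar{\boldsymbol u}_h .$$ Then $\sigma_h^{\mathrm{LEQ}}\in\Sigma_h$ and $$(\boldsymbol f,\boldsymbol v_h)+\langle\operatorname{div}(\sigma_h^{\mathrm{LEQ}}),\boldsymbol v_h\rangle_{\boldsymbol V_h}=0\quad\text{for all }\boldsymbol v_h\in\boldsymbol V_h\text{ with }\operatorname{div}(\boldsymbol v_h)=0 .$$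
   Context: Stokes problem and notation: $\Omega\subset\mathbb R^d$, $d\in\{2,3\}$, is an open bounded domain with polygonal/polyhedral boundary, $\nu>0$, $\boldsymbol f\in L^2(\Omega)^d$, $\boldsymbol V=H^1_0(\Omega)^d$, $Q=L^2_0(\Omega)$ (mean-value zero). $(\cdot,\cdot)_\omega$ is the $L^2$ inner product on $\omega$ (index omitted for $\Omega$). $\mathcal T$ is a regular triangulation of $\Omega$ into simplices with vertices $\mathcal V$, faces $\mathcal F$, interior faces $\mathcal F(\Omega)$. $\boldsymbol a_n=\boldsymbol a\cdot\boldsymbol n$, $\boldsymbol a_t=\boldsymbol a-(\boldsymbol a\cdot\boldsymbol n)\boldsymbol n$; for matrix fields $\tau_{nn}=\boldsymbol n\cdot\tau\boldsymbol n$, $\tau_{nt}=(\tau\boldsymbol n)_t$; on $\partial T$ the normal $\boldsymbol n$ is outward. $[\![b]\!]$ is the jump over a face (fixed face normal pointing from $T_1$ to $T_2$, $[\![b]\!]=b|_{T_1}-b|_{T_2}$; on faces belonging to only one element of the mesh or patch it is the trace with outward normal). Matrix divergences are row-wise. $P_k(\mathcal T)$: piecewise polynomials of degree $\le k$; $\boldsymbol\pi_j$: $L^2$-projection onto vector-valued piecewise polynomials of degree $j$ ($0$ if $j<0$). $\mathrm{RT}_k(\mathcal T)=\{\boldsymbol v_h\in H(\operatorname{div},\Omega):\boldsymbol v_h|_T(\boldsymbol x)=\boldsymbol a_T+b_T\boldsymbol x,\ \boldsymbol a_T\in P_k(T)^d,\ b_T\in P_k(T)\}$; $H_0(\operatorname{div},\Omega)$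 has vanishing normal trace. Primal method: $\bar{\boldsymbol V}_h\subset\boldsymbol V$, $\bar Q_h\subset Q$ is an inf-sup stable pair of finite element spaces (with discontinuous pressures) with expected optimal convergence order $r$, and $(\bar{\boldsymbol u}_h,\bar p_h)\in\bar{\boldsymbol V}_h\times\bar Q_h$ satisfies $\nu(\nabla\bar{\boldsymbol u}_h,\nabla\bar{\boldsymbol v}_h)-(\operatorname{div}\bar{\boldsymbol v}_h,\bar p_h)=(\boldsymbol f,\mathcal R(\bar{\boldsymbol v}_h))$ for all $\bar{\boldsymbol v}_h\in\bar{\boldsymbol V}_h$ and $(\operatorname{div}\bar{\boldsymbol u}_h,\bar q_h)=0$ for all $\bar q_h\in\bar Q_h$. The reconstruction operator $\mathcal R$ maps discretely divergence-free functions to exactly divergence-free ones and satisfies, for all $\bar{\boldsymbol v}_h\in\bar{\boldsymbol V}_h,\bar q_h\in\bar Q_h$: $\operatorname{div}\mathcal R(\bar{\boldsymbol v}_h)\in\bar Q_h$; $(\operatorname{div}\bar{\boldsymbol v}_h,\bar q_h)=(\operatorname{div}\mathcal R(\bar{\boldsymbol v}_h),\bar q_h)$; $(\boldsymbol f,\bar{\boldsymbol v}_h-\mathcal R(\bar{\boldsymbol v}_h))=(\boldsymbol f-\boldsymbol\pi_{r-2}\boldsymbol f,\bar{\boldsymbol v}_h-\mathcal R(\bar{\boldsymbol v}_h))$; and $\mathcal R(\bar{\boldsymbol v}_h)=\bar{\boldsymbol v}_h$ for all $\bar{\boldsymbol v}_h\in P_1(\mathcal T)^d\cap H^1_0(\Omega)^d$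 (which is contained in $\bar{\boldsymbol V}_h$). Global spaces, with $k=r$: $\Sigma_h=\{\tau_h\in P_k(\mathcal T)^{d\times d}:\operatorname{tr}(\tau_h)=0,\ [\![(\tau_h)_{nt}]\!]=0\ \forall F\in\mathcal F(\Omega)\}$, $\boldsymbol V_h=\mathrm{RT}_k(\mathcal T)\cap H_0(\operatorname{div},\Omega)$, and $\langle\operatorname{div}(\sigma_h),\boldsymbol v_h\rangle_{\boldsymbol V_h}:=\sum_{T\in\mathcal T}(\operatorname{div}\sigma_h,\boldsymbol v_h)_T-\sum_{F\in\mathcal F}([\![(\sigma_h)_{nn}]\!],(\boldsymbol v_h)_n)_F$. Local problems: for $V\in\mathcal V$, $\mathcal T_V=\{T\in\mathcal T:V\in\overline T\}$, $\omega_V$ is the union of the cells in $\mathcal T_V$, $\mathcal F_V$ are the facets in the patch including those on $\partial\omega_V$, $\phi_V$ is the hat function of $V$. With $k=r$: $\Sigma_h^V=\{\tau_h\in L^2(\omega_V)^{d\times d}:\tau_h|_T\in P_k(T)^{d\times d}\ \forall T\in\mathcal T_V,\ \operatorname{tr}(\tau_h)=0\}$; $\boldsymbol V_h^V=\mathrm{RT}_k(\mathcal T_V)$ (normal-continuous within $\omega_V$); $\hat{\boldsymbol V}_h^V=\{\hat{\boldsymbol v}_h\in L^2(\mathcal F_V)^d:\hat{\boldsymbol v}_h|_F\in P_k(F)^d,\ (\hat{\boldsymbol v}_h)_n=0\ \forall F\in\mathcal F_V\}$; $Q_h^V=P_k(\mathcal T_V)$; $\boldsymbol X_h^V=(\boldsymbol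 V_h^V\times\hat{\boldsymbol V}_h^V)/\{(\boldsymbol c,\boldsymbol c_t):\boldsymbol c\in\mathbb R^d\}$, identified with the pairs whose mean value $\frac1{|\mathcal T_V|+|\mathcal F_V|}(\sum_{T\in\mathcal T_V}\int_T\boldsymbol v_h\,dx+\sum_{F\in\mathcal F_V}\int_F\hat{\boldsymbol v}_h\,ds)$ vanishes, where $|\mathcal T_V|,|\mathcal F_V|$ are the measures of the patch and its skeleton. If $V\in\partial\Omega$, the facets on $\partial\Omega$ are removed from $\mathcal F_V$ (so $\hat{\boldsymbol V}_h^V$ has no degrees of freedom there) and $\boldsymbol X_h^V:=\boldsymbol V_h^V\times\hat{\boldsymbol V}_h^V$. The bubble projector $\boldsymbol B^V$ acts componentwise and elementwise by $B_T^V(v)=I^k_{\mathcal L}(\phi_Vv)$, $I^k_{\mathcal L}$ being the nodal Lagrange interpolation into $P_k(T)$. The local problem: find $(\sigma_h^V,(\boldsymbol u_h^V,\hat{\boldsymbol u}_h^V),p_h^V)\in\Sigma_h^V\times\boldsymbol X_h^V\times Q_h^V$ such that for all $(\tau_h^V,(\boldsymbol v_h^V,\hat{\boldsymbol v}_h^V),q_h^V)$ in the same space $$(\sigma_h^V,\tau_h^V)_{\omega_V}+\langle\operatorname{div}(\tau_h^V),(\boldsymbol u_h^V,\hat{\boldsymbol u}_h^V)\rangle_{\boldsymbol V_h^V}=0,$$ $$\langle\operatorname{div}(\sigma_h^V),(\boldsymbol v_h^V,\hat{\boldsymbol v}_h^V)\rangle_{\boldsymbol V_h^V}+(\operatorname{div}\boldsymbol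 v_h^V,p_h^V)_{\omega_V}=\boldsymbol r^V((\boldsymbol v_h^V,\hat{\boldsymbol v}_h^V)),\qquad(\operatorname{div}\boldsymbol u_h^V,q_h^V)_{\omega_V}=0,$$ where $$\langle\operatorname{div}(\tau),(\boldsymbol v,\hat{\boldsymbol v})\rangle_{\boldsymbol V_h^V}:=\sum_{T\in\mathcal T_V}(\operatorname{div}\tau,\boldsymbol v)_T-\sum_{F\in\mathcal F_V}\big(([\![\tau_{nn}]\!],\boldsymbol v_n)_F+([\![\tau_{nt}]\!],\hat{\boldsymbol v})_F\big),$$ $$\boldsymbol r^V((\boldsymbol v,\hat{\boldsymbol v})):=\sum_{T\in\mathcal T_V}\Big[(\boldsymbol f+\nu\Delta\bar{\boldsymbol u}_h-\nabla\bar p_h,\boldsymbol B^V(\boldsymbol v))_T-((\bar\sigma_h-\bar p_hI_{d\times d})_{nn},(\boldsymbol B^V(\boldsymbol v))_n)_{\partial T}-(\phi_V(\bar\sigma_h)_{nt},\hat{\boldsymbol v})_{\partial T}\Big].$$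
   Formalization: The membership of σ^LEQ in Σ_h, false for only discretely divergence-free ū_h (trace is ν div ū_h), is replaced by: it holds iff σ̄_h ∈ P_k and div ū_h = 0 on each cell; if just σ̄_h ∈ P_k, the deviatoric part of σ^LEQ lies in Σ_h. The equilibrium identity is unchanged. *)

(* Defs.v *)
From HB Require Import structures.
From mathcomp Require Import all_boot all_order all_algebra.
From mathcomp Require Import all_classical all_reals all_analysis.
Set Implicit Arguments.
Unset Strict Implicit.
Unset Printing Implicit Defensive.
Import Order.TTheory GRing.Theory Num.Theory numFieldNormedType.Exports.
Local Open Scope classical_set_scope.
Local Open Scope ring_scope.

(* The library's sigma-finiteness instance on m1 \x m2 is shadowed by the one
   for products of subprobabilities, hence this copy. *)
Section product_sigma_finite.
Context d1 d2 (T1 : measurableType d1) (T2 : measurableType d2) (R : realType).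
Variables (m1 : {sigma_finite_measure set T1 -> \bar R})
          (m2 : {sigma_finite_measure set T2 -> \bar R}).

Definition prod_measure : set (T1 * T2) -> \bar R := (m1 \x m2)%E.

HB.instance Definition _ := Measure.on prod_measure.

Let prod_measure_sigma_finite : sigma_finite setT prod_measure.
Proof.
have /sigma_finiteP[F [TF ndF Foo]] := sigma_finiteT m1.
have /sigma_finiteP[G [TG ndG Goo]] := sigma_finiteT m2.
exists (fun n => F n `*` G n).
  rewrite -setXTT TF TG predeqE => -[x y]; split.
    move=> [/= [n _ Fnx] [k _ Gky]]; exists (maxn n k) => //; split.
    - by move: x Fnx; exact/subsetPset/ndF/leq_maxl.
    - by move: y Gky; exact/subsetPset/ndG/leq_maxr.
  by move=> [n _ []/= ? ?]; split; exists n.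
move=> k; have [? ?] := Foo k; have [? ?] := Goo k.
split; first exact: measurableX.
by rewrite /prod_measure product_measure1E// lte_mul_pinfty// ge0_fin_numE.
Qed.

HB.instance Definition _ := Measure_isSigmaFinite.Build _ _ _ prod_measure
  prod_measure_sigma_finite.

End product_sigma_finite.

(* Rn R n is R * (R * (... * unit)) with its product sigma-algebra, and lebn n
   the n-dimensional Lebesgue measure on it. *)
Section lebesgue_n.
Variable R : realType.

Fixpoint Rn_display (n : nat) : measure_display :=
  if n is n'.+1 then (R.-ocitv.-measurable.-sigma, Rn_display n').-prod%mdisp
  else default_measure_display.

Fixpoint Rn n : measurableType (Rn_display n) :=
  match n with
  | 0 => unit
  | n'.+1 => (measurableTypeR R * Rn n')%type
  end.

Fixpoint lebn n : {sigma_finite_measure set (Rn n) -> \bar R} :=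
  match n return {sigma_finite_measure set (Rn n) -> \bar R} with
  | 0 => dirac tt
  | n'.+1 => prod_measure lebesgue_measure (lebn n')
  end.

Fixpoint coord n : Rn n -> nat -> R :=
  match n return Rn n -> nat -> R with
  | 0 => fun _ _ => 0
  | n'.+1 => fun y i => if i is i'.+1 then coord y.2 i' else y.1
  end.

Definition ref_simplex n : set (Rn n) :=
  [set y | (forall i, 0 <= coord y i) /\ \sum_(i < n) coord y i <= 1].

End lebesgue_n.

Section simplex_integral.
Context {R : realType} {d : nat}.
Local Notation pt := 'rV[R]_d.

Section param.
Variables (m : nat) (p : 'I_m.+1 -> pt).

Definition simplex_param (y : Rn R m) : pt :=
  p ord0 + \sum_(i < m) coord y i *: (p (lift ord0 i) - p ord0).

Definition simplex_edges : 'M[R]_(m, d) :=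
  \matrix_(i, j) (p (lift ord0 i) - p ord0) 0 j.

(* Integral over the m-simplex with vertices p with respect to the
   m-dimensional surface measure (Lebesgue measure if m = d), by affine
   parametrisation; the factor is the Gramian, i.e. |det| if m = d. *)
Definition simplex_int (g : pt -> R) : R :=
  Num.sqrt (\det (simplex_edges *m simplex_edges^T)) *
  \int[lebn R m]_(y in @ref_simplex R m) g (simplex_param y).

Definition simplex_L2 (g : pt -> R) : Prop :=
  measurable_fun (@ref_simplex R m) (g \o simplex_param) /\
  (lebn R m).-integrable (@ref_simplex R m)
    (fun y => ((g (simplex_param y)) ^+ 2)%:E).

End param.

Definition dot (u v : pt) : R := \sum_i u 0 i * v 0 i.
Definition frob (A B : 'M[R]_d) : R := \sum_i \sum_j A i j * B i j.
Definition dev (A : 'M[R]_d) : 'M[R]_d := A - (\tr A / d%:R)%:M.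

(* Vectors are rows, so that tau n is n *m tau^T. *)
Definition nn (tau : 'M[R]_d) (n : pt) : R := dot n (n *m tau^T).
Definition nt (tau : 'M[R]_d) (n : pt) : pt :=
  n *m tau^T - dot (n *m tau^T) n *: n.

Definition partial (i : 'I_d) (g : pt -> R) (x : pt) : R :=
  'D_(delta_mx 0 i) g x.
Definition grad (q : pt -> R) (x : pt) : pt := \row_j partial j q x.
Definition gradv (u : pt -> pt) (x : pt) : 'M[R]_d :=
  \matrix_(i, j) partial j (fun y => u y 0 i) x.
Definition divv (v : pt -> pt) (x : pt) : R :=
  \sum_i partial i (fun y => v y 0 i) x.
Definition divm (tau : pt -> 'M[R]_d) (x : pt) : pt :=
  \row_i \sum_j partial j (fun y => tau y i j) x.
Definition lapv (u : pt -> pt) (x : pt) : pt :=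
  \row_i \sum_j partial j (partial j (fun y => u y 0 i)) x.

Definition poly_le (k : nat) (g : pt -> R) : Prop :=
  exists c : {ffun 'I_d -> 'I_k.+1} -> R, forall x,
    g x = \sum_(a : {ffun 'I_d -> 'I_k.+1} | (\sum_i a i <= k)%N)
            c a * \prod_i x 0 i ^+ a i.
Definition polyv_le k (v : pt -> pt) := forall i, poly_le k (fun x => v x 0 i).
Definition polym_le k (tau : pt -> 'M[R]_d) :=
  forall i j, poly_le k (fun x => tau x i j).

Definition RT_poly (k : nat) (v : pt -> pt) : Prop :=
  exists a b, [/\ polyv_le k a, poly_le k b & forall x, v x = a x + b x *: x].

Definition C1 (psi : pt -> R) : Prop :=
  (forall x, differentiable psi x) /\ (forall i, continuous (partial i psi)).

(* C^1 functions with compact support in U. *)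
Definition test_fun (U : set pt) (psi : pt -> R) : Prop :=
  C1 psi /\ exists K : set pt,
    [/\ compact K, K `<=` U & forall x, ~ K x -> psi x = 0].

(* Boundary of an open set. *)
Definition bd (Omega : set pt) : set pt := closure Omega `\` Omega.

(* The polygonal/polyhedral shape comes from the triangulation; the last
   condition says that the domain lies on one side of its boundary (no slits).*)
Definition domain (Omega : set pt) : Prop :=
  [/\ Omega !=set0, open Omega, connected Omega, bounded_set Omega
    & (closure Omega)° = Omega].

End simplex_integral.

(* A simplex is identified with its set of vertices. *)
Record mesh (R : realType) (d : nat) := Mesh {
  vtx : finType;
  pos : vtx -> 'rV[R]_d;
  cells : {set {set vtx}} }.

Section mesh_theory.
Context {R : realType} {d : nat} (M : mesh R d).
Local Notation pt := 'rV[R]_d.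
Local Notation vtx := (vtx M).
Local Notation pos := (@pos R d M).
Local Notation cells := (cells M).
Local Notation simplex := {set vtx}.

Definition hull (A : simplex) : set pt :=
  [set x | exists w : vtx -> R,
    [/\ forall V, 0 <= w V, forall V, V \notin A -> w V = 0,
        \sum_V w V = 1 & x = \sum_V w V *: pos V]].

Definition aff_indep (A : simplex) : Prop :=
  forall w : vtx -> R, (forall V, V \notin A -> w V = 0) ->
    \sum_V w V = 0 -> \sum_V w V *: pos V = 0 -> forall V, w V = 0.

Definition triangulation (Omega : set pt) : Prop :=
  [/\ injective pos,
      forall T, T \in cells -> #|T| = d.+1 /\ aff_indep T,
      forall V, exists2 T, T \in cells & V \in T,
      forall T1 T2, T1 \in cells -> T2 \in cells ->
        hull T1 `&` hull T2 = hull (T1 :&: T2)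
    & closure Omega = \bigcup_(T in [set` cells]) hull T].

Definition faces_of (C : {set simplex}) : {set simplex} :=
  [set F : simplex | (#|F| == d) && [exists T in C, F \subset T]]%SET.
Definition faces := faces_of cells.
Definition cell_faces (T : simplex) := faces_of [set T]%SET.
Definition on_bd (Omega : set pt) (F : simplex) : bool :=
  `[< hull F `<=` bd Omega >].
Definition interior_faces (Omega : set pt) : {set simplex} :=
  [set F in faces | ~~ on_bd Omega F]%SET.

Definition vpatch (V : vtx) : {set simplex} := [set T in cells | V \in T]%SET.
Definition bd_vertex (Omega : set pt) (V : vtx) : bool :=
  `[< bd Omega (pos V) >].
Definition patch_faces (Omega : set pt) (V : vtx) : {set simplex} :=
  [set F in faces_of (vpatch V) | bd_vertex Omega V ==> ~~ on_bd Omega F]%SET.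

Definition vertices (m : nat) (A : simplex) (i : 'I_m.+1) : pt :=
  nth 0 [seq pos V | V <- enum A] i.
Definition cell_int (T : simplex) := simplex_int (@vertices d T).
Definition face_int (F : simplex) := simplex_int (@vertices d.-1 F).

Definition is_normal (T F : simplex) (n : pt) : Prop :=
  [/\ dot n n = 1,
      forall A B, A \in F -> B \in F -> dot n (pos A - pos B) = 0
    & forall A B, A \in T -> A \notin F -> B \in F -> dot n (pos A - pos B) < 0].
(* Outward unit normal of T on its face F. *)
Definition outer_normal (T F : simplex) : pt := xget 0 [set n | is_normal T F n].

(* With respect to a set C of cells (the mesh or a patch), T_1 of a face is an
   arbitrary but fixed adjacent cell in C, and the face normal points out of
   T_1. On a face with a single adjacent cell in C, the jump is the trace. *)
Definition cell1 (C : {set simplex}) (F : simplex) : simplex :=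
  odflt finset.set0 [pick T in C | F \subset T].
Definition face_normal (C : {set simplex}) (F : simplex) : pt :=
  outer_normal (cell1 C F) F.
Definition jump (W : zmodType) (C : {set simplex}) (F : simplex)
    (b : simplex -> W) : W :=
  \sum_(T in C | F \subset T) (if T == cell1 C F then b T else - b T).

(* Discontinuous (broken) fields: one function per cell, so that traces from
   either side of a face make sense. Only the values of the branch T on the
   cell T matter; a polynomial branch is extended to the whole space. *)
Definition sfield := simplex -> pt -> R.
Definition vfield := simplex -> pt -> pt.
Definition mfield := simplex -> pt -> 'M[R]_d.

Definition Pk_s k (q : sfield) := forall T, T \in cells -> poly_le k (q T).
Definition Pk_v k (v : vfield) := forall T, T \in cells -> polyv_le k (v T).
Definition Pk_m k (tau : mfield) := forall T, T \in cells -> polym_le k (tau T).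

Definition omega_int (g : sfield) : R := \sum_(T in cells) cell_int T (g T).
Definition ip_s (p q : sfield) := omega_int (fun T x => p T x * q T x).
Definition ip_v (u v : vfield) := omega_int (fun T x => dot (u T x) (v T x)).
Definition ip_m (s t : mfield) := omega_int (fun T x => frob (s T x) (t T x)).

Definition L2_s (q : sfield) : Prop :=
  forall T, T \in cells -> simplex_L2 (@vertices d T) (q T).
Definition L2_v (v : vfield) : Prop := forall i, L2_s (fun T x => v T x 0 i).

(* For U = Omega: w is the weak divergence of v in Omega. For U = setT the
   boundary term of Green's formula vanishes as well, i.e. in addition v has
   vanishing normal trace on the boundary of Omega. *)
Definition has_div (U : set pt) (v : vfield) (w : sfield) : Prop :=
  forall psi, test_fun U psi ->
    ip_v v (fun _ => grad psi) + ip_s w (fun _ => psi) = 0.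
Definition H0_div (v : vfield) : Prop :=
  L2_v v /\ exists2 w, L2_s w & has_div setT v w.

(* Test functions that do not vanish on the boundary of Omega express in the
   same way that the trace is zero. *)
Definition H10_s (u : sfield) : Prop :=
  L2_s u /\ exists g : vfield, L2_v g /\
    forall psi, test_fun setT psi -> forall j,
      ip_s u (fun _ => partial j psi) + ip_s (fun T x => g T x 0 j) (fun _ => psi)
      = 0.
Definition H10_v (u : vfield) : Prop := forall i, H10_s (fun T x => u T x 0 i).

(* L^2-projection onto piecewise polynomials of degree r - 2. *)
Definition proj_cell (j : nat) (T : simplex) (g : pt -> R) : pt -> R :=
  xget (fun _ => 0) [set p : pt -> R | poly_le j p /\
    forall q, poly_le j q -> cell_int T (fun x => (g x - p x) * q x) = 0].
Definition proj_sub2 (r : nat) (f : pt -> pt) : vfield := fun T x =>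
  if (r < 2)%N then 0
  else \row_i proj_cell (r - 2) T (fun y => f y 0 i) x.

Definition Sigma_h (Omega : set pt) (k : nat) (tau : mfield) : Prop :=
  [/\ Pk_m k tau,
      forall T x, T \in cells -> hull T x -> \tr (tau T x) = 0
    & forall F x, F \in interior_faces Omega -> hull F x ->
        jump cells F (fun T => nt (tau T x) (face_normal cells F)) = 0].

Definition V_h (k : nat) (v : vfield) : Prop :=
  (forall T, T \in cells -> RT_poly k (v T)) /\ H0_div v.

Definition pairing (tau : mfield) (v : vfield) : R :=
  \sum_(T in cells) cell_int T (fun x => dot (divm (tau T) x) (v T x)) -
  \sum_(F in faces) face_int F (fun x =>
    jump cells F (fun T => nn (tau T x) (face_normal cells F)) *
    dot (v (cell1 cells F) x) (face_normal cells F)).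

Section primal.
Variables (Omega : set pt) (nu : R) (f : pt -> pt) (r : nat).
Variables (Vb : set vfield) (Qb : set sfield) (Rec : vfield -> vfield).

Definition grad_f (u : vfield) : mfield := fun T => gradv (u T).
Definition div_f (u : vfield) : sfield := fun T => divv (u T).
Definition fun_f (g : pt -> pt) : vfield := fun _ => g.

Definition fe_velocity_space : Prop :=
  [/\ exists m, forall v, Vb v -> Pk_v m v,
      forall v, Vb v -> H10_v v,
      Vb (fun _ _ => 0)
    & forall a u v, Vb u -> Vb v -> Vb (fun T x => a *: u T x + v T x)].

Definition fe_pressure_space : Prop :=
  [/\ exists m, forall q, Qb q -> Pk_s m q,
      forall q, Qb q -> omega_int q = 0,
      Qb (fun _ _ => 0)
    & forall a p q, Qb p -> Qb q -> Qb (fun T x => a * p T x + q T x)].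

Definition inf_sup_stable : Prop :=
  exists2 beta : R, 0 < beta & forall q, Qb q -> 0 < ip_s q q ->
    exists v, [/\ Vb v, 0 < ip_m (grad_f v) (grad_f v)
      & beta * Num.sqrt (ip_m (grad_f v) (grad_f v)) * Num.sqrt (ip_s q q)
        <= ip_s (div_f v) q].

Definition reconstruction : Prop :=
  [/\ forall v, Vb v -> L2_v (Rec v) /\ exists w, [/\ Qb w,
        has_div Omega (Rec v) w
        & forall q, Qb q -> ip_s (div_f v) q = ip_s w q],
      forall v, Vb v -> (forall q, Qb q -> ip_s (div_f v) q = 0) ->
        has_div Omega (Rec v) (fun _ _ => 0),
      forall v, Vb v ->
        ip_v (fun_f f) (fun T x => v T x - Rec v T x) =
        ip_v (fun T x => f x - proj_sub2 r f T x) (fun T x => v T x - Rec v T x)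
    & forall v, Pk_v 1 v -> H10_v v -> Vb v /\
        forall T x, T \in cells -> hull T x -> Rec v T x = v T x].

Definition primal_solution (ub : vfield) (pb : sfield) : Prop :=
  [/\ Vb ub, Qb pb,
      forall v, Vb v ->
        nu * ip_m (grad_f ub) (grad_f v) - ip_s (div_f v) pb =
        ip_v (fun_f f) (Rec v)
    & forall q, Qb q -> ip_s (div_f ub) q = 0].

End primal.

(* Hat function of V on T, the affine function with the right vertex values. *)
Definition hat (V : vtx) (T : simplex) : pt -> R :=
  xget (fun _ => 0) [set p : pt -> R | poly_le 1 p /\
    forall W, W \in T -> p (pos W) = (W == V)%:R].

(* Principal lattice of order k of the simplex T. *)
Definition lattice (k : nat) (T : simplex) : set pt :=
  [set z | exists a : vtx -> nat, [/\ forall W, W \notin T -> a W = 0%N,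
    (\sum_W a W = k)%N & z = \sum_W ((a W)%:R / k%:R) *: pos W]].
Definition lagrange (k : nat) (T : simplex) (g : pt -> R) : pt -> R :=
  xget (fun _ => 0) [set p : pt -> R | poly_le k p /\
    forall z, lattice k T z -> p z = g z].
Definition bubble (k : nat) (V : vtx) (v : vfield) : vfield := fun T x =>
  \row_i lagrange k T (fun y => hat V T y * v T y 0 i) x.

Section local_problem.
Variables (Omega : set pt) (nu : R) (f : pt -> pt) (k : nat).
Variables (ub : vfield) (pb : sfield) (V : vtx).
Local Notation TV := (vpatch V).
Local Notation FV := (patch_faces Omega V).
Local Notation nF := (face_normal TV).

Definition stress_f : mfield := fun T x => nu *: gradv (ub T) x.

Definition patch_int (g : sfield) : R := \sum_(T in TV) cell_int T (g T).

Definition SigmaV (tau : mfield) : Prop :=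
  forall T, T \in TV ->
    polym_le k (tau T) /\ forall x, hull T x -> \tr (tau T x) = 0.

Definition VV (v : vfield) : Prop :=
  (forall T, T \in TV -> RT_poly k (v T)) /\
  forall F T1 T2 x, F \in faces_of TV -> T1 \in TV -> T2 \in TV ->
    F \subset T1 -> F \subset T2 -> hull F x ->
    dot (v T1 x) (nF F) = dot (v T2 x) (nF F).

(* Here the index of the field is a face. *)
Definition VhatV (vh : vfield) : Prop :=
  forall F, F \in FV -> polyv_le k (vh F) /\
    forall x, hull F x -> dot (vh F x) (nF F) = 0.

Definition QV (q : sfield) : Prop := forall T, T \in TV -> poly_le k (q T).

Definition patch_mean (v vh : vfield) : pt := \row_i
  ((\sum_(T in TV) cell_int T (fun=> 1) + \sum_(F in FV) face_int F (fun=> 1))^-1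
   * (\sum_(T in TV) cell_int T (fun x => v T x 0 i) +
      \sum_(F in FV) face_int F (fun x => vh F x 0 i))).

Definition XV (v vh : vfield) : Prop :=
  [/\ VV v, VhatV vh & ~~ bd_vertex Omega V -> patch_mean v vh = 0].

Definition pairingV (tau : mfield) (v vh : vfield) : R :=
  \sum_(T in TV) cell_int T (fun x => dot (divm (tau T) x) (v T x)) -
  \sum_(F in FV)
    (face_int F (fun x => jump TV F (fun T => nn (tau T x) (nF F)) *
                          dot (v (cell1 TV F) x) (nF F)) +
     face_int F (fun x => dot (jump TV F (fun T => nt (tau T x) (nF F)))
                              (vh F x))).

(* On the facets removed from FV there is no vh, hence no contribution. *)
Definition residual (v vh : vfield) : R :=
  \sum_(T in TV)
    (cell_int T (fun x =>
       dot (f x + nu *: lapv (ub T) x - grad (pb T) x) (bubble k V v T x)) -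
     \sum_(F in cell_faces T) face_int F (fun x =>
       nn (stress_f T x - (pb T x)%:M) (outer_normal T F) *
       dot (bubble k V v T x) (outer_normal T F)) -
     \sum_(F in cell_faces T | F \in FV) face_int F (fun x =>
       dot (hat V T x *: nt (stress_f T x) (outer_normal T F)) (vh F x))).

Definition local_solution (s : mfield) (u uh : vfield) (p : sfield) : Prop :=
  [/\ SigmaV s /\ XV u uh /\ QV p,
      forall tau, SigmaV tau ->
        patch_int (fun T x => frob (s T x) (tau T x)) + pairingV tau u uh = 0,
      forall v vh, XV v vh ->
        pairingV s v vh + patch_int (fun T x => divv (v T) x * p T x) =
        residual v vh
    & forall q, QV q -> patch_int (fun T x => divv (u T) x * q T x) = 0].

End local_problem.

(* The sum of the local stresses, each extended by zero outside its patch. *)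
Definition stress_delta (s : vtx -> mfield) : mfield := fun T x =>
  \sum_V (if T \in vpatch V then s V T x else 0).

Definition stress_LEQ (nu : R) (ub : vfield) (s : vtx -> mfield) : mfield :=
  fun T x => stress_f nu ub T x - stress_delta s T x.

End mesh_theory.

Arguments fun_f {R d} M g.

(* Main.v *)
Require Import Defs.
From HB Require Import structures.
From mathcomp Require Import all_boot all_order all_algebra.
From mathcomp Require Import all_classical all_reals all_analysis.
From mathcomp Require Import perm measurable_realfun ring lra zify.
Set Implicit Arguments.
Unset Strict Implicit.
Unset Printing Implicit Defensive.
Import Order.TTheory GRing.Theory Num.Theory numFieldNormedType.Exports.
Local Open Scope classical_set_scope.
Local Open Scope ring_scope.

Local Notation coord := Defs.coord.

(* Summed over all vertices V, the hat functions phi_V give 1 and the bubble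
   projections of v in P_k give v. A divergence-free v in RT_k is in P_k and has
   continuous normal components, hence is an admissible test function of every
   local problem, and the sum of the local equations says that div sigma^Delta
   equals the residual of the primal method on v; the pressure terms cancel by
   Green's formula. Testing instead with the tangential jump w of sigma^LEQ on
   one interior face yields that the integral of |w|^2 vanishes.
   On an interior vertex patch only test functions of zero mean are allowed. The
   missing ones, (c, c_t) with c constant, satisfy the local equation by the
   primal equation for phi_V c, which the reconstruction leaves unchanged. *)

(** * Integration over simplices *)

Section beta_integral.
Context {R : realType}.
Implicit Types (s t : R) (P : {poly R}).

(** The hypothesis [has_div setT] is a weak statement, while the local problems ask for pointwise
    traces. The gap is closed by test functions q b, where b is a C^1 bump and q is the polynomial
    to be shown zero (the divergence, or the sum of the outward normal components at a facet), so
    that a square appears under the integral. This requires Green's formula for C^1 functions on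
    cells, hence the integration theory: exact integrals of barycentric monomials, transferred by
    approximation in C^1. The degree matters. [RT_poly k] contains fields of degree k + 1, on which
    nodal interpolation into P_k is not exact; the bubbles of a field are known to sum up to it only
    once its vanishing divergence has removed the top degree. At a boundary vertex the facets in the
    boundary of the domain are missing from the patch problem. They reappear when whole cells are
    summed, and disappear only because the normal trace is zero there. This rests on a boundary
    facet having a single adjacent cell, which is where slits in the domain are excluded. *)

Lemma integral_deriv_poly P s : 0 <= s ->
  (\int[lebesgue_measure]_(t in `[0%R, s]) (P^`().[t])%:E = (P.[s] - P.[0])%:E)%E.
Proof.
rewrite le_eqVlt => /predU1P[<-|s0].
  by rewrite set_itv1 integral_set1 subrr.
rewrite (@continuous_FTC2 R (horner P^`()) (horner P)) // ?EFinB//.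
- by apply: continuous_subspaceT => x; exact: continuous_horner.
- split.
  + by move=> x _; exact: derivable_horner.
  + by apply: cvg_at_right_filter; exact: continuous_horner.
  + by apply: cvg_at_left_filter; exact: continuous_horner.
- by move=> x _; rewrite -derivE.
Qed.

(** Induction on [a] by integration by parts, each step trading one power of ['X] for one of
    [s%:P - 'X]. A polynomial primitive reduces the beta integral to the fundamental theorem of
    calculus. *)
Lemma beta_primitive (a b : nat) s : exists P : {poly R},
  P^`() = 'X^a * (s%:P - 'X) ^+ b /\
  P.[s] - P.[0] = s ^+ (a + b).+1 * (a`! * b`!)%:R / (a + b).+1`!%:R.
Proof.
elim: a b => [|a IH] b.
  exists (- (b.+1%:R^-1) *: (s%:P - 'X) ^+ b.+1); split.
    rewrite derivZ deriv_exp derivB derivC derivX sub0r mulN1r -pred_Sn expr0 mul1r.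
    have hb : (b.+1%:R^-1)%:P * b.+1%:R = 1 :> {poly R}.
      by rewrite -polyC_natr -polyCM mulVf ?pnatr_eq0.
    rewrite -!mul_polyC polyCN -[(- _) *+ _]mulr_natl /=.
    transitivity ((s%:P - 'X) ^+ b * ((b.+1%:R^-1)%:P * b.+1%:R)); first by ring.
    by rewrite hb mulr1.
  rewrite !hornerE /= subrr expr0n /= ?mulr0 ?subr0 sub0r.
  have hf : b`!%:R != 0 :> R by rewrite pnatr_eq0 -lt0n fact_gt0.
  rewrite factS !natrM exprS. by field; rewrite hf addrC natr1 pnatr_eq0.
have [P [dP P0]] := IH b.+1.
exists (- (b.+1%:R^-1) *: ('X^(a.+1) * (s%:P - 'X) ^+ b.+1)
        + (a.+1%:R / b.+1%:R) *: P); split.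
  rewrite derivD !derivZ derivM derivXn deriv_exp derivB derivC derivX sub0r dP.
  rewrite /= mulN1r.
  rewrite -!mul_polyC polyCM polyCN !polyC_natr.
  have hb : (b.+1%:R^-1)%:P * b.+1%:R = 1 :> {poly R}.
    by rewrite -polyC_natr -polyCM mulVf ?pnatr_eq0.
  rewrite -[(- _) *+ _]mulr_natl -['X^_ *+ _]mulr_natl /= !exprS.
  transitivity ('X * 'X^a * (s%:P - 'X) ^+ b * ((b.+1%:R^-1)%:P * b.+1%:R)).
    by ring.
  by rewrite hb mulr1.
rewrite [X in X = _](_ : _ = a.+1%:R / b.+1%:R * (P.[s] - P.[0])); last first.
  by rewrite !hornerE /= ?subrr !exprS ?mul0r ?mulr0 ?mul0r ?addr0 ?add0r mulrBr.
rewrite P0 addSnnS.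
have hb : b.+1%:R != 0 :> R by rewrite pnatr_eq0.
have hc : (a + b.+1).+1`!%:R != 0 :> R by rewrite pnatr_eq0 -lt0n fact_gt0.
move: hc; move: ((a + b.+1).+1`!%:R) => N hc.
rewrite [b.+1`!]factS [a.+1`!]factS !natrM exprS.
by field; rewrite hc addrC natr1 hb.
Qed.

Lemma beta_integral (a b : nat) s : 0 <= s ->
  (\int[lebesgue_measure]_(t in `[0%R, s]) ((t ^+ a * (s - t) ^+ b)%R)%:E =
   (s ^+ (a + b).+1 * (a`! * b`!)%:R / (a + b).+1`!%:R)%:E)%E.
Proof.
move=> s0; have [P [dP P0]] := beta_primitive a b s.
rewrite -P0 -integral_deriv_poly//; apply: eq_integral => t _.
by rewrite dP !hornerE.
Qed.

End beta_integral.

(** * Dirichlet integrals by slicing the simplex *)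

Section simplex_measure.
Context {R : realType}.

Lemma measurable_coord m i : measurable_fun setT (fun y : Rn R m => coord y i).
Proof.
elim: m i => [|m IH] i /=; first exact: measurable_cst.
case: i => [|i]; first exact: measurable_fst.
exact: (measurableT_comp (IH i) measurable_snd).
Qed.

Lemma measurable_sum_coord m :
  measurable_fun setT (fun y : Rn R m => \sum_(i < m) coord y i).
Proof. by apply: measurable_sum => i; exact: measurable_coord. Qed.

(** The size is variable because fixing the first coordinate at [t] leaves a simplex of size
    [s - t]. *)
Definition scaled_simplex m (s : R) : set (Rn R m) :=
  [set y | (forall i, 0 <= coord y i) /\ \sum_(i < m) coord y i <= s].

Lemma coord_oversize m (y : Rn R m) i : (m <= i)%N -> coord y i = 0.
Proof. by elim: m y i => [|m IH] y [|i] //=; exact: IH. Qed.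

Lemma scaled_simplexE m s : scaled_simplex s =
  (\bigcap_(i < m) [set y : Rn R m | 0 <= coord y i])
  `&` [set y | \sum_(i < m) coord y i <= s].
Proof.
apply/seteqP; split=> y [h1 h2]; split=> //; first by move=> i _; exact: h1.
move=> i; have [im|mi] := ltnP i m; last by rewrite coord_oversize.
exact: (h1 i im).
Qed.

Lemma measurable_scaled_simplex m s : measurable (@scaled_simplex m s).
Proof.
rewrite scaled_simplexE; apply: measurableI.
  apply: fin_bigcap_measurable => [|i _]; first exact: finite_II.
  have := @measurable_coord m i measurableT `[0, +oo[%classic (measurable_itv _).
  by rewrite setTI; congr (measurable _); apply/seteqP; split=> y /=;
    rewrite in_itv/= andbT.
have := @measurable_sum_coord m measurableT `]-oo, s]%classic (measurable_itv _).
by rewrite setTI; congr (measurable _); apply/seteqP; split=> y /=; rewrite in_itv.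
Qed.

Lemma scaled_simplexS m s (t : R) (y : Rn R m) :
  @scaled_simplex m.+1 s (t, y) <-> 0 <= t /\ scaled_simplex (s - t) y.
Proof.
rewrite /scaled_simplex /= big_ord_recl /=; split.
  move=> [h1 h2]; split; first exact: (h1 0%N).
  split; first by move=> i; exact: (h1 i.+1).
  by rewrite lerBrDl.
move=> [t0 [h1 h2]]; split; first by case.
by rewrite -lerBrDl.
Qed.

(** For [s = 1] the last base is the barycentric coordinate of the vertex at the origin. The family
    is stable under fixing the first coordinate, as the induction on the dimension requires. *)
Definition smono m (a : nat -> nat) (b : nat) (s : R) (y : Rn R m) : R :=
  (\prod_(i < m) coord y i ^+ a i) * (s - \sum_(i < m) coord y i) ^+ b.

Lemma smonoS m a b s t (y : Rn R m) :
  @smono m.+1 a b s (t, y) = t ^+ a 0%N * smono (a \o S) b (s - t) y.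
Proof.
rewrite /smono !big_ord_recl /= mulrA; congr (_ * _ ^+ _).
by rewrite opprD addrA.
Qed.

Lemma smono_ge0 m a b s (y : Rn R m) : scaled_simplex s y -> 0 <= smono a b s y.
Proof.
move=> [y0 ys]; apply: mulr_ge0; last by rewrite exprn_ge0 // subr_ge0.
by apply: prodr_ge0 => i _; rewrite exprn_ge0.
Qed.

Lemma measurable_smono m a b s : measurable_fun setT (@smono m a b s).
Proof.
apply: measurable_funM.
  by apply: measurable_prod => i _; apply: measurable_funX; exact: measurable_coord.
apply: measurable_funX; apply: measurable_funB; first exact: measurable_cst.
exact: measurable_sum_coord.
Qed.

(** Dirichlet's formula. By Tonelli and induction, the slice at first coordinate [t] contributes a
    constant times a power of [t] and a power of [s - t], and a beta integral remains. *)
Lemma dirichlet_integral m (a : nat -> nat) b s : 0 <= s ->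
  (\int[lebn R m]_(y in scaled_simplex s) (smono a b s y)%:E =
   (s ^+ (m + \sum_(i < m) a i + b)
    * ((\prod_(i < m) (a i)`!) * b`!)%:R / (m + \sum_(i < m) a i + b)`!%:R)%:E)%E.
Proof.
elim: m a b s => [|m IH] a b s s0.
  rewrite (_ : scaled_simplex s = setT); last first.
    by apply/seteqP; split=> // -[] _; split => [i|]; rewrite ?big_ord0.
  rewrite /= integral_dirac// diracT mul1e.
  rewrite /smono !big_ord0 subr0 !mul1r add0n mul1n mulfK//.
pose f (z : Rn R m.+1) :=
  (((EFin \o @smono m.+1 a b s) \_ (scaled_simplex s)) z : \bar R).
have mf : measurable_fun setT f.
  apply/(measurable_restrictT _ _).1; first exact: measurable_scaled_simplex.
  apply: measurable_funTS; apply/measurable_EFinP; exact: measurable_smono.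
have f0 z : (0 <= f z)%E.
  rewrite /f patchE; case: ifPn => // /set_mem sz.
  by rewrite lee_fin smono_ge0.
rewrite integral_mkcond.
transitivity (\int[lebesgue_measure]_t \int[lebn R m]_y f (t, y))%E.
  exact: (@fubini_tonelli1 _ _ (measurableTypeR R) (Rn R m) R lebesgue_measure (lebn R m) f mf f0).
transitivity (\int[lebesgue_measure]_(t in `[0%R, s])
   ((t ^+ a 0%N * (s - t) ^+ (m + \sum_(i < m) (a \o S) i + b)) *
    (((\prod_(i < m) ((a \o S) i)`!) * b`!)%:R /
        (m + \sum_(i < m) (a \o S) i + b)`!%:R))%:E)%E.
  rewrite [RHS]integral_mkcond; apply: eq_integral => t _ /=.
  rewrite patchE; case: ifPn => [/set_mem /=|/negP nts].
    rewrite in_itv/= => /andP[t0 ts].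
    transitivity ((t ^+ a 0%N)%:E * \int[lebn R m]_(y in scaled_simplex (s - t))
      (smono (a \o S) b (s - t) y)%:E)%E; last first.
      by rewrite IH ?subr_ge0// -EFinM !mulrA.
    rewrite -ge0_integralZl_EFin ?exprn_ge0//; last 3 first.
    - exact: measurable_scaled_simplex.
    - by move=> y sy; rewrite lee_fin smono_ge0.
    - apply: measurable_funTS; apply/measurable_EFinP; exact: measurable_smono.
    rewrite [RHS]integral_mkcond; apply: eq_integral => y _.
    rewrite /f !patchE /= -EFinM smonoS.
    case: ifPn => [/set_mem/scaled_simplexS[_ /mem_set ->]//|/negP h].
    by case: ifPn => // /set_mem h'; case: h; apply/mem_set/scaled_simplexS.
  rewrite integral0_eq// => y _; rewrite /f patchE; case: ifPn => // /set_mem.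
  move=> /scaled_simplexS[t0 [y0 ys]]; case: nts; apply/mem_set => /=.
  rewrite in_itv/= t0 -subr_ge0 (le_trans _ ys)// sumr_ge0//.
transitivity ((((\prod_(i < m) ((a \o S) i)`!) * b`!)%:R /
        (m + \sum_(i < m) (a \o S) i + b)`!%:R)%:E *
 \int[lebesgue_measure]_(t in `[0%R, s])
   ((t ^+ a 0%N * (s - t) ^+ (m + \sum_(i < m) (a \o S) i + b))%:E))%E.
  rewrite -ge0_integralZl_EFin ?divr_ge0//; last 2 first.
  - by move=> t /=; rewrite in_itv/= => /andP[t0 ts];
      rewrite lee_fin mulr_ge0 ?exprn_ge0 ?subr_ge0.
  - apply/measurable_EFinP; apply: measurable_funM; apply: measurable_funX => //.
    exact: measurable_funB.
  by apply: eq_integral => t _; rewrite -EFinM mulrC.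
rewrite beta_integral// -EFinM; congr (EFin _).
rewrite (big_ord_recl m a) (big_ord_recl m (fun i => (a i)`!)) /=.
rewrite -[(\sum_(i < m) a (bump 0 i))%N]/(\sum_(i < m) (a \o S) i)%N.
rewrite -[(\prod_(i < m) (a (bump 0 i))`!)%N]/(\prod_(i < m) ((a \o S) i)`!)%N.
move: (\sum_(i < m) _)%N (\prod_(i < m) _)%N => S P.
have -> : (m.+1 + (a 0%N + S) + b = (a 0%N + (m + S + b)).+1)%N by lia.
have h1 : (m + S + b)`!%:R != 0 :> R by rewrite pnatr_eq0 -lt0n fact_gt0.
have h2 : (a 0 + (m + S + b)).+1`!%:R != 0 :> R by rewrite pnatr_eq0 -lt0n fact_gt0.
rewrite (natrM R (a 0%N)`!) (natrM R P) (natrM R ((a 0%N)`! * P)%N).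
move: h1 h2; move: ((m + S + b)`!%:R) ((a 0 + (m + S + b)).+1`!%:R) => u v u0 v0.
by rewrite !natrM; field; rewrite u0 v0.
Qed.

End simplex_measure.

(** * Barycentric monomials and their divergence theorem *)

Section barycentric_monomials.
Context {R : realType}.

Section fixed_dim.
Context {m : nat}.
Implicit Types (a : 'I_m.+1 -> nat) (l : 'I_m.+1 -> R).
Local Notation ref := (@ref_simplex R m).

(** Vertex [ord0] is the base point of [simplex_param] and hence carries the dependent
    coordinate. *)
Definition bary_coord (y : Rn R m) (i : 'I_m.+1) : R :=
  if unlift ord0 i is Some j then coord y j else 1 - \sum_(j < m) coord y j.

Lemma bary_coord0 y : bary_coord y ord0 = 1 - \sum_(j < m) coord y j.
Proof. by rewrite /bary_coord unlift_none. Qed.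

Lemma bary_coordS y j : bary_coord y (lift ord0 j) = coord y j.
Proof. by rewrite /bary_coord liftK. Qed.

Lemma bary_coord_sum y : \sum_i bary_coord y i = 1.
Proof.
rewrite big_ord_recl bary_coord0 (eq_bigr _ (fun j _ => bary_coordS y j)).
exact: subrK.
Qed.

Lemma bary_coord_ge0 y i : ref y -> 0 <= bary_coord y i.
Proof.
move=> [y0 y1]; case: (unliftP ord0 i) => [j|] ->.
  by rewrite bary_coordS.
by rewrite bary_coord0 subr_ge0.
Qed.

Lemma measurable_bary_coord i : measurable_fun setT (bary_coord^~ i).
Proof.
case: (unliftP ord0 i) => [j|] ->.
  rewrite (_ : bary_coord^~ _ = fun y => coord y j); first exact: measurable_coord.
  by apply/funext => y; rewrite bary_coordS.
rewrite (_ : bary_coord^~ _ = fun y => 1 - \sum_(j < m) coord y j); last first.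
  by apply/funext => y; rewrite bary_coord0.
by apply: measurable_funB => //; exact: measurable_sum_coord.
Qed.

Lemma measurable_ref_simplex : measurable ref.
Proof. exact: (measurable_scaled_simplex m 1). Qed.

Definition mono a l : R := \prod_i l i ^+ a i.

Lemma mono_bary_ge0 a y : ref y -> 0 <= mono a (bary_coord y).
Proof. by move=> hy; apply: prodr_ge0 => i _; rewrite exprn_ge0 ?bary_coord_ge0. Qed.

Lemma measurable_mono a : measurable_fun setT (fun y => mono a (bary_coord y)).
Proof.
by apply: measurable_prod => i _; apply: measurable_funX; exact: measurable_bary_coord.
Qed.

Lemma mono_integral a :
  (\int[lebn R m]_(y in ref) (mono a (bary_coord y))%:E =
   ((\prod_i (a i)`!)%:R / (m + \sum_i a i)`!%:R)%:E)%E.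
Proof.
pose a' i := if insub i is Some j then a (lift ord0 (j : 'I_m)) else 0%N.
have a'E (i : 'I_m) : a' i = a (lift ord0 i) by rewrite /a' valK.
have := @dirichlet_integral R m a' (a ord0) 1 ler01.
rewrite expr1n mul1r (eq_bigr _ (fun j _ => a'E j)).
rewrite (eq_bigr (fun j => (a (lift ord0 j))`!) (fun j _ => congr1 _ (a'E j))) => H.
rewrite !big_ord_recl [(a _ + _)%N]addnC addnA [((a ord0)`! * _)%N]mulnC -H.
apply: eq_integral => y _; congr (_%:E).
rewrite /mono /smono big_ord_recl bary_coord0 mulrC; congr (_ * _).
by apply: eq_bigr => i _; rewrite bary_coordS a'E.
Qed.

Lemma integrable_mono a :
  (lebn R m).-integrable ref (EFin \o (fun y => mono a (bary_coord y))).
Proof.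
apply/integrableP; split.
  apply/measurable_EFinP/measurable_funTS; exact: measurable_mono.
under eq_integral => y /set_mem yr.
  rewrite /= ger0_norm ?mono_bary_ge0//; over.
by rewrite mono_integral ltry.
Qed.

Lemma Rintegral_mono a : \int[lebn R m]_(y in ref) mono a (bary_coord y) =
   (\prod_i (a i)`!)%:R / (m + \sum_i a i)`!%:R.
Proof. by rewrite /Rintegral mono_integral. Qed.

(** The partial derivative in [l i], with the barycentric coordinates treated as independent
    variables. If [a i] is zero the truncated exponent does no harm, as the factor vanishes. *)
Definition dmono i a l : R := (a i)%:R * mono (fun j => (a j - (j == i))%N) l.

Lemma integrable_dmono i a :
  (lebn R m).-integrable ref (EFin \o (fun y => dmono i a (bary_coord y))).
Proof.
have := integrableZl measurable_ref_simplex (a i)%:R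
  (integrable_mono (fun j => (a j - (j == i))%N)).
by congr (integrable _ _ _).
Qed.

(** A list of coefficients and exponents, so that the derivative [dbpoly] is formal. *)
Definition bpoly (s : seq (R * ('I_m.+1 -> nat))) l : R :=
  \sum_(t <- s) t.1 * mono t.2 l.

(** The derivative along the edge from vertex [j] to vertex [i]. A difference of two partial
    derivatives does not depend on values off the plane where the coordinates sum to one. *)
Definition dbpoly i j (s : seq (R * ('I_m.+1 -> nat))) l : R :=
  \sum_(t <- s) t.1 * (dmono i t.2 l - dmono j t.2 l).

End fixed_dim.

Lemma integrable_Rsum m (I : Type) (s : seq I) (F : I -> Rn R m -> R) :
  (forall i, (lebn R m).-integrable (@ref_simplex R m) (EFin \o F i)) ->
  (lebn R m).-integrable (@ref_simplex R m) (EFin \o (fun y => \sum_(i <- s) F i y)) /\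
  \int[lebn R m]_(y in @ref_simplex R m) (\sum_(i <- s) F i y) =
  \sum_(i <- s) \int[lebn R m]_(y in @ref_simplex R m) F i y.
Proof.
move=> hF; elim: s => [|i s [IH1 IH2]].
  have -> : (fun y => \sum_(i <- [::]) F i y) = cst 0.
    by apply/funext => y; rewrite big_nil.
  split; first exact: integrable0.
  by rewrite big_nil /Rintegral integral0.
have -> : (fun y => \sum_(j <- i :: s) F j y) =
    (fun y => F i y + \sum_(j <- s) F j y).
  by apply/funext => y; rewrite big_cons.
split; last by rewrite big_cons RintegralD//; [rewrite IH2|exact: measurable_ref_simplex].
have := integrableD measurable_ref_simplex (hF i) IH1.
by congr (integrable _ _ _).
Qed.

(** Embeds the barycentric coordinates of the face opposite to vertex [b]. *)
Definition insert0 m (b : 'I_m.+2) (l : 'I_m.+1 -> R) (i : 'I_m.+2) : R :=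
  if unlift b i is Some j then l j else 0.

Lemma mono_insert0 m (b : 'I_m.+2) (a : 'I_m.+2 -> nat) l :
  mono a (insert0 b l) = if a b == 0%N then mono (a \o lift b) l else 0.
Proof.
rewrite /mono (bigD1 b)//= {1}/insert0 unlift_none.
case: eqP => [->|/eqP ab]; last by rewrite expr0n (negbTE ab) mul0r.
rewrite expr0 mul1r.
rewrite (reindex_omap (lift b) (unlift b)) /=; last first.
  by move=> i ib; case: unliftP ib => [j ->|->]; rewrite ?eqxx.
apply: eq_big => [j|j _]; first by rewrite eq_sym neq_lift liftK eqxx.
by rewrite /insert0 liftK.
Qed.

(** The dimension is one higher and the degree one lower than for the monomial on a face, so the
    denominator is the same (m + |a|)! as in [face_mono_integral]. *)
Lemma dmono_integral m (a : 'I_m.+2 -> nat) i :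
  \int[lebn R m.+1]_(y in @ref_simplex R m.+1) dmono i a (bary_coord y) =
  (0 < a i)%N%:R * ((\prod_j (a j)`!)%:R / (m + \sum_j a j)`!%:R).
Proof.
rewrite /dmono RintegralZl//; last 2 first.
- exact: measurable_ref_simplex.
- exact: integrable_mono.
case: posnP => [->|ai]; first by rewrite !mul0r.
rewrite mul1r Rintegral_mono.
rewrite [in LHS](bigD1 i)//= [in RHS](bigD1 i)//= eqxx.
rewrite (eq_bigr (fun j => (a j)`!)) => [|j /negbTE->]; last by rewrite subn0.
rewrite mulrA -natrM mulnA subn1 -{1}(prednK ai) -factS prednK//.
congr (_ / _`!%:R).
rewrite (bigD1 i)//= [in RHS](bigD1 i)//= eqxx.
rewrite (eq_bigr a) => [|j /negbTE->]; last by rewrite subn0.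
by lia.
Qed.

Lemma face_mono_integral m (a : 'I_m.+2 -> nat) i :
  \int[lebn R m]_(y in @ref_simplex R m) mono a (insert0 i (bary_coord y)) =
  (a i == 0)%N%:R * ((\prod_j (a j)`!)%:R / (m + \sum_j a j)`!%:R).
Proof.
under eq_Rintegral do rewrite mono_insert0.
case: eqP => ai; last by rewrite mul0r /Rintegral integral0.
rewrite mul1r Rintegral_mono.
(* Index [i] drops out of the product of factorials and of the sum of exponents, since [a i] is 0
   and 0! = 1; a general monoid law covers both. *)
have E (idx : nat) (op : Monoid.com_law idx) (F : nat -> nat) : F 0%N = idx ->
    \big[op/idx]_j F (a j) = \big[op/idx]_j F ((a \o lift i) j).
  move=> F0; rewrite (bigD1 i)//= ai F0 Monoid.mul1m.
  rewrite (reindex_omap (lift i) (unlift i)) /=; last first.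
    by move=> j ji; case: unliftP ji => [k ->|->]; rewrite ?eqxx.
  by apply: eq_bigl => j; rewrite eq_sym neq_lift liftK eqxx.
by rewrite (E _ _ factorial)// (E _ _ id).
Qed.

(* The divergence theorem for monomials: with C = prod a_l! / (m + |a|)!, the
   integral of the i-th derivative over the simplex is [a_i > 0] C and that over
   the face opposite to i is [a_i = 0] C, so that their sum does not depend on i. *)
Lemma bpoly_gauss m (s : seq (R * ('I_m.+2 -> nat))) (i j : 'I_m.+2) :
  \int[lebn R m.+1]_(y in @ref_simplex R m.+1) dbpoly i j s (bary_coord y) =
  \int[lebn R m]_(y in @ref_simplex R m) bpoly s (insert0 j (bary_coord y)) -
  \int[lebn R m]_(y in @ref_simplex R m) bpoly s (insert0 i (bary_coord y)).
Proof.
have hI (a : 'I_m.+2 -> nat) k :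
    (lebn R m).-integrable (@ref_simplex R m)
      (EFin \o (fun y => mono a (insert0 k (bary_coord y)))).
  have -> : (fun y => mono a (insert0 k (bary_coord y))) = (fun y : Rn R m =>
      if a k == 0%N then mono (a \o lift k) (bary_coord y) else 0).
    by apply/funext => y; rewrite mono_insert0.
  case: eqP => _; first exact: integrable_mono.
  exact: integrable0.
have hD (a : 'I_m.+2 -> nat) : (lebn R m.+1).-integrable (@ref_simplex R m.+1)
      (EFin \o (fun y => dmono i a (bary_coord y) - dmono j a (bary_coord y))).
  have := integrableB measurable_ref_simplex (integrable_dmono i a) (integrable_dmono j a).
  by congr (integrable _ _ _).
rewrite /dbpoly (integrable_Rsum _ _).2 /=; last first.
  move=> t; have := integrableZl measurable_ref_simplex t.1 (hD t.2).
  by congr (integrable _ _ _).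
rewrite /bpoly !(integrable_Rsum _ _).2 /=; last 2 first.
- move=> t; have := integrableZl measurable_ref_simplex t.1 (hI t.2 i).
  by congr (integrable _ _ _).
- move=> t; have := integrableZl measurable_ref_simplex t.1 (hI t.2 j).
  by congr (integrable _ _ _).
rewrite -sumrB; apply: eq_bigr => t _.
have mref k := @measurable_ref_simplex k.
rewrite (RintegralZl _ (mref _) (hD t.2)).
rewrite (RintegralZl _ (mref _) (hI t.2 j)) (RintegralZl _ (mref _) (hI t.2 i)).
rewrite RintegralB; [|exact: mref|exact: integrable_dmono|exact: integrable_dmono].
rewrite !dmono_integral !face_mono_integral -mulrBr -!mulrBl; congr (_ * (_ * _)).
by case: (t.2 i) => [|?]; case: (t.2 j) => [|?]; rewrite ?subrr ?subr0 ?sub0r.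
Qed.

End barycentric_monomials.

(** * Dot product and maximum norm of row vectors *)

Section dot_theory.
Context {R : realType} {d : nat}.
Implicit Types u v w : 'rV[R]_d.

Lemma dotC u v : dot u v = dot v u.
Proof. by apply: eq_bigr => i _; rewrite mulrC. Qed.

Lemma dotDl u v w : dot (u + v) w = dot u w + dot v w.
Proof. by rewrite /dot -big_split; apply: eq_bigr => i _; rewrite mxE mulrDl. Qed.

Lemma dotZl a u v : dot (a *: u) v = a * dot u v.
Proof. by rewrite /dot mulr_sumr; apply: eq_bigr => i _; rewrite mxE mulrA. Qed.

Lemma dotDr u v w : dot u (v + w) = dot u v + dot u w.
Proof. by rewrite dotC dotDl !(dotC u). Qed.

Lemma dotZr a u v : dot u (a *: v) = a * dot u v.
Proof. by rewrite dotC dotZl (dotC u). Qed.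

Lemma dotNl u v : dot (- u) v = - dot u v.
Proof. by rewrite -scaleN1r dotZl mulN1r. Qed.

Lemma dotNr u v : dot u (- v) = - dot u v.
Proof. by rewrite dotC dotNl (dotC u). Qed.

Lemma dotBl u v w : dot (u - v) w = dot u w - dot v w.
Proof. by rewrite dotDl dotNl. Qed.

Lemma dotBr u v w : dot u (v - w) = dot u v - dot u w.
Proof. by rewrite dotDr dotNr. Qed.

Lemma dot0l u : dot 0 u = 0.
Proof. by rewrite /dot big1// => i _; rewrite mxE mul0r. Qed.

Lemma dot0r u : dot u 0 = 0.
Proof. by rewrite dotC dot0l. Qed.

Lemma dot_suml (I : Type) (s : seq I) (P : pred I) (F : I -> 'rV[R]_d) v :
  dot (\sum_(i <- s | P i) F i) v = \sum_(i <- s | P i) dot (F i) v.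
Proof.
apply: (big_morph (dot^~ v)) => [x y|]; first exact: dotDl.
exact: dot0l.
Qed.

Lemma dot_sumr (I : Type) (s : seq I) (P : pred I) (F : I -> 'rV[R]_d) v :
  dot v (\sum_(i <- s | P i) F i) = \sum_(i <- s | P i) dot v (F i).
Proof. by rewrite dotC dot_suml; apply: eq_bigr => i _; rewrite dotC. Qed.

Lemma dot_ge0 u : 0 <= dot u u.
Proof. by apply: sumr_ge0 => i _; rewrite -expr2 sqr_ge0. Qed.

Lemma dot_eq0 u : (dot u u == 0) = (u == 0).
Proof.
apply/eqP/eqP => [|->]; last by rewrite dot0l.
move=> /eqP; rewrite psumr_eq0; last by move=> i _; rewrite -expr2 sqr_ge0.
move=> /allP h; apply/rowP => i; rewrite mxE.
by move: (h i (mem_index_enum i)) => /=; rewrite mulf_eq0 orbb => /eqP.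
Qed.

Lemma norm_coord_le u i : `|u 0 i| <= `|u|.
Proof.
rewrite [leRHS]/Num.norm /= mx_normrE; apply/bigmax_geP; right => /=.
by exists (0, i).
Qed.

Lemma norm_le_coord u (e : R) : 0 <= e -> (forall i, `|u 0 i| <= e) -> `|u| <= e.
Proof.
move=> e0 h; rewrite [leLHS]/Num.norm /= mx_normrE.
by apply/bigmax_leP; split=> // -[i j] _ /=; rewrite ord1.
Qed.

(** The topology of row vectors comes from the maximum norm, whereas second moments and bumps are
    Euclidean; this bound and [norm_le_dot] mediate between them. *)
Lemma dot_le_norm u : dot u u <= d%:R * `|u| ^+ 2.
Proof.
rewrite /dot -[X in _ <= X%:R * _]card_ord -sum1_card natr_sum mulr_suml.
apply: ler_sum => i _; rewrite mul1r -expr2 -real_normK ?num_real//.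
by rewrite lerXn2r ?nnegrE// norm_coord_le.
Qed.

Lemma norm_le_dot u : `|u| ^+ 2 <= dot u u.
Proof.
have h i : `|u 0 i| <= Num.sqrt (dot u u).
  rewrite -sqrtr_sqr ler_wsqrtr// expr2 /dot (bigD1 i)//= lerDl.
  by apply: sumr_ge0 => j _; rewrite -expr2 sqr_ge0.
rewrite -[leRHS]sqr_sqrtr ?dot_ge0// lerXn2r ?nnegrE ?sqrtr_ge0//.
exact: norm_le_coord (sqrtr_ge0 _) h.
Qed.

End dot_theory.

(** * Directional derivatives and a quadratic modulus of continuity *)

Section calculus.
Context {R : realType} {d : nat}.
Local Notation pt := 'rV[R]_d.
Implicit Types (g : pt -> R) (x c : pt).

Lemma rV_sum_delta c : c = \sum_i c 0 i *: delta_mx 0 i.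
Proof. exact: row_sum_delta. Qed.

Lemma differentiable_cont g : (forall x, differentiable g x) -> continuous g.
Proof. by move=> dg x; apply: differentiable_continuous. Qed.

Lemma derive_partial g x c : differentiable g x ->
  'D_c g x = \sum_i c 0 i * partial i g x.
Proof.
move=> dg; rewrite deriveE// {1}(rV_sum_delta c) linear_sum.
apply: eq_bigr => i _; rewrite linearZ /=; congr (_ * _).
by rewrite /partial deriveE.
Qed.

Lemma derive_dot_grad g x c : differentiable g x -> 'D_c g x = dot (grad g x) c.
Proof.
move=> dg; rewrite derive_partial//; apply: eq_bigr => i _.
by rewrite mxE mulrC.
Qed.

Lemma continuous_sum (I : Type) (s : seq I) (F : I -> pt -> R) :
  (forall i, continuous (F i)) -> continuous (fun x => \sum_(i <- s) F i x).
Proof.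
move=> cF; elim: s => [|i s IH].
  have -> : (fun x => \sum_(i <- [::]) F i x) = (fun=> 0).
    by apply/funext => x; rewrite big_nil.
  exact: cst_continuous.
have -> : (fun x => \sum_(j <- i :: s) F j x) =
    (fun x => F i x + \sum_(j <- s) F j x).
  by apply/funext => x; rewrite big_cons.
by move=> x; exact: (cvgD (cF i x) (IH x)).
Qed.

Lemma continuous_derive g c : C1 g -> continuous (fun x => 'D_c g x).
Proof.
move=> [dg cg].
have -> : (fun x => 'D_c g x) = (fun x => \sum_i c 0 i * partial i g x).
  by apply/funext => x; rewrite derive_partial.
by apply: continuous_sum => i x; exact: (cvgM (cvg_cst (c 0 i)) (cg i x)).
Qed.

Lemma derive_line g x c (t : R) : differentiable g (x + t *: c) ->
  is_derive t 1 (fun t => g (x + t *: c)) ('D_c g (x + t *: c)).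
Proof.
move=> dg.
have E : (fun h : R => h^-1 *: (((fun t => g (x + t *: c)) \o shift t) (h *: 1)
     - g (x + t *: c)))
   = (fun h : R => h^-1 *: ((g \o shift (x + t *: c)) (h *: c) - g (x + t *: c))).
  apply/funext => h /=; congr (_ *: (g _ - _)).
  by rewrite [h *: 1]mulr1 scalerDl addrCA.
have dc : derivable g (x + t *: c) c by exact: diff_derivable.
by split; rewrite /derivable /derive E.
Qed.

Lemma mean_value g x c (h : R) : (forall y, differentiable g y) -> 0 <= h ->
  exists2 t, 0 <= t <= h & g (x + h *: c) - g x = h * 'D_c g (x + t *: c).
Proof.
move=> dg h0.
have := @MVT_segment R (fun t => g (x + t *: c)) (fun t => 'D_c g (x + t *: c)) 0 h h0.
case.
- by move=> t _; exact: derive_line.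
- apply: continuous_subspaceT => t.
  apply/differentiable_continuous/derivable1_diffP.
  by case: (derive_line (dg (x + t *: c))).
- move=> t; rewrite in_itv /= => th E; exists t => //.
  by move: E; rewrite scale0r addr0 subr0 mulrC.
Qed.

(** A modulus as in Korovkin's theorem: continuity handles close points, and for distant ones the
    quadratic term absorbs twice the bound of [g]. The shape is chosen because Bernstein polynomials
    of squared distances are known exactly. *)
Lemma continuity_modulus g (e M : R) : continuous g -> 0 < e ->
  exists2 C, 0 <= C & forall x z, `|x| <= M -> `|z| <= M ->
    `|g z - g x| <= e + C * dot (z - x) (z - x).
Proof.
move=> cg e0.
pose K := [set x : pt | `|x| <= M].
have cK : compact K.
  apply: bounded_closed_compact.
    exists M; split; first exact: num_real.
    by move=> N MN x /= xM; exact: le_trans xM (ltW MN).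
  have -> : K = (fun x : pt => `|x|) @^-1` [set y | y <= M] by [].
  by apply: preimage_closed => [x _|]; [exact: norm_continuous|exact: closed_le].
have [B B0 hB] : exists2 B, 0 <= B & forall x, K x -> `|g x| <= B.
  have : compact (g @` K) by apply: continuous_compact cK; exact: continuous_subspaceT.
  move=> /compact_bounded [B0 [_ hB]].
  exists (Num.max 0 (B0 + 1)); first by rewrite le_max lexx.
  move=> x Kx; have : B0 < Num.max 0 (B0 + 1) by rewrite lt_max ltrDl ltr01 orbT.
  by move=> /hB; apply; exists x.
(* The estimate holds near each base point for all large [C]; compactness of [K], as a near-covering
   property, makes one [C] serve for all. *)
pose P (C : R) (x : pt) := 0 <= C /\ (K x -> forall z, K z ->
    `|g z - g x| <= e + C * dot (z - x) (z - x)).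
have hP : forall x, K x -> \forall x' \near x & C \near (pinfty_nbhs R), P C x'.
  move=> x0 Kx0.
  have e2 : 0 < e / 2 by rewrite divr_gt0.
  have /cvgrPdist_lt/(_ _ e2) := cg x0.
  move=> /nbhs_ballP[r /= r0 hr].
  have r2 : 0 < r / 2 by rewrite divr_gt0.
  (* Points at distance at least r / 2 have squared distance at least (r / 2)^2, so that such a [C]
     lifts the quadratic term above 2 B. *)
  exists (ball x0 (r / 2), [set C | 2 * B / (r / 2) ^+ 2 < C]).
    split => /=; last by exists (2 * B / (r / 2) ^+ 2); split; [exact: num_real|].
    exact: nbhsx_ballx.
  move=> [x C] /= [xr CB].
  have C0 : 0 <= C.
    apply: le_trans (ltW CB); apply: divr_ge0; first exact: mulr_ge0.
    by apply: exprn_ge0; exact: ltW.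
  split=> // Kx z Kz.
  have [zx|zx] := ltP `|z - x| (r / 2).
    have h1 : `|g x0 - g x| < e / 2.
      by apply: hr; apply: le_ball xr; rewrite ler_pdivrMr// ler_peMr ?ltW// ltr1n.
    have h2 : `|g x0 - g z| < e / 2.
      apply: hr; rewrite -ball_normE /=.
      rewrite -ball_normE /= in xr.
      rewrite -(subrKA x) (le_lt_trans (ler_normD _ _))// (splitr r) ltrD//.
      by rewrite distrC.
    have : `|g z - g x| <= e.
      rewrite -(subrKA (g x0)) (le_trans (ler_normD _ _))// (splitr e).
      by rewrite lerD// ltW// distrC.
    by move=> /le_trans; apply; rewrite lerDl mulr_ge0 ?dot_ge0.
  apply: (@le_trans _ _ (2 * B)).
    rewrite (le_trans (ler_normB _ _))// mulr2n mulrDl !mul1r lerD ?hB//.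
  apply: (@le_trans _ _ (C * dot (z - x) (z - x))); last by rewrite lerDr ltW.
  apply: (@le_trans _ _ (C * (r / 2) ^+ 2)).
    by rewrite -ler_pdivrMr ?exprn_gt0// ltW.
  apply: ler_wpM2l => //; apply: le_trans (norm_le_dot _).
  by rewrite lerXn2r ?nnegrE// ltW.
have := (compact_near_coveringP K).1 cK _ (pinfty_nbhs R) P _ hP.
move=> [C0 [_ hC]].
exists (Num.max 0 (C0 + 1)); first by rewrite le_max lexx.
move=> x z xM zM.
have hlt : C0 < Num.max 0 (C0 + 1) by rewrite lt_max ltrDl ltr01 orbT.
by have [_ /(_ xM z zM)] := hC _ hlt x xM.
Qed.

End calculus.

(** * Bernstein polynomials on a simplex *)

Section bernstein.
Context {R : realType} {d m : nat}.
Local Notation pt := 'rV[R]_d.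
Variable p : 'I_m.+1 -> pt.
Implicit Types (F G : pt -> R) (l : 'I_m.+1 -> R).

Definition bary_comb l : pt := \sum_i l i *: p i.

(* The n-th Bernstein polynomial of g is bern n (fun z => g (n%:R^-1 *: z)). *)
Fixpoint bern n F l : R :=
  if n is n'.+1 then \sum_i l i * bern n' (fun z => F (z + p i)) l else F 0.

Definition mulX (k : 'I_m.+1) (s : seq (R * ('I_m.+1 -> nat))) :=
  [seq (t.1, fun j => (t.2 j + (j == k))%N) | t <- s].

Lemma mono_mulX k (a : 'I_m.+1 -> nat) l :
  mono (fun j => (a j + (j == k))%N) l = l k * mono a l.
Proof.
rewrite /mono [in LHS](bigD1 k)//= [in RHS](bigD1 k)//= eqxx addn1 exprS -mulrA.
by congr (_ * (_ * _)); apply: eq_bigr => j /negbTE->; rewrite addn0.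
Qed.

Lemma dmono_mulX i k (a : 'I_m.+1 -> nat) l :
  dmono i (fun j => (a j + (j == k))%N) l =
  (k == i)%:R * mono a l + l k * dmono i a l.
Proof.
rewrite /dmono [i == k]eq_sym; case: eqP => [<-|/eqP ki].
  rewrite mul1r natrD mulrDl addrC mulr1n mul1r; congr (_ + _).
    by apply: congr2 (erefl l); apply/funext => j; rewrite addnK.
  case: (posnP (a k)) => [->|ak]; first by rewrite !mul0r mulr0.
  rewrite mulrCA -mono_mulX; congr (_ * mono _ l); apply/funext => j.
  by case: eqP => [->|_]; rewrite ?addnK ?subnK// subn0 addn0.
rewrite addn0 mul0r add0r mulrCA -mono_mulX; congr (_ * mono _ l).
apply/funext => j; case: (eqVneq j i) => [->|ji].
  by rewrite eq_sym (negbTE ki) !addn0.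
by rewrite !subn0.
Qed.

Lemma bpoly_mulX k s l : bpoly (mulX k s) l = l k * bpoly s l.
Proof.
rewrite /bpoly big_map mulr_sumr; apply: eq_bigr => t _ /=.
by rewrite mono_mulX mulrCA.
Qed.

Lemma dbpoly_mulX i j k s l : dbpoly i j (mulX k s) l =
  ((k == i)%:R - (k == j)%:R) * bpoly s l + l k * dbpoly i j s l.
Proof.
rewrite /dbpoly /bpoly big_map !mulr_sumr -big_split /=; apply: eq_bigr => t _.
by rewrite !dmono_mulX; ring.
Qed.

Lemma bpoly_flatten (I : Type) (r : seq I) (S : I -> seq (R * ('I_m.+1 -> nat))) l :
  bpoly (flatten [seq S k | k <- r]) l = \sum_(k <- r) bpoly (S k) l.
Proof. by rewrite /bpoly big_flatten big_map. Qed.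

Lemma dbpoly_flatten (I : Type) (r : seq I) (S : I -> seq (R * ('I_m.+1 -> nat))) i j l :
  dbpoly i j (flatten [seq S k | k <- r]) l = \sum_(k <- r) dbpoly i j (S k) l.
Proof. by rewrite /dbpoly big_flatten big_map. Qed.

Lemma bern_bpoly n F : exists s,
  (forall l, bern n F l = bpoly s l) /\
  (forall i j l, dbpoly i j s l = n%:R *
     (bern n.-1 (fun z => F (z + p i)) l - bern n.-1 (fun z => F (z + p j)) l)).
Proof.
elim: n F => [|n IH] F.
  exists [:: (F 0, fun=> 0%N)]; split=> [l|i j l].
    by rewrite /bpoly big_seq1 /mono /= big1 ?mulr1// => i _; rewrite expr0.
  by rewrite /dbpoly big_seq1 /dmono /= !mul0r subrr mulr0.
have /choice[S hS] := fun k => IH (fun z => F (z + p k)).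
exists (flatten [seq mulX k (S k) | k <- index_enum 'I_m.+1]); split=> [l|i j l].
  rewrite bpoly_flatten /=; apply: eq_bigr => k _.
  by rewrite bpoly_mulX (hS k).1.
rewrite dbpoly_flatten /=.
under eq_bigr => k _ do rewrite dbpoly_mulX -(hS k).1 (hS k).2.
rewrite big_split /=.
have E1 (q : 'I_m.+1) (X : 'I_m.+1 -> R) : \sum_k (k == q)%:R * X k = X q.
  rewrite (bigD1 q)//= eqxx mul1r big1 ?addr0// => k /negbTE->.
  by rewrite mul0r.
under eq_bigr do rewrite mulrBl.
rewrite sumrB !E1 -[n.+1]add1n natrD mulrDl mul1r; congr (_ + _).
case: n {IH hS} => [|n] /=.
  by rewrite mul0r big1// => k _; rewrite mul0r mulr0.
rewrite -sumrB mulr_sumr; apply: eq_bigr => k _.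
rewrite mulrCA -mulrBr; congr (_ * (_ * (_ - _)));
  by apply: congr2 (erefl l); apply/funext => z; rewrite addrAC.
Qed.

(** For weights of sum one, [bern n F l] is the mean of [F] at the sum of [n] vertices drawn
    independently with weights [l]. Such sums stay in the ball of radius n M, and a modulus of
    continuity is only available on bounded sets. *)
Lemma bern_le n F G l (M : R) : (forall i, 0 <= l i) -> (forall i, `|p i| <= M) ->
  (forall z, `|z| <= n%:R * M -> F z <= G z) -> bern n F l <= bern n G l.
Proof.
move=> l0 pM; elim: n F G => [|n IH] F G FG.
  by apply: FG; rewrite normr0 mul0r.
apply: ler_sum => i _; apply: ler_wpM2l; first exact: l0.
  apply: IH => z zM.
apply: FG; apply: le_trans (ler_normD _ _) _.
by rewrite -natr1 mulrDl mul1r lerD.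
Qed.

Lemma bernD n F G l : bern n (fun z => F z + G z) l = bern n F l + bern n G l.
Proof.
elim: n F G => //= n IH F G; rewrite -big_split; apply: eq_bigr => i _.
by rewrite IH mulrDr.
Qed.

Lemma bernZ n a F l : bern n (fun z => a * F z) l = a * bern n F l.
Proof.
elim: n F => //= n IH F; rewrite mulr_sumr; apply: eq_bigr => i _.
by rewrite IH mulrCA.
Qed.

Lemma bernB n F G l : bern n (fun z => F z - G z) l = bern n F l - bern n G l.
Proof.
rewrite bernD; congr (_ + _); rewrite -mulN1r -bernZ.
by apply: congr2 (erefl l); apply/funext => z; rewrite mulN1r.
Qed.

Lemma bern_cst n c l : \sum_i l i = 1 -> bern n (fun=> c) l = c.
Proof. by move=> l1; elim: n => //= n IH; rewrite -mulr_suml l1 mul1r. Qed.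

(** The variance of a random vertex drawn with weights [l]. *)
Definition spread l : R :=
  \sum_i l i * dot (p i - bary_comb l) (p i - bary_comb l).

Lemma spread_step l u : \sum_i l i = 1 ->
  \sum_i l i * dot (u + (p i - bary_comb l)) (u + (p i - bary_comb l)) =
  dot u u + spread l.
Proof.
move=> l1.
have E : \sum_i l i *: (p i - bary_comb l) = 0.
  under eq_bigr do rewrite scalerBr.
  by rewrite sumrB -scaler_suml l1 scale1r subrr.
have E2 i : l i * dot (u + (p i - bary_comb l)) (u + (p i - bary_comb l)) =
    l i * dot u u + (2 * dot u (l i *: (p i - bary_comb l)) +
    l i * dot (p i - bary_comb l) (p i - bary_comb l)).
  move: (p i - _) => w; rewrite dotDl !dotDr [dot w u]dotC dotZr; ring.
rewrite (eq_bigr _ (fun i _ => E2 i)) !big_split /= -mulr_suml l1 mul1r.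
by rewrite -mulr_sumr -dot_sumr E dot0r mulr0 add0r.
Qed.

(** Variances of independent draws add up, and [bary_comb p l] is the mean of a single draw;
    [spread_step] splits off one vertex. *)
Lemma bern_spread n c l : \sum_i l i = 1 ->
  bern n (fun z => dot (z - c) (z - c)) l =
  dot (n%:R *: bary_comb l - c) (n%:R *: bary_comb l - c) + n%:R * spread l.
Proof.
move=> l1; elim: n c => [|n IH] c /=.
  by rewrite mul0r addr0 scale0r.
have E i : bern n (fun z => dot (z + p i - c) (z + p i - c)) l =
   dot (((n.+1%:R) *: bary_comb l - c) + (p i - bary_comb l))
       (((n.+1%:R) *: bary_comb l - c) + (p i - bary_comb l)) + n%:R * spread l.
  have -> : (fun z => dot (z + p i - c) (z + p i - c)) =
            (fun z => dot (z - (c - p i)) (z - (c - p i))).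
    by apply/funext => z; rewrite opprB addrA addrAC.
  rewrite IH; congr (dot _ _ + _);
  by rewrite -natr1 scalerDl scale1r opprB; apply/rowP => j; rewrite !mxE; ring.
under eq_bigr => i _ do rewrite E mulrDr.
rewrite big_split /= -mulr_suml l1 mul1r spread_step// -addrA -natr1.
by congr (_ + _); ring.
Qed.

(** [bern] is monotone and reproduces constants, so that a pointwise bound may be averaged. *)
Lemma bern_dist2 n F c (e C : R) l x (M : R) : \sum_i l i = 1 ->
  (forall i, 0 <= l i) -> (forall i, `|p i| <= M) ->
  (forall z, `|z| <= n%:R * M -> `|F z - c| <= e + C * dot (z - x) (z - x)) ->
  `|bern n F l - c| <= e + C * bern n (fun z => dot (z - x) (z - x)) l.
Proof.
move=> l1 l0 pM h; rewrite -{1}(bern_cst n c l1) -bernB.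
rewrite -{1}(bern_cst n e l1) -bernZ -bernD ler_norml -[- bern _ _ _]mulN1r -bernZ.
by apply/andP; split; apply: bern_le l0 pM _ => z /h;
  rewrite ler_norml => /andP[]; rewrite ?mulN1r.
Qed.

Section bound.
Variables (l : 'I_m.+1 -> R) (M : R).
Hypotheses (l1 : \sum_i l i = 1) (l0 : forall i, 0 <= l i).
Hypothesis (pM : forall i, `|p i| <= M).

Lemma norm_bary_comb : `|bary_comb l| <= M.
Proof.
rewrite (le_trans (ler_norm_sum _ _ _))// -[leRHS]mul1r -l1 mulr_suml.
by apply: ler_sum => i _; rewrite normrZ ger0_norm// ler_wpM2l.
Qed.

Lemma spread_le : spread l <= d%:R * (2 * M) ^+ 2.
Proof.
have -> : d%:R * (2 * M) ^+ 2 = \sum_i l i * (d%:R * (2 * M) ^+ 2).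
  by rewrite -mulr_suml l1 mul1r.
apply: ler_sum => i _; apply: ler_wpM2l => //; apply: le_trans (dot_le_norm _) _.
rewrite ler_wpM2l//.
have M0 : 0 <= M by apply: le_trans (pM i).
rewrite lerXn2r ?nnegrE ?mulr_ge0//.
rewrite (le_trans (ler_normB _ _))// mulr2n mulrDl mul1r.
by rewrite lerD// norm_bary_comb.
Qed.

End bound.

End bernstein.

(** * Approximation of C^1 functions together with their edge derivatives *)

Section approximation.
Context {R : realType} {d m : nat}.
Local Notation pt := 'rV[R]_d.
Variable p : 'I_m.+1 -> pt.
Implicit Types (g : pt -> R) (l : 'I_m.+1 -> R).

Lemma dot_add_sq_le (u w : pt) : dot (u + w) (u + w) <= 2 * (dot u u + dot w w).
Proof.
rewrite -subr_ge0 (_ : _ - _ = dot (u - w) (u - w)) ?dot_ge0//.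
by rewrite dotBl !dotBr dotDl !dotDr (dotC w u); ring.
Qed.

Definition std_simplex : set ('I_m.+1 -> R) :=
  [set l | (forall i, 0 <= l i) /\ \sum_i l i = 1].

Lemma ex_norm_bound : exists M : R, forall i, `|p i| <= M.
Proof.
exists (\sum_i `|p i|) => i; rewrite (bigD1 i)//= lerDl.
by apply: sumr_ge0.
Qed.

Lemma div_succ_le (A e : R) : 0 <= A -> 0 < e ->
  exists K, forall n, (K <= n)%N -> A / n.+1%:R <= e.
Proof.
move=> A0 e0; exists (Num.truncn (A / e)) => n Kn.
rewrite ler_pdivrMr ?ltr0n// mulrC -ler_pdivrMr//.
apply/ltW/(lt_le_trans (truncnS_gt _)).
by rewrite ler_nat ltnS.
Qed.

(** After rescaling, the variance is [spread p l / n.+1%:R], which tends to zero uniformly in [l].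
    One half of [e] pays for the modulus of continuity, the other for the variance. *)
Lemma bern_approx g (e : R) : continuous g -> 0 < e ->
  exists K, forall n, (K <= n)%N -> forall l, std_simplex l ->
    `|bern p n.+1 (fun z => g (n.+1%:R^-1 *: z)) l - g (bary_comb p l)| <= e.
Proof.
move=> cg e0; have [M pM] := ex_norm_bound.
have e2 : 0 < e / 2 by rewrite divr_gt0.
have [C C0 hC] := continuity_modulus M cg e2.
have D0 : 0 <= C * (d%:R * (2 * M) ^+ 2).
  by apply: mulr_ge0 => //; apply: mulr_ge0 => //; exact: sqr_ge0.
have [K hK] := div_succ_le D0 e2.
exists K => n Kn l [l0 l1].
have N0 : 0 < n.+1%:R :> R by rewrite ltr0n.
set x := bary_comb p l; set N : R := n.+1%:R.
have h z : `|z| <= n.+1%:R * M ->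
    `|g (N^-1 *: z) - g x| <= e / 2 + C * N^-1 ^+ 2 * dot (z - N *: x) (z - N *: x).
  move=> zM; apply: le_trans (hC x (N^-1 *: z) _ _) _.
  - exact: norm_bary_comb.
  - by rewrite normrZ gtr0_norm ?invr_gt0// mulrC ler_pdivrMr// mulrC.
  - have -> : N^-1 *: z - x = N^-1 *: (z - N *: x).
      by rewrite scalerBr scalerA mulVf ?scale1r// gt_eqF.
    by rewrite dotZl dotZr lerD2l expr2 !mulrA.
have := bern_dist2 l1 l0 pM h.
rewrite bern_spread// subrr dot0l add0r => /le_trans; apply.
rewrite [leRHS]splitr lerD2l; apply: le_trans (hK n Kn).
have -> : C * N^-1 ^+ 2 * (n.+1%:R * spread p l) = C * (spread p l / N).
  by rewrite -/N; field; rewrite gt_eqF.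
rewrite -[leRHS]mulrA; apply: ler_wpM2l => //.
by rewrite ler_pM2r ?invr_gt0//; exact: spread_le.
Qed.

(** The scaled difference is a difference quotient with step 1 / (n + 1). The mean value theorem
    turns it into a directional derivative at a nearby point, to which the argument of [bern_approx]
    applies. *)
Lemma bern_derive_approx g (e : R) i j : C1 g -> 0 < e ->
  exists K, forall n, (K <= n)%N -> forall l, std_simplex l ->
    `|n.+1%:R * (bern p n (fun z => g (n.+1%:R^-1 *: (z + p i))) l -
                 bern p n (fun z => g (n.+1%:R^-1 *: (z + p j))) l)
     - 'D_(p i - p j) g (bary_comb p l)| <= e.
Proof.
move=> C1g e0; have [M pM] := ex_norm_bound.
have M0 : 0 <= M by apply: le_trans (pM i).
have e2 : 0 < e / 2 by rewrite divr_gt0.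
set c := p i - p j.
(* The mean value points (z + p_j + N t c) / N have norm at most (n M + 3 M) / N, hence at most 3
   M. *)
have [C C0 hC] := continuity_modulus (3 * M) (continuous_derive (c := c) C1g) e2.
(* [D] bounds the spread. [D'] bounds the squared length of [w] below, the part of the scaled
   displacement from [x] that remains besides [z - n%:R *: x]; its maximum norm is at most 4 M. *)
pose D : R := d%:R * (2 * M) ^+ 2.
pose D' : R := d%:R * (4 * M) ^+ 2.
have D0 : 0 <= 2 * C * (D + D').
  by apply: mulr_ge0; [exact: mulr_ge0|apply: addr_ge0; apply: mulr_ge0 => //; exact: sqr_ge0].
have [K hK] := div_succ_le D0 e2.
exists K => n Kn l [l0 l1].
have N0 : 0 < n.+1%:R :> R by rewrite ltr0n.
set x := bary_comb p l; set N : R := n.+1%:R.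
have xM : `|x| <= M by exact: norm_bary_comb.
have NN : N != 0 by rewrite gt_eqF.
rewrite -bernB -bernZ.
have cM : `|c| <= 2 * M.
  by rewrite (le_trans (ler_normB _ _))// mulr2n mulrDl mul1r lerD.
have h z : `|z| <= n%:R * M ->
    `|N * (g (N^-1 *: (z + p i)) - g (N^-1 *: (z + p j))) - 'D_c g x| <=
    (e / 2 + 2 * C * N^-1 ^+ 2 * D') +
    2 * C * N^-1 ^+ 2 * dot (z - n%:R *: x) (z - n%:R *: x).
  move=> zM.
  have -> : N^-1 *: (z + p i) = N^-1 *: (z + p j) + N^-1 *: c.
    by rewrite -scalerDr /c; congr (_ *: _); rewrite addrA [z + _ + _]addrAC addrK.
  have Nge0 : 0 <= N^-1 by rewrite invr_ge0 ltW.
  have [t /andP[t0 t1] ->] := mean_value (N^-1 *: (z + p j)) c C1g.1 Nge0.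
  rewrite mulrA divff// mul1r.
  set w := p j + (N * t) *: c - x.
  have -> : N^-1 *: (z + p j) + t *: c = N^-1 *: (n%:R *: x + x + ((z - n%:R *: x) + w)).
    have -> : n%:R *: x + x + (z - n%:R *: x + w) = z + p j + (N * t) *: c.
      by rewrite /w; apply/rowP => k; rewrite !mxE; ring.
    by rewrite [RHS]scalerDr scalerA mulrA mulVf// mul1r.
  have Nt : 0 <= N * t <= 1.
    rewrite mulr_ge0 ?(ltW N0)//=.
    by have := ler_wpM2l (ltW N0) t1; rewrite divff.
  have wM : `|w| <= 4 * M.
    have -> : 4 * M = M + 2 * M + M by ring.
    rewrite (le_trans (ler_normB _ _))// lerD//.
    rewrite (le_trans (ler_normD _ _))// lerD//.
    rewrite normrZ; case/andP: Nt => Nt0 Nt1; rewrite ger0_norm//.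
    by rewrite (le_trans _ cM)// ler_piMl.
  have -> : n%:R *: x + x = N *: x by rewrite /N -natr1 scalerDl scale1r.
  set y := z - n%:R *: x.
  have -> : N^-1 *: (N *: x + (y + w)) = x + N^-1 *: (y + w).
    by rewrite scalerDr scalerA mulVf// scale1r.
  apply: le_trans (hC x _ _ _) _.
  - by rewrite (le_trans xM)// ler_peMl// ler1n.
  - have -> : x + N^-1 *: (y + w) = N^-1 *: (z + (p j + (N * t) *: c)).
      apply: (scalerI NN); rewrite scalerDr !scalerA divff// !scale1r /y /w /N -natr1.
      by apply/rowP => k; rewrite !mxE; ring.
    rewrite normrZ ger0_norm// mulrC ler_pdivrMr//.
    rewrite (le_trans (ler_normD _ _))//.
    have -> : 3 * M * N = n%:R * M + (M + 2 * M) + 2 * (n%:R * M) by rewrite /N -natr1; ring.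
    rewrite -[leLHS]addr0 lerD ?mulr_ge0//; apply: lerD => //.
    rewrite (le_trans (ler_normD _ _))// lerD//.
    rewrite normrZ; case/andP: Nt => Nt0 Nt1; rewrite ger0_norm//.
    by rewrite (le_trans _ cM)// ler_piMl.
  - rewrite [x + _ - x]addrAC subrr add0r dotZl dotZr -[leRHS]addrA lerD2l.
    have -> : 2 * C * N^-1 ^+ 2 * D' + 2 * C * N^-1 ^+ 2 * dot y y =
       C * (N^-1 * (N^-1 * (2 * (D' + dot y y)))) by ring.
    rewrite !ler_wpM2l//.
    apply: le_trans (dot_add_sq_le _ _) _; rewrite ler_wpM2l// addrC lerD2r.
    apply: le_trans (dot_le_norm _) _; rewrite ler_wpM2l//.
    by rewrite lerXn2r ?nnegrE ?mulr_ge0.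
have := bern_dist2 l1 l0 pM h.
rewrite bern_spread// subrr dot0l add0r => /le_trans; apply.
rewrite [leRHS]splitr -addrA lerD2l; apply: le_trans (hK n Kn).
have -> : 2 * C * (D + D') / n.+1%:R = 2 * C * N^-1 ^+ 2 * (N * (D + D')).
  by rewrite -/N; field.
rewrite -mulrDr; apply: ler_wpM2l.
  by apply: mulr_ge0; [exact: mulr_ge0|exact: sqr_ge0].
have VD : spread p l <= D by exact: spread_le.
have D'0 : 0 <= D' by apply: mulr_ge0 => //; exact: sqr_ge0.
have V0 : 0 <= spread p l.
  by apply: sumr_ge0 => k _; rewrite mulr_ge0 ?dot_ge0.
rewrite mulrDr addrC lerD//.
  by apply: ler_pM => //; rewrite /N ler_nat.
by rewrite ler_peMl// /N ler1n.
Qed.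

Lemma C1_approx g (e : R) i j : C1 g -> 0 < e ->
  exists s, forall l, std_simplex l ->
    `|bpoly s l - g (bary_comb p l)| <= e /\
    `|dbpoly i j s l - 'D_(p i - p j) g (bary_comb p l)| <= e.
Proof.
move=> C1g e0.
have [K1 h1] := bern_approx (differentiable_cont C1g.1) e0.
have [K2 h2] := bern_derive_approx i j C1g e0.
pose n := maxn K1 K2.
have [s [s1 s2]] := bern_bpoly p n.+1 (fun z => g (n.+1%:R^-1 *: z)).
exists s => l hl; rewrite -s1 s2 /=; split; first exact: h1 (leq_maxl _ _) _ hl.
exact: h2 (leq_maxr _ _) _ hl.
Qed.

End approximation.

(** * Integrable functions on the reference simplex *)

Section simplex_integrals.
Context {R : realType}.
Local Notation ref m := (@ref_simplex R m).

Definition sint m (h : Rn R m -> R) : R := \int[lebn R m]_(y in ref m) h y.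
Definition sintegrable m (h : Rn R m -> R) : Prop :=
  (lebn R m).-integrable (ref m) (EFin \o h).

Lemma sintegrable_cst m c : sintegrable (fun _ : Rn R m => c).
Proof.
have h := integrableZl (measurable_ref_simplex (m := m)) c
  (integrable_mono (fun=> 0%N)).
rewrite /sintegrable; have -> // : EFin \o (fun _ : Rn R m => c) =
  (fun y => c%:E * (EFin \o (fun y => mono (fun _ : 'I_m.+1 => 0%N) (bary_coord y))) y)%E.
apply/funext => y /=; rewrite /mono big1 => [|i _]; last by rewrite expr0.
by rewrite mule1.
Qed.

Lemma sintegrableD m (h k : Rn R m -> R) : sintegrable h -> sintegrable k ->
  sintegrable (fun y => h y + k y).
Proof.
move=> ih ik; have := integrableD (measurable_ref_simplex (m := m)) ih ik.
by congr (integrable _ _ _).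
Qed.

Lemma sintegrableZ m c (h : Rn R m -> R) : sintegrable h ->
  sintegrable (fun y => c * h y).
Proof.
move=> ih; have := integrableZl (measurable_ref_simplex (m := m)) c ih.
by congr (integrable _ _ _).
Qed.

Lemma sintegrableB m (h k : Rn R m -> R) : sintegrable h -> sintegrable k ->
  sintegrable (fun y => h y - k y).
Proof.
move=> ih ik; have := integrableB (measurable_ref_simplex (m := m)) ih ik.
by congr (integrable _ _ _).
Qed.

Lemma sintD m (h k : Rn R m -> R) : sintegrable h -> sintegrable k ->
  sint (fun y => h y + k y) = sint h + sint k.
Proof. by move=> ih ik; rewrite /sint RintegralD//; exact: measurable_ref_simplex. Qed.

Lemma sintB m (h k : Rn R m -> R) : sintegrable h -> sintegrable k ->
  sint (fun y => h y - k y) = sint h - sint k.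
Proof. by move=> ih ik; rewrite /sint RintegralB//; exact: measurable_ref_simplex. Qed.

Lemma sintZ m c (h : Rn R m -> R) : sintegrable h ->
  sint (fun y => c * h y) = c * sint h.
Proof. by move=> ih; rewrite /sint RintegralZl//; exact: measurable_ref_simplex. Qed.

Lemma eq_sint m (h k : Rn R m -> R) : (forall y, ref m y -> h y = k y) ->
  sint h = sint k.
Proof. by move=> hk; apply: eq_Rintegral => y /set_mem; exact: hk. Qed.

Definition refvol m : R := sint (fun _ : Rn R m => 1).

Lemma sint_le m (h k : Rn R m -> R) : sintegrable h -> sintegrable k ->
  (forall y, ref m y -> h y <= k y) -> sint h <= sint k.
Proof. by move=> ih ik hk; apply: le_Rintegral => //; exact: measurable_ref_simplex. Qed.

Lemma sint_cst m c : sint (fun _ : Rn R m => c) = c * refvol m.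
Proof.
rewrite -(sintZ c (sintegrable_cst m 1)); apply: eq_sint => y _.
by rewrite mulr1.
Qed.

Lemma refvol_ge0 m : 0 <= refvol m.
Proof. exact: Rintegral_ge0. Qed.

Lemma sint_dist m (h k : Rn R m -> R) (e : R) : sintegrable h -> sintegrable k ->
  (forall y, ref m y -> `|h y - k y| <= e) -> `|sint h - sint k| <= e * refvol m.
Proof.
move=> ih ik hk; rewrite -sintB// -sint_cst ler_norml; apply/andP; split.
  rewrite sint_cst -mulNr -sint_cst.
  apply: sint_le; [exact: sintegrable_cst|exact: sintegrableB|].
  by move=> y /hk; rewrite ler_norml => /andP[].
apply: sint_le; [exact: sintegrableB|exact: sintegrable_cst|].
by move=> y /hk; rewrite ler_norml => /andP[].
Qed.

(** Applied to polynomials converging to a continuous function: measurability for the iterated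
    product sigma-algebra is inherited by the limit and need not be compared with the topology of
    row vectors. *)
Lemma sintegrable_uniform m (h : Rn R m -> R) :
  (forall e : R, 0 < e -> exists2 k, sintegrable k &
     forall y, ref m y -> `|k y - h y| <= e) -> sintegrable h.
Proof.
move=> H.
have /choice[k hk] : forall n : nat, exists k, sintegrable k /\
    forall y, ref m y -> `|k y - h y| <= n.+1%:R^-1.
  move=> n; have [|k ik hk] := H n.+1%:R^-1; first by rewrite invr_gt0 ltr0n.
  by exists k.
have mh : measurable_fun (ref m) h.
  apply: (@measurable_fun_cvg _ _ _ _ k) => [n|y yr].
    by have [/measurable_int/measurable_EFinP] := hk n.
  apply/cvgrPdist_le => e e0; near=> n.
  rewrite distrC (le_trans ((hk n).2 y yr))//.
  near: n; by have := near_infty_natSinv_lt (PosNum e0); apply: filterS => n /ltW.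
have [i0 h0] := hk 0%N.
(* A dominating function, since [k 0%N] is within distance 1 of [h]. *)
have ik : sintegrable (fun y => `|k 0%N y| + 1).
  apply: sintegrableD; last exact: sintegrable_cst.
  by have := integrable_norm i0.
apply: (le_integrable (measurable_ref_simplex (m := m)) _ _ ik).
  exact/measurable_EFinP.
move=> y yr; rewrite /= lee_fin [leRHS]ger0_norm ?addr_ge0//.
have := h0 y yr; rewrite invr1 distrC => h1.
by rewrite -(subrK (k 0%N y) (h y)) addrC (le_trans (ler_normD _ _))// lerD2l.
Unshelve. all: by end_near. Qed.

Section param.
Context {d m : nat}.
Local Notation pt := 'rV[R]_d.
Variable p : 'I_m.+1 -> pt.

Lemma simplex_paramE y : simplex_param p y = bary_comb p (bary_coord y).
Proof.
rewrite /simplex_param /bary_comb big_ord_recl bary_coord0.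
rewrite [in RHS](eq_bigr (fun j : 'I_m => coord y j *: p (lift ord0 j))); last first.
  by move=> j _; rewrite bary_coordS.
rewrite (eq_bigr (fun j : 'I_m => coord y j *: p (lift ord0 j) - coord y j *: p ord0));
  last by move=> j _; rewrite scalerBr.
by rewrite sumrB -scaler_suml scalerBl scale1r addrCA addrC.
Qed.

Lemma std_simplex_bary y : ref m y -> std_simplex (bary_coord y).
Proof. by move=> yr; split=> [i|]; [exact: bary_coord_ge0|exact: bary_coord_sum]. Qed.

Lemma sintegrable_bpoly (s : seq (R * ('I_m.+1 -> nat))) :
  sintegrable (fun y => bpoly s (bary_coord y)).
Proof.
apply: (integrable_Rsum _ _).1 => t.
by have := sintegrableZ t.1 (integrable_mono t.2).
Qed.

Lemma sintegrable_cont (g : pt -> R) : continuous g ->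
  sintegrable (fun y => g (simplex_param p y)).
Proof.
move=> cg; apply: sintegrable_uniform => e e0.
have [K hK] := bern_approx p cg e0.
have [s [hs _]] := bern_bpoly p K.+1 (fun z => g (K.+1%:R^-1 *: z)).
exists (fun y => bpoly s (bary_coord y)); first exact: sintegrable_bpoly.
move=> y yr; rewrite simplex_paramE -hs; apply: hK => //.
exact: std_simplex_bary.
Qed.

End param.

Lemma insert0_std m (j : 'I_m.+2) (l : 'I_m.+1 -> R) :
  std_simplex l -> std_simplex (insert0 j l).
Proof.
move=> [l0 l1]; split=> [i|].
  by rewrite /insert0; case: unlift.
rewrite (bigD1 j)//= {1}/insert0 unlift_none add0r.
rewrite (reindex_omap (lift j) (unlift j)) /=; last first.
  by move=> i ij; case: unliftP ij => [k ->|->]; rewrite ?eqxx.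
rewrite -l1; apply: eq_big => [k|k _]; first by rewrite eq_sym neq_lift liftK eqxx.
by rewrite /insert0 liftK.
Qed.

Lemma bary_comb_insert0 d m (p : 'I_m.+2 -> 'rV[R]_d) j (l : 'I_m.+1 -> R) :
  bary_comb p (insert0 j l) = bary_comb (p \o lift j) l.
Proof.
rewrite /bary_comb (bigD1 j)//= {1}/insert0 unlift_none scale0r add0r.
rewrite (reindex_omap (lift j) (unlift j)) /=; last first.
  by move=> i ij; case: unliftP ij => [k ->|->]; rewrite ?eqxx.
apply: eq_big => [k|k _]; first by rewrite eq_sym neq_lift liftK eqxx.
by rewrite /insert0 liftK.
Qed.

Lemma sintegrable_bpoly_face m (s : seq (R * ('I_m.+2 -> nat))) j :
  sintegrable (fun y : Rn R m => bpoly s (insert0 j (bary_coord y))).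
Proof.
apply: (integrable_Rsum _ _).1 => t.
rewrite /=; have -> : (fun y : Rn R m => t.1 * mono t.2 (insert0 j (bary_coord y))) =
  (fun y => t.1 * (if t.2 j == 0%N then mono (t.2 \o lift j) (bary_coord y) else 0)).
  by apply/funext => y; rewrite mono_insert0.
case: eqP => _; first by have := sintegrableZ t.1 (integrable_mono (t.2 \o lift j)).
by have := sintegrable_cst m (t.1 * 0).
Qed.

Lemma eq_le_eps (x y C : R) : 0 <= C ->
  (forall e : R, 0 < e -> `|x - y| <= e * C) -> x = y.
Proof.
move=> C0 h; apply/eqP; rewrite -subr_eq0 -normr_le0; apply/ler_addgt0Pr => e e0; rewrite add0r.
have C1 : 0 < C + 1 by rewrite ltr_wpDl.
apply: le_trans (h (e / (C + 1)) (divr_gt0 e0 C1)) _.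
by rewrite -mulrA ler_piMr ?(ltW e0)// mulrC ler_pdivrMr// mul1r lerDl.
Qed.

(* Bernstein polynomials approximate g together with its derivatives along the
   edges, which reduces the claim to monomials. *)
Lemma sint_gauss d m (p : 'I_m.+2 -> 'rV[R]_d) (g : 'rV[R]_d -> R) i j : C1 g ->
  sint (fun y : Rn R m.+1 => 'D_(p i - p j) g (simplex_param p y)) =
  sint (fun y : Rn R m => g (simplex_param (p \o lift j) y)) -
  sint (fun y : Rn R m => g (simplex_param (p \o lift i) y)).
Proof.
move=> C1g.
apply: (@eq_le_eps _ _ (refvol m.+1 + refvol m + refvol m)).
  by rewrite !addr_ge0// refvol_ge0.
move=> e e0; have [s hs] := C1_approx p i j C1g e0.
have cg := differentiable_cont C1g.1.
have iD : sintegrable (fun y : Rn R m.+1 => dbpoly i j s (bary_coord y)).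
  apply: (integrable_Rsum _ _).1 => t.
  have := sintegrableZ t.1 (sintegrableB (integrable_dmono i t.2) (integrable_dmono j t.2)).
  exact.
have h1 := sint_dist iD (sintegrable_cont p (continuous_derive (c := p i - p j) C1g)).
have hface k : `|sint (fun y : Rn R m => bpoly s (insert0 k (bary_coord y))) -
    sint (fun y : Rn R m => g (simplex_param (p \o lift k) y))| <= e * refvol m.
  apply: sint_dist; [exact: sintegrable_bpoly_face|exact: sintegrable_cont|].
  move=> y yr; rewrite simplex_paramE -bary_comb_insert0.
  by have [] := hs _ (insert0_std k (std_simplex_bary yr)).
have {}h1 : `|sint (fun y : Rn R m.+1 => dbpoly i j s (bary_coord y)) -
    sint (fun y : Rn R m.+1 => 'D_(p i - p j) g (simplex_param p y))| <= e * refvol m.+1.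
  apply: h1 => y yr; rewrite simplex_paramE.
  by have [] := hs _ (std_simplex_bary yr).
have hi := hface i; have hj := hface j.
have := bpoly_gauss s i j; rewrite -/(sint _) -!/(sint _) => E.
rewrite {}E in h1; move: h1 hi hj.
set A := sint _; set B := sint _; set C := sint _; set D := sint _; set F := sint _.
clearbody A B C D F; rewrite !mulrDr => h1 hi hj.
(* [A - B] is the facet side of the formula for the approximating polynomial. What remains are three
   approximation errors, one on the cell and two on faces. *)
rewrite (_ : C - (F - D) = - (A - B - C) + ((A - F) - (B - D))); last by ring.
rewrite -[leRHS]addrA (le_trans (ler_normD _ _))// normrN lerD//.
by rewrite (le_trans (ler_normB _ _))// lerD.
Qed.

End simplex_integrals.

(** * Vanishing integrals of nonnegative continuous functions *)

Section positivity.
Context {R : realType}.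
Local Notation ref m := (@ref_simplex R m).

Lemma ex_coord m (c : nat -> R) :
  exists y : Rn R m, forall i, (i < m)%N -> coord y i = c i.
Proof.
elim: m c => [|m IH] c; first by exists tt.
have [y hy] := IH (c \o S).
by exists (c 0%N, y) => -[|i] //= im; exact: hy.
Qed.

Lemma ex_bary_coord m (l : 'I_m.+1 -> R) : std_simplex l ->
  exists2 y : Rn R m, ref m y & bary_coord y = l.
Proof.
move=> [l0 l1].
have [y hy] := @ex_coord m (fun i => if insub i is Some j then l (lift ord0 j) else 0).
have {}hy (i : 'I_m) : coord y i = l (lift ord0 i) by rewrite hy// valK.
have s1 : \sum_(i < m) coord y i = 1 - l ord0.
  by rewrite (eq_bigr _ (fun i _ => hy i)) -l1 big_ord_recl addrAC subrr add0r.
exists y.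
  split=> [i|]; last by rewrite s1 gerBl.
  have [im|mi] := ltnP i m; last by rewrite coord_oversize.
  by rewrite (hy (Ordinal im)).
apply/funext => i; case: (unliftP ord0 i) => [j|] ->.
  by rewrite bary_coordS.
by rewrite bary_coord0 s1 opprB addrC subrK.
Qed.

Definition box m (c : nat -> R) (e : R) : set (Rn R m) :=
  [set y | forall i, (i < m)%N -> `|coord y i - c i| <= e].

Lemma boxS m c e : @box m.+1 c e = `[c 0%N - e, c 0%N + e] `*` box (c \o S) e.
Proof.
apply/seteqP; split=> [[t y] h|[t y] /= [h1 h2] [|i] im].
- split; first by have := h 0%N isT; rewrite /= in_itv /= ler_distl.
  by move=> i im; exact: (h i.+1).
- by move: h1; rewrite /= in_itv /= ler_distl.
- exact: (h2 i).
Qed.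

Lemma measurable_box m c e : measurable (@box m c e).
Proof.
elim: m c => [|m IH] c.
  by rewrite (_ : box c e = setT)//; apply/seteqP; split.
by rewrite boxS; apply: measurableX => //; exact: IH.
Qed.

Lemma box_gt0 m c e : 0 < e -> (0 < lebn R m (@box m c e))%E.
Proof.
move=> e0; elim: m c => [|m IH] c.
  rewrite (_ : box c e = setT); last by apply/seteqP; split.
  by rewrite /= diracT lte_fin ltr01.
rewrite boxS.
have -> : lebn R m.+1 (`[c 0%N - e, c 0%N + e] `*` box (c \o S) e) =
   ((lebesgue_measure (`[(c 0%N - e)%R, (c 0%N + e)%R]%classic : set R)) * lebn R m (box (c \o S) e))%E.
  by apply: product_measure1E => //; exact: measurable_box.
apply: mule_gt0 => //.
rewrite lebesgue_measure_itv /= lte_fin.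
have h : c 0%N - e < c 0%N + e by rewrite ltrBlDr -addrA ltrDl addr_gt0.
by rewrite h -EFinB lte_fin subr_gt0.
Qed.

Context {d m : nat} (p : 'I_m.+1 -> 'rV[R]_d).
Implicit Types (h : 'rV[R]_d -> R) (l : 'I_m.+1 -> R).

Lemma simplex_param_box (l : 'I_m.+1 -> R) y (e : R) :
  \sum_i l i = 1 ->
  (forall i : 'I_m, `|coord y i - l (lift ord0 i)| <= e) ->
  `|bary_comb p l - simplex_param p y| <= e * \sum_(i < m) `|p (lift ord0 i) - p ord0|.
Proof.
move=> l1 hy.
have -> : bary_comb p l = p ord0 + \sum_(i < m) l (lift ord0 i) *: (p (lift ord0 i) - p ord0).
  have l0 : l ord0 = 1 - \sum_(i < m) l (lift ord0 i) by rewrite -l1 big_ord_recl addrK.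
  rewrite /bary_comb big_ord_recl l0.
  rewrite [in RHS](eq_bigr (fun j : 'I_m => l (lift ord0 j) *: p (lift ord0 j)
      - l (lift ord0 j) *: p ord0)); last by move=> j _; rewrite scalerBr.
  by rewrite sumrB -scaler_suml scalerBl scale1r addrAC addrA.
rewrite opprD addrACA subrr add0r -sumrB.
rewrite (le_trans (ler_norm_sum _ _ _))// mulr_sumr; apply: ler_sum => i _.
by rewrite -scalerBl normrZ ler_wpM2r// distrC.
Qed.

(** If [h] were positive at a point with positive coordinates, it would exceed half that value on a
    cube inside the reference simplex, and the integral would be positive. *)
Lemma interior_pos h l : continuous h -> (forall y, ref m y -> 0 <= h (simplex_param p y)) ->
  sint (fun y => h (simplex_param p y)) = 0 ->
  std_simplex l -> (forall i, 0 < l i) -> h (bary_comb p l) <= 0.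
Proof.
move=> ch h0 hint [_ l1] l0; rewrite leNgt; apply/negP => hx.
set x := bary_comb p l in hx *.
have hx2 : 0 < h x / 2 by rewrite divr_gt0.
have /cvgrPdist_lt/(_ _ hx2)/nbhs_ballP[r /= r0 hr] := ch x.
(* As all coordinates are at most 1, their product is a positive lower bound for each of them. *)
pose b := \prod_i l i.
have b0 : 0 < b by apply: prodr_gt0.
have bl i : b <= l i.
  rewrite /b (bigD1 i)//= ler_piMr ?(ltW (l0 i))//; apply: prodr_ile1 => j _.
  rewrite ltW//= -l1 (bigD1 j)//= lerDl; apply: sumr_ge0 => k _; exact: ltW.
pose S : R := \sum_(i < m) `|p (lift ord0 i) - p ord0|.
have S0 : 0 <= S by apply: sumr_ge0.
(* [th] keeps the image of the cube in the ball of radius [r]; the factor b / (m + 1) in [e] below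
   keeps the cube in the simplex. *)
pose th := r / (r + S).
have rS : 0 < r + S by rewrite ltr_pwDl.
have th0 : 0 < th by rewrite divr_gt0.
have th1 : th <= 1 by rewrite ler_pdivrMr// mul1r lerDl.
have thS : th * S < r.
  by rewrite /th mulrAC ltr_pdivrMr// ltr_pM2l// ltrDr.
have N0 : 0 < m.+1%:R :> R by rewrite ltr0n.
pose e := b / m.+1%:R * th.
have e0 : 0 < e by rewrite mulr_gt0// divr_gt0.
have eb : m.+1%:R * e <= b.
  have -> : m.+1%:R * e = b * th by rewrite /e; field; rewrite addrC natr1 gt_eqF.
  by rewrite ler_piMr// ltW.
have eb' : e <= b.
  by apply: le_trans eb; rewrite ler_peMl ?(ltW e0)// ler1n.
have b1 : b <= 1.
  apply: le_trans (bl ord0) _; rewrite -l1 (bigD1 ord0)//= lerDl.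
  by apply: sumr_ge0 => k _; exact: ltW.
have eth : e <= th.
  rewrite /e ler_piMl ?(ltW th0)// ler_pdivrMr// mul1r (le_trans b1)// ler1n//.
pose c i := if insub i is Some j then l (lift ord0 (j : 'I_m)) else 0.
have cE (i : 'I_m) : c i = l (lift ord0 i) by rewrite /c valK.
have Bref : box c e `<=` ref m.
  move=> y hy; split=> [i|].
    have [im|mi] := ltnP i m; last by rewrite coord_oversize.
    have := hy i im; rewrite (cE (Ordinal im)) ler_distl => /andP[h1 _].
    by apply: le_trans h1; rewrite subr_ge0 (le_trans eb').
  apply: (@le_trans _ _ (\sum_(i < m) (l (lift ord0 i) + e))).
    apply: ler_sum => i _; have := hy i (ltn_ord i).
    by rewrite cE ler_distl => /andP[].
  rewrite big_split /= sumr_const card_ord -l1 big_ord_recl addrC lerD2r.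
  rewrite (le_trans _ (bl ord0))// (le_trans _ eb)// -[e *+ m]mulr_natl ler_wpM2r ?(ltW e0)//.
  by rewrite ler_nat.
have Bh y : box c e y -> h x / 2 <= h (simplex_param p y).
  move=> hy.
  have : `|h x - h (simplex_param p y)| < h x / 2.
    apply: hr; rewrite -ball_normE /=; apply: le_lt_trans thS.
    apply: le_trans (simplex_param_box (e := e) l1 _) _.
      by move=> i; have := hy i (ltn_ord i); rewrite cE.
    by rewrite ler_wpM2r.
  by rewrite ltr_distlC => /andP[h1 _]; apply/ltW; move: h1; lra.
have mref := @measurable_ref_simplex R m.
have ih := sintegrable_cont p ch.
have : (\int[lebn R m]_(y in ref m) (h (simplex_param p y))%:E = 0%:E)%E.
  by rewrite -hint /sint /Rintegral fineK//; exact: integrable_fin_num.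
apply/eqP; rewrite gt_eqF//.
have bpos : (0 < (h x / 2)%:E * lebn R m (box c e))%E.
  by apply: mule_gt0; [rewrite lte_fin|exact: box_gt0].
apply: (lt_le_trans bpos).
rewrite -integral_cst; last exact: measurable_box.
have mh : measurable_fun (ref m) (fun y => (h (simplex_param p y))%:E).
  exact: (measurable_int _ ih).
apply: (@le_trans _ _ (\int[lebn R m]_(y in box c e) (h (simplex_param p y))%:E)%E).
  apply: ge0_le_integral.
  - exact: measurable_box.
  - by move=> y _; rewrite lee_fin ltW.
  - exact: measurable_cst.
  - by apply: measurable_funS mh.
  - by move=> y hy; rewrite lee_fin Bh.
apply: ge0_subset_integral => //; first exact: measurable_box.
Qed.

(** A boundary point is moved slightly towards the centroid, with [h] still positive there by
    continuity; this reduces to [interior_pos]. *)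
Lemma sint_eq0 h l : continuous h -> (forall y, ref m y -> 0 <= h (simplex_param p y)) ->
  sint (fun y => h (simplex_param p y)) = 0 ->
  std_simplex l -> h (bary_comb p l) = 0.
Proof.
move=> ch h0 hint hl; apply/eqP; rewrite eq_le andbC; apply/andP; split.
  by have [y yr <-] := ex_bary_coord hl; rewrite -simplex_paramE h0.
rewrite leNgt; apply/negP => hx.
set x := bary_comb p l in hx *.
have /cvgrPdist_lt/(_ _ hx)/nbhs_ballP[r /= r0 hr] := ch x.
pose c : 'I_m.+1 -> R := fun=> m.+1%:R^-1.
have N0 : 0 < m.+1%:R :> R by rewrite ltr0n.
pose w := bary_comb p c - x.
pose t := Num.min 1 (r / (`|w| + 1)).
have w1 : 0 < `|w| + 1 by rewrite ltr_wpDl.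
have t0 : 0 < t by rewrite lt_min ltr01 divr_gt0.
have t1 : t <= 1 by rewrite ge_min lexx.
have tr : t * `|w| < r.
  have h1 : t <= r / (`|w| + 1) by rewrite ge_min lexx orbT.
  apply: (@le_lt_trans _ _ (r / (`|w| + 1) * `|w|)); first by rewrite ler_wpM2r.
  by rewrite mulrAC ltr_pdivrMr// ltr_pM2l// ltrDl.
pose l' i := (1 - t) * l i + t * c i.
case: hl => l0 l1.
have l'0 i : 0 < l' i.
  by rewrite ltr_wpDl// ?mulr_ge0 ?subr_ge0// mulr_gt0// invr_gt0.
have l'1 : \sum_i l' i = 1.
  rewrite big_split /= -!mulr_sumr l1 sumr_const card_ord -[_^-1 *+ _]mulr_natl divff ?gt_eqF//.
  by rewrite !mulr1 subrK.
have := interior_pos ch h0 hint (conj (fun i => ltW (l'0 i)) l'1) l'0.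
have -> : bary_comb p l' = x + t *: w.
  have -> : bary_comb p l' = (1 - t) *: x + t *: bary_comb p c.
    rewrite /x /bary_comb !scaler_sumr -big_split; apply: eq_bigr => i _.
    by rewrite /= !scalerA -scalerDl.
  by rewrite scalerBl scale1r scalerBr -addrA; congr (_ + _); rewrite addrC.
have : `|h x - h (x + t *: w)| < h x.
  apply: hr; rewrite -ball_normE /= opprD addrA subrr add0r normrN normrZ.
  by rewrite gtr0_norm.
by rewrite ltr_distlC => /andP[+ _]; rewrite subrr => h1 h2; move: (lt_le_trans h1 h2); rewrite ltxx.
Qed.

End positivity.

(** * Polynomials *)

Section partial_rules.
Context {R : realType} {d : nat}.
Local Notation pt := 'rV[R]_d.
Implicit Types (g h : pt -> R) (x : pt).

Lemma partialD i g h x : differentiable g x -> differentiable h x ->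
  partial i (fun y => g y + h y) x = partial i g x + partial i h x.
Proof. by move=> dg dh; rewrite /partial deriveD//; exact: diff_derivable. Qed.

Lemma partialB i g h x : differentiable g x -> differentiable h x ->
  partial i (fun y => g y - h y) x = partial i g x - partial i h x.
Proof. by move=> dg dh; rewrite /partial deriveB//; exact: diff_derivable. Qed.

Lemma partialZ i c g x : differentiable g x ->
  partial i (fun y => c * g y) x = c * partial i g x.
Proof. by move=> dg; rewrite /partial (@deriveZ _ _ _ g c)//; exact: diff_derivable. Qed.

Lemma partialM i g h x : differentiable g x -> differentiable h x ->
  partial i (fun y => g y * h y) x = partial i g x * h x + g x * partial i h x.
Proof.
move=> dg dh; rewrite /partial (@deriveM _ _ g h); [|exact: diff_derivable|exact: diff_derivable].
by rewrite addrC; congr (_ + _); rewrite /GRing.scale /= mulrC.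
Qed.

Lemma partial_cst i c x : partial i (fun _ : pt => c) x = 0.
Proof. exact: derive_cst. Qed.

Lemma derive_affine g x v c :
  (forall h : R, g (h *: v + x) - g x = h * c) -> 'D_v g x = c.
Proof.
move=> H; rewrite /derive.
have -> : (fun h : R => h^-1 *: ((g \o shift x) (h *: v) - g x)) =
    (fun h : R => h^-1 * (h * c)).
  by apply/funext => ?; rewrite /= H.
apply/cvg_lim => //; apply: (@cvg_near_cst R^o).
by near=> h; rewrite mulrA mulVf ?mul1r//; near: h; exact: nbhs_dnbhs_neq.
Unshelve. all: by end_near. Qed.

Lemma partial_coord i j x : partial i (fun y : pt => y 0 j) x = (i == j)%:R.
Proof.
apply: derive_affine => h; rewrite !mxE eqxx /= [j == i]eq_sym.
by rewrite addrK.
Qed.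

Lemma C1_mul g h : C1 g -> C1 h -> C1 (fun x => g x * h x).
Proof.
move=> [dg cg] [dh ch]; split=> [x|i]; first exact: differentiableM.
have -> : partial i (fun x => g x * h x) =
    (fun x => partial i g x * h x + g x * partial i h x).
  by apply/funext => x; rewrite partialM.
have [cg' ch'] := (differentiable_cont dg, differentiable_cont dh).
by move=> x; exact: (cvgD (cvgM (cg i x) (ch' x)) (cvgM (cg' x) (ch i x))).
Qed.

End partial_rules.

(** * Polynomials of bounded degree *)

Section polynomials.
Context {R : realType} {d : nat}.
Local Notation pt := 'rV[R]_d.
Implicit Types (g h : pt -> R) (x : pt).

(** The same functions as [poly_le], see [pdegP], but closed under sums and products by construction
    and open to induction. *)
Inductive pdeg : nat -> (pt -> R) -> Prop :=
| pdeg_cst k c : pdeg k (fun=> c)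
| pdeg_coord k i : pdeg k.+1 (fun x => x 0 i)
| pdeg_add k g h : pdeg k g -> pdeg k h -> pdeg k (fun x => g x + h x)
| pdeg_mul k l g h : pdeg k g -> pdeg l h -> pdeg (k + l) (fun x => g x * h x).

Lemma pdeg_leq k l g : (k <= l)%N -> pdeg k g -> pdeg l g.
Proof.
move=> kl gk; have := pdeg_mul gk (pdeg_cst (l - k) 1).
rewrite subnKC// => hg; rewrite (_ : g = fun x => g x * 1)//.
by apply/funext => x; rewrite mulr1.
Qed.

Lemma pdeg_sum k (I : Type) (s : seq I) (P : pred I) (F : I -> pt -> R) :
  (forall i, P i -> pdeg k (F i)) -> pdeg k (fun x => \sum_(i <- s | P i) F i x).
Proof.
move=> hF; elim: s => [|i s IH].
  have -> : (fun x => \sum_(i <- [::] | P i) F i x) = fun=> 0.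
    by apply/funext => x; rewrite big_nil.
  exact: pdeg_cst.
have -> : (fun x => \sum_(j <- i :: s | P j) F j x) =
   (fun x => (if P i then F i x else 0) + \sum_(j <- s | P j) F j x).
  by apply/funext => x; rewrite big_cons; case: ifP; rewrite ?add0r.
apply: pdeg_add IH; case Pi: (P i); first exact: hF.
exact: pdeg_cst.
Qed.

Lemma pdeg_exp k g n : pdeg k g -> pdeg (n * k) (fun x => g x ^+ n).
Proof.
move=> hg; elim: n => [|n IH].
  have -> : (fun x => g x ^+ 0) = fun=> 1 by apply/funext.
  exact: pdeg_cst.
have -> : (fun x => g x ^+ n.+1) = (fun x => g x * g x ^+ n).
  by apply/funext => x; rewrite exprS.
by rewrite mulSn; apply: pdeg_mul.
Qed.

Lemma pdeg_prod (I : Type) (s : seq I) (k : I -> nat) (F : I -> pt -> R) :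
  (forall i, pdeg (k i) (F i)) ->
  pdeg (\sum_(i <- s) k i) (fun x => \prod_(i <- s) F i x).
Proof.
move=> hF; elim: s => [|i s IH].
  have -> : (fun x => \prod_(i <- [::]) F i x) = fun=> 1.
    by apply/funext => x; rewrite big_nil.
  exact: pdeg_cst.
have -> : (fun x => \prod_(j <- i :: s) F j x) =
   (fun x => F i x * \prod_(j <- s) F j x).
  by apply/funext => x; rewrite big_cons.
by rewrite big_cons; apply: pdeg_mul.
Qed.

Definition xmono (a : 'I_d -> nat) (x : pt) : R := \prod_i x 0 i ^+ a i.

Lemma pdeg_xmono a : pdeg (\sum_i a i) (xmono a).
Proof.
apply: pdeg_prod => i; have := pdeg_exp (a i) (pdeg_coord 0 i).
by rewrite muln1.
Qed.

Lemma poly_le_pdeg k g : poly_le k g -> pdeg k g.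
Proof.
move=> [c hc]; have -> : g = (fun x => \sum_(a : {ffun 'I_d -> 'I_k.+1} |
    (\sum_i a i <= k)%N) c a * xmono (fun i => a i) x) by apply/funext.
apply: pdeg_sum => a ak; apply: (@pdeg_leq (0 + \sum_i a i)) => //.
by apply: pdeg_mul; [exact: pdeg_cst|exact: pdeg_xmono].
Qed.

Lemma poly_leD k g h : poly_le k g -> poly_le k h -> poly_le k (fun x => g x + h x).
Proof.
move=> [c hc] [c' hc']; exists (fun a => c a + c' a) => x.
by rewrite hc hc' -big_split; apply: eq_bigr => a _; rewrite mulrDl.
Qed.

Lemma poly_le_xmono k c a : (\sum_i a i <= k)%N -> poly_le k (fun x => c * xmono a x).
Proof.
move=> ak.
have aik i : (a i < k.+1)%N.
  by rewrite ltnS (leq_trans _ ak)// (bigD1 i)//= leq_addr.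
pose b : {ffun 'I_d -> 'I_k.+1} := [ffun i => inord (a i)].
have bE i : b i = a i :> nat by rewrite ffunE inordK.
exists (fun a' => if a' == b then c else 0) => x.
rewrite (bigD1 b) /=; last by rewrite (eq_bigr _ (fun i _ => bE i)).
rewrite eqxx [X in _ + X]big1 ?addr0; last by move=> a' /andP[_ /negbTE->]; rewrite mul0r.
by congr (_ * _); apply: eq_bigr => i _; rewrite bE.
Qed.

(** Exponents are arbitrary functions in a list, so that a product of two expansions can be formed
    before its terms are collected into the coefficient family of [poly_le]. *)
Definition xspan k g := exists s : seq (R * ('I_d -> nat)),
  (forall t, List.In t s -> (\sum_i t.2 i <= k)%N) /\
  g = (fun x => \sum_(t <- s) t.1 * xmono t.2 x).

Lemma xspan_poly_le k g : xspan k g -> poly_le k g.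
Proof.
move=> [s [+ ->]]; elim: s => [|t s IH] hs.
  exists (fun=> 0) => x; rewrite big_nil big1// => a _; exact: mul0r.
have -> : (fun x => \sum_(t0 <- t :: s) t0.1 * xmono t0.2 x) =
   (fun x => t.1 * xmono t.2 x + \sum_(t0 <- s) t0.1 * xmono t0.2 x).
  by apply/funext => x; rewrite big_cons.
apply: poly_leD; first by apply: poly_le_xmono; apply: hs; left.
by apply: IH => t' st'; apply: hs; right.
Qed.

Lemma pdeg_poly_le k g : pdeg k g -> poly_le k g.
Proof.
move=> H; apply: xspan_poly_le.
elim: H => {k g} [k c|k i|k g h _ [s [hs ->]] _ [t [ht ->]]|
                 k l g h _ [s [hs ->]] _ [t [ht ->]]].
- exists [:: (c, fun=> 0%N)]; split=> [_ [<-|//]|]; first by rewrite /= big1.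
  apply/funext => x; rewrite big_seq1 /xmono big1 ?mulr1// => i _.
- exists [:: (1, fun j => (j == i : nat))]; split=> [_ [<-|//]|].
    by rewrite /= (bigD1 i)//= eqxx big1// => j /negbTE->.
  apply/funext => x; rewrite big_seq1 mul1r /xmono (bigD1 i)//= eqxx expr1.
  by rewrite big1 ?mulr1// => j /negbTE->; rewrite expr0.
- exists (s ++ t); split=> [u hu|].
    by case: (List.in_app_or _ _ _ hu); [exact: hs|exact: ht].
  by apply/funext => x; rewrite big_cat.
- exists [seq (u.1 * v.1, fun i => (u.2 i + v.2 i)%N) | u <- s, v <- t]; split.
    move=> w.
    have E (A B C : Type) (F : A -> B -> C) (s1 : seq A) (s2 : seq B) w0 :
        List.In w0 [seq F u v | u <- s1, v <- s2] ->
        exists u v, [/\ List.In u s1, List.In v s2 & w0 = F u v].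
      elim: s1 => //= u s1 IH hw.
      case: (List.in_app_or _ _ _ hw) => [|/IH[u' [v [h1 h2 h3]]]].
        elim: s2 {IH hw} => //= v s2 IH [<-|/IH[u' [v' [h1 h2 h3]]]].
          by exists u, v; split=> //; left.
        by exists u', v'; split=> //; right.
      by exists u', v; split=> //; right.
    move=> hw; have [u [v [us vt ->]]] := E _ _ _ _ _ _ _ hw; rewrite /= big_split /=.
    by apply: leq_add; [exact: hs|exact: ht].
  apply/funext => x; rewrite big_allpairs_dep mulr_suml /=; apply: eq_bigr => u _.
  rewrite mulr_sumr; apply: eq_bigr => v _ /=.
  rewrite mulrACA; congr (_ * _); rewrite /xmono -big_split; apply: eq_bigr => i _.
  by rewrite exprD.
Qed.

Lemma pdegP k g : poly_le k g <-> pdeg k g.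
Proof. by split; [exact: poly_le_pdeg|exact: pdeg_poly_le]. Qed.

Lemma pdeg_scale k c g : pdeg k g -> pdeg k (fun x => c * g x).
Proof. by move=> hg; apply: (pdeg_mul (pdeg_cst 0 c) hg). Qed.

Lemma pdeg_opp k g : pdeg k g -> pdeg k (fun x => - g x).
Proof.
move=> /(pdeg_scale (-1)); congr pdeg; apply/funext => x.
by rewrite mulN1r.
Qed.

Lemma pdeg_sub k g h : pdeg k g -> pdeg k h -> pdeg k (fun x => g x - h x).
Proof. by move=> hg /pdeg_opp; exact: pdeg_add. Qed.

Lemma pdeg_differentiable k g : pdeg k g -> forall x, differentiable g x.
Proof.
move=> H x; elim: H => {k g} [k c|k i|k g h _ dg _ dh|k l g h _ dg _ dh].
- exact: differentiable_cst.
- exact: differentiable_coord.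
- exact: differentiableD.
- exact: differentiableM.
Qed.

(** Since [0.-1] is 0, the degree bound alone does not survive the product rule when one factor has
    degree 0; the second clause removes that term. *)
Lemma pdeg_partial k g i : pdeg k g ->
  pdeg k.-1 (partial i g) /\ (k = 0%N -> partial i g = fun=> 0).
Proof.
elim=> {k g} [k c|k j|k g h hg [dg zg] hh [dh zh]|k l g h hg [dg zg] hh [dh zh]].
- have -> : partial i (fun=> c) = fun=> 0 by apply/funext => x; rewrite partial_cst.
  by split=> //; exact: pdeg_cst.
- have -> : partial i (fun x => x 0 j) = fun=> (i == j)%:R.
    by apply/funext => x; rewrite partial_coord.
  by split=> //; exact: pdeg_cst.
- have -> : partial i (fun x => g x + h x) = fun x => partial i g x + partial i h x.
    by apply/funext => x; rewrite partialD//; apply: pdeg_differentiable; eassumption.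
  split; first exact: pdeg_add.
  by move=> k0; rewrite zg// zh//; apply/funext => x; rewrite addr0.
- have -> : partial i (fun x => g x * h x) =
      fun x => partial i g x * h x + g x * partial i h x.
    by apply/funext => x; rewrite partialM//; apply: pdeg_differentiable; eassumption.
  split.
    apply: pdeg_add.
      case: k hg dg zg => [|k] hg dg zg; last exact: (pdeg_mul dg hh).
      rewrite zg//; rewrite (_ : (fun x => _) = fun=> 0); first exact: pdeg_cst.
      by apply/funext => x; rewrite mul0r.
    case: l hh dh zh => [|l] hh dh zh; last first.
      by have := pdeg_mul hg dh; rewrite addnS.
    rewrite zh//; rewrite (_ : (fun x => _) = fun=> 0); first exact: pdeg_cst.
    by apply/funext => x; rewrite mulr0.
  move=> /eqP; rewrite addn_eq0 => /andP[/eqP k0 /eqP l0].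
  by rewrite zg// zh//; apply/funext => x; rewrite mul0r mulr0 addr0.
Qed.

Lemma pdeg_C1 k g : pdeg k g -> C1 g.
Proof.
move=> hg; split; first exact: pdeg_differentiable hg.
move=> i; apply: differentiable_cont.
by have [/pdeg_differentiable] := pdeg_partial i hg.
Qed.

Lemma pdeg_line k g x w : pdeg k g ->
  exists P : {poly R}, (size P <= k.+1)%N /\ forall t, g (x + t *: w) = P.[t].
Proof.
elim=> {k g} [k c|k j|k g h _ [P [sP hP]] _ [Q [sQ hQ]]|
              k l g h _ [P [sP hP]] _ [Q [sQ hQ]]].
- exists c%:P; split=> [|t]; last by rewrite hornerC.
  by rewrite (leq_trans (size_polyC_leq1 _)).
- exists ((x 0 j)%:P + (w 0 j) *: 'X); split=> [|t]; last by rewrite !mxE !hornerE mulrC.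
  rewrite (leq_trans (size_polyD _ _))// geq_max (leq_trans (size_polyC_leq1 _))//=.
  by rewrite (leq_trans (size_scale_leq _ _))// size_polyX.
- exists (P + Q); split=> [|t]; last by rewrite hP hQ hornerD.
  by rewrite (leq_trans (size_polyD _ _))// geq_max sP.
- exists (P * Q); split=> [|t]; last by rewrite hP hQ hornerM.
  rewrite (leq_trans (size_polyMleq _ _))//.
  by have := leq_add sP sQ; lia.
Qed.

Lemma poly_eq0_interval (P : {poly R}) (e : R) : 0 < e ->
  (forall t, 0 < t < e -> P.[t] = 0) -> P = 0.
Proof.
move=> e0 h; apply/eqP/negPn/negP => P0.
(* Distinct points strictly inside the interval, one more than the degree of [P]. *)
pose s := [seq e / (i.+2)%:R | i <- iota 0 (size P)].
have us : uniq s.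
  rewrite map_inj_in_uniq ?iota_uniq// => i j _ _ /(mulfI (lt0r_neq0 e0)) /invr_inj.
  by move=> /eqP; rewrite eqr_nat => /eqP [].
have rs : all (root P) s.
  apply/allP => _ /mapP[i _ ->]; apply/eqP/h.
  rewrite divr_gt0 ?ltr0n//= ltr_pdivrMr ?ltr0n// ltr_pMr//.
  by rewrite ltr1n.
by have := max_poly_roots P0 rs us; rewrite size_map size_iota ltnn.
Qed.

(** Serves to pass from interior points of a cell or facet, where bumps are available, to all other
    points. *)
Lemma pdeg_line_eq0 k g x w (e : R) : pdeg k g -> 0 < e ->
  (forall t, 0 < t < e -> g (x + t *: w) = 0) -> forall t, g (x + t *: w) = 0.
Proof.
move=> hg e0 h; have [P [_ hP]] := pdeg_line x w hg.
have P0 : P = 0 by apply: poly_eq0_interval e0 _ => u hu; rewrite -hP h.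
by move=> t; rewrite hP P0 horner0.
Qed.

End polynomials.

(** * Divergence-free Raviart-Thomas fields *)

Section raviart_thomas.
Context {R : realType} {d : nat}.
Local Notation pt := 'rV[R]_d.

Lemma derive_horner_line (g : pt -> R) x (P : {poly R}) :
  (forall y, differentiable g y) -> (forall t, g (t *: x) = P.[t]) ->
  forall t, 'D_x g (t *: x) = P^`().[t].
Proof.
move=> dg hP t.
have E s : 0 + s *: x = s *: x by rewrite add0r.
have := derive_line (x := 0) (c := x) (t := t) (dg _).
have -> : (fun t => g (0 + t *: x)) = horner P.
  by apply/funext => s; rewrite E hP.
by rewrite E => /@derive_val <-; rewrite -derive1E -derivE.
Qed.

(* With beta the homogeneous part of degree k of b, the homogeneous part of
   degree k of div (a + b x) is (k + d) beta. *)
Lemma RT_divfree k (v : pt -> pt) : (0 < k)%N -> RT_poly k v ->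
  (forall x, divv v x = 0) -> polyv_le k v.
Proof.
move=> k0 [a [b [ha [c hc] hv]]] hdiv.
have hb : pdeg k b by apply/pdegP; exists c.
have {}ha i : pdeg k (fun x => a x 0 i) by apply/pdegP; exact: ha.
have db := pdeg_differentiable hb.
have dv x : divv v x = \sum_i partial i (fun y => a y 0 i) x + 'D_x b x + d%:R * b x.
  rewrite derive_partial// -big_split /=.
  rewrite (_ : d%:R * b x = \sum_(i < d) b x); last by rewrite sumr_const card_ord mulr_natl.
  rewrite -big_split /=; apply: eq_bigr => i _.
  have -> : (fun y => v y 0 i) = (fun y => a y 0 i + b y * y 0 i).
    by apply/funext => y; rewrite hv !mxE.
  rewrite partialD; [|exact: pdeg_differentiable (ha i) _|].
    rewrite partialM//; last exact: differentiable_coord.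
    by rewrite partial_coord eqxx mulr1 addrA [_ * x 0 i]mulrC.
  apply: differentiableM => //; exact: differentiable_coord.
pose beta x := \sum_(u : {ffun 'I_d -> 'I_k.+1} | (\sum_i u i <= k)%N && (\sum_i u i == k)%N)
    c u * xmono (fun i => u i) x.
have beta0 x : beta x = 0.
  (* The restriction of [b] to the ray through [x], graded by total degree, so that its coefficient
     of order [k] is [beta x]. *)
  pose B : {poly R} := \sum_(u : {ffun 'I_d -> 'I_k.+1} | (\sum_i u i <= k)%N)
     (c u * xmono (fun i => u i) x) *: 'X^(\sum_i u i).
  have hB t : b (t *: x) = B.[t].
    rewrite hc /B horner_sum; apply: eq_bigr => u _.
    rewrite hornerZ hornerXn -mulrA; congr (_ * _).
    rewrite /xmono -prodrXr mulrC -big_split; apply: eq_bigr => i _.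
    by rewrite !mxE exprMn.
  have hdA : pdeg k.-1 (fun y => \sum_i partial i (fun y => a y 0 i) y).
    by apply: pdeg_sum => i _; have [] := pdeg_partial i (ha i).
  have [P [sP hP]] := pdeg_line 0 x hdA.
  (* The divergence along the ray, as a polynomial in t. Its coefficient of order [k] is (k + d)
     times [beta x], because the contribution [P] of [a] has degree at most k - 1. *)
  have E0 : P + 'X * B^`() + d%:R *: B = 0.
    apply: (@poly_eq0_interval _ _ 1) => // t _.
    rewrite !hornerE -hP add0r -(derive_horner_line db hB) -hB.
    rewrite -[RHS](hdiv (t *: x)) dv; congr (_ + _ + _).
    rewrite !derive_partial// mulr_sumr; apply: eq_bigr => i _.
    by rewrite !mxE mulrA.
  have : (P + 'X * B^`() + d%:R *: B)`_k = 0 by rewrite E0 coef0.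
  have Bk : B`_k = beta x.
    rewrite /B coef_sum /beta big_mkcondr /=; apply: eq_bigr => u _.
    by rewrite coefZ coefXn eq_sym; case: eqP; rewrite ?mulr1 ?mulr0.
  rewrite !coefD coefZ mulrC coefMX gtn_eqF// coef_deriv prednK// Bk.
  rewrite (@nth_default _ _ P); last by rewrite (leq_trans sP)// prednK.
  rewrite add0r -[_ x *+ k]mulr_natl -mulrDl => /eqP; rewrite mulf_eq0 -natrD pnatr_eq0.
  by rewrite addn_eq0 (gtn_eqF k0) /= => /eqP.
have hb1 : pdeg k.-1 b.
  have -> : b = (fun x => \sum_(u : {ffun 'I_d -> 'I_k.+1} |
      (\sum_i u i <= k)%N && (\sum_i u i != k)%N) c u * xmono (fun i => u i) x).
    apply/funext => x; rewrite hc (bigID (fun u : {ffun 'I_d -> 'I_k.+1} => \sum_i u i == k)%N) /=.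
    by rewrite [X in X + _](beta0 x) add0r.
  apply: pdeg_sum => u /andP[u1 u2]; apply: pdeg_scale.
  apply: pdeg_leq (pdeg_xmono _).
  by rewrite -ltnS prednK// ltn_neqAle u2.
move=> i; apply/pdegP.
have -> : (fun x => v x 0 i) = (fun x => a x 0 i + b x * x 0 i).
  by apply/funext => x; rewrite hv !mxE.
apply: pdeg_add => //.
by have := pdeg_mul hb1 (pdeg_coord 0 i); rewrite addn1 prednK.
Qed.

End raviart_thomas.

(** * Lagrange interpolation on the principal lattice *)

Section lagrange_interpolation.
Context {R : realType} {d : nat}.
Local Notation pt := 'rV[R]_d.
Variables (p : 'I_d.+1 -> pt) (lam : 'I_d.+1 -> pt -> R) (k : nat).
Hypothesis k0 : (0 < k)%N.
Hypothesis lam_deg : forall i, pdeg 1 (lam i).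
Hypothesis lamP : forall (l : 'I_d.+1 -> R), \sum_i l i = 1 ->
  forall i, lam i (\sum_j l j *: p j) = l i.

Definition lattice_pt (b : 'I_d.+1 -> nat) : pt := \sum_i ((b i)%:R / k%:R) *: p i.

Lemma lam_lattice b i : (\sum_i b i = k)%N -> lam i (lattice_pt b) = (b i)%:R / k%:R.
Proof.
move=> hb; rewrite lamP//.
rewrite -mulr_suml -natr_sum hb divff// pnatr_eq0 -lt0n//.
Qed.

(** The inner product over [j] vanishes exactly where [k%:R * lam i] takes one of the values 0, ...,
    a_i - 1. *)
Definition lagr (a : 'I_d.+1 -> nat) (x : pt) : R :=
  \prod_i \prod_(j < a i) (k%:R * lam i x - (j : nat)%:R).

Lemma pdeg_lagr a : pdeg (\sum_i a i) (lagr a).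
Proof.
apply: pdeg_prod => i.
have := pdeg_prod (index_enum 'I_(a i)) (k := fun=> 1%N)
  (F := fun j x => k%:R * lam i x - (j : nat)%:R).
rewrite sum_nat_const card_ord muln1; apply=> j.
by apply: pdeg_sub; [exact: pdeg_scale|exact: pdeg_cst].
Qed.

(** A nonzero value at the lattice point of [b] means that no a_i exceeds b_i; with equal sums this
    forces equality. *)
Lemma lagr_lattice a b : (\sum_i a i = k)%N -> (\sum_i b i = k)%N ->
  (lagr a (lattice_pt b) != 0) = [forall i, a i == b i].
Proof.
move=> ha hb.
have kb i : k%:R * lam i (lattice_pt b) = (b i)%:R.
  by rewrite lam_lattice// mulrC divfK// pnatr_eq0 -lt0n.
apply/idP/idP => [h|/forallP h].
  have ab i : (a i <= b i)%N.
    rewrite leqNgt; apply/negP => ba; move/negP: h; apply; apply/eqP.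
    rewrite /lagr (bigD1 i)//= (bigD1 (Ordinal ba))//= kb subrr !mul0r//.
  have : (\sum_i b i == \sum_i a i)%N by rewrite ha hb.
  have S : (\sum_i (b i - a i) = 0)%N.
    by rewrite sumnB// ha hb subnn.
  move=> _; apply/forallP => i; rewrite eqn_leq ab /=.
  have := leq_trans (leq_addr (\sum_(j | j != i) (b j - a j)) (b i - a i))%N (leqnn _).
  by rewrite -(bigD1 i (P := xpredT) (F := fun j => b j - a j)%N)// S leqn0 subn_eq0.
rewrite /lagr; apply/prodf_neq0 => i _; apply/prodf_neq0 => j _.
rewrite kb -(eqP (h i)) subr_eq0 eqr_nat gtn_eqF//.
Qed.

Local Notation idx := {ffun 'I_d -> 'I_k.+1}.
Definition low : pred idx := fun u => (\sum_i u i <= k)%N.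

(** Vertex [ord0] receives what is left of [k]. This matches the lattice points with the monomials
    of degree at most [k], which makes the interpolation matrix square. *)
Definition lift_idx (u : idx) (i : 'I_d.+1) : nat :=
  if unlift ord0 i is Some j then u j else (k - \sum_j u j)%N.

Lemma lift_idx_sum u : low u -> (\sum_i lift_idx u i = k)%N.
Proof.
move=> hu; rewrite big_ord_recl {1}/lift_idx unlift_none.
rewrite [X in (_ + X)%N](eq_bigr (fun j => u j : nat)) => [|j _]; last by rewrite /lift_idx liftK.
by rewrite subnK.
Qed.

Lemma lift_idx_inj u v : (forall i, lift_idx u i = lift_idx v i) -> u = v.
Proof.
move=> h; apply/ffunP => j; apply: val_inj.
by have := h (lift ord0 j); rewrite /lift_idx !liftK.
Qed.

Lemma lift_idx_surj (b : 'I_d.+1 -> nat) : (\sum_i b i = k)%N ->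
  exists2 u, low u & forall i, lift_idx u i = b i.
Proof.
move=> hb.
have bk i : (b i < k.+1)%N by rewrite ltnS -hb (bigD1 i)//= leq_addr.
exists [ffun j => inord (b (lift ord0 j))].
  rewrite /low (eq_bigr (fun j => b (lift ord0 j))) => [|j _].
    by rewrite -hb big_ord_recl leq_addl.
  by rewrite ffunE inordK.
move=> i; rewrite /lift_idx; case: unliftP => [j ->|->].
  by rewrite ffunE inordK.
rewrite (eq_bigr (fun j => b (lift ord0 j))) => [|j _].
  by rewrite -hb big_ord_recl addnK.
by rewrite ffunE inordK.
Qed.

Definition nodal (u : idx) (x : pt) : R :=
  (lagr (lift_idx u) (lattice_pt (lift_idx u)))^-1 * lagr (lift_idx u) x.

Lemma pdeg_nodal u : low u -> pdeg k (nodal u).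
Proof.
move=> hu; apply: pdeg_scale; rewrite -{1}(lift_idx_sum hu); exact: pdeg_lagr.
Qed.

Lemma nodal_lattice u v : low u -> low v ->
  nodal u (lattice_pt (lift_idx v)) = (u == v)%:R.
Proof.
move=> hu hv; rewrite /nodal.
have [->|uv] := eqVneq u v.
  rewrite mulVf// lagr_lattice ?lift_idx_sum//.
  exact/forallP.
have /negbT : (lagr (lift_idx u) (lattice_pt (lift_idx v)) != 0) = false.
  rewrite lagr_lattice ?lift_idx_sum//; apply/negP => /forallP h.
  by case/eqP: uv; apply: lift_idx_inj => i; exact/eqP.
by rewrite negbK => /eqP ->; rewrite mulr0.
Qed.

Lemma lagrange_exists (g : pt -> R) : exists q, poly_le k q /\
  forall b, (\sum_i b i = k)%N -> q (lattice_pt b) = g (lattice_pt b).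
Proof.
exists (fun x => \sum_(u | low u) g (lattice_pt (lift_idx u)) * nodal u x); split.
  apply/pdegP; apply: pdeg_sum => u hu; apply: pdeg_scale; exact: pdeg_nodal.
move=> b hb; have [v hv vb] := lift_idx_surj hb.
have -> : b = lift_idx v by apply/funext => i; rewrite vb.
rewrite (bigD1 v)//= nodal_lattice// eqxx mulr1 big1 ?addr0//.
by move=> u /andP[hu /negbTE uv]; rewrite nodal_lattice// uv mulr0.
Qed.

(* Existence of the nodal basis makes the square matrix of the monomials at the
   lattice points right invertible, hence invertible. *)
Lemma lagrange_unique q : poly_le k q ->
  (forall b, (\sum_i b i = k)%N -> q (lattice_pt b) = 0) -> forall x, q x = 0.
Proof.
move=> [c hc] hq.
have /choice[C hC] : forall u : idx, exists cu : idx -> R, low u -> forall x,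
    nodal u x = \sum_(a | low a) cu a * xmono (fun i => a i) x.
  move=> u; have [hu|hu] := boolP (low u); last by exists (fun=> 0).
  by have /pdegP[cu hcu] := pdeg_nodal hu; exists cu => _ x; exact: hcu.
pose K := #|low|.
pose A : 'M[R]_K := \matrix_(i, j)
  xmono (fun l => (enum_val j : idx) l) (lattice_pt (lift_idx (enum_val i))).
pose B : 'M[R]_K := \matrix_(i, j) C (enum_val j) (enum_val i).
have lowE i : low (enum_val (A := low) i) by have := enum_valP i.
have E (F : idx -> R) : \sum_(a | low a) F a = \sum_(i < K) F (enum_val (A := low) i).
  exact: (big_enum_val (A := low) F).
have AB : A *m B = 1%:M.
  apply/matrixP => i j; rewrite !mxE.
  transitivity (nodal (enum_val j) (lattice_pt (lift_idx (enum_val i)))).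
    rewrite hC//.
    rewrite E.
    by apply: eq_bigr => l _; rewrite !mxE mulrC.
  by rewrite nodal_lattice// (inj_eq enum_val_inj) eq_sym.
have BA := mulmx1C AB.
pose w : 'cV[R]_K := \col_i c (enum_val i).
have Aw : A *m w = 0.
  apply/colP => i; rewrite !mxE -[RHS](hq _ (lift_idx_sum (lowE i))) hc.
  rewrite [RHS]E.
  by apply: eq_bigr => l _; rewrite !mxE mulrC.
have w0 : w = 0 by rewrite -[w]mul1mx -BA -mulmxA Aw mulmx0.
move=> x; rewrite hc.
rewrite [LHS]E.
apply: big1 => i _.
by have /colP/(_ i) := w0; rewrite !mxE => ->; rewrite mul0r.
Qed.

End lagrange_interpolation.

(** * Geometry of the triangulation *)

(** Both lists are strictly increasing and have the same elements. Deleting a vertex of a cell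
    therefore reindexes its enumeration by [lift i]. *)
Lemma filter_ord_neq n (i : 'I_n.+1) :
  [seq j <- enum 'I_n.+1 | j != i] = [seq lift i j | j <- enum 'I_n].
Proof.
apply: (inj_map val_inj); apply: (irr_sorted_eq ltn_trans ltnn).
- have h : sorted ltn [seq val j | j <- enum 'I_n.+1].
    by rewrite val_enum_ord iota_ltn_sorted.
  have tr : transitive (relpre (val : 'I_n.+1 -> nat) ltn).
    by move=> x y z /=; exact: ltn_trans.
  rewrite sorted_map; rewrite sorted_map in h.
  exact: (sorted_filter tr).
- rewrite -map_comp sorted_map.
  have : sorted (relpre (val : 'I_n -> nat) ltn) (enum 'I_n).
    by rewrite -sorted_map val_enum_ord iota_ltn_sorted.
  apply: sub_sorted => x y /=; rewrite /bump; lia.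
- move=> x; apply/mapP/mapP => -[j].
    rewrite mem_filter => /andP[ji _] ->.
    case: (unliftP i j) ji => [k ->|->]; last by rewrite eqxx.
    by move=> _; exists (lift i k) => //; apply: map_f; rewrite mem_enum.
  move=> /mapP[k _ ->] ->; exists (lift i k) => //.
  by rewrite mem_filter eq_sym neq_lift mem_enum.
Qed.

(** * Enumerations of the vertices of a simplex *)

Section labelling.
Context {vtx : finType} {k : nat}.
Implicit Types (T : {set vtx}) (e : 'I_k.+1 -> vtx).

(** An equality of lists rather than of sets, because [vertices], and with it every integral,
    follows the order of [enum]. *)
Definition labelled T e := enum T = [seq e i | i <- enum 'I_k.+1].

Lemma labelled_exists T : #|T| = k.+1 -> exists e, labelled T e.
Proof.
move=> Tk; have sT : size (enum T) = k.+1 by rewrite -cardE.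
case E : (enum T) sT => [//|V0 s] sT.
exists (fun i => nth V0 (V0 :: s) i).
rewrite /labelled E -[LHS](@mkseq_nth _ V0) sT /mkseq -val_enum_ord -map_comp.
by apply: eq_map.
Qed.

Section lab.
Variables (T : {set vtx}) (e : 'I_k.+1 -> vtx).
Hypothesis eT : labelled T e.

Lemma labelled_inj : injective e.
Proof.
by apply/injectiveP; rewrite /injectiveb /dinjectiveb -eT enum_uniq.
Qed.

Lemma labelled_mem V : V \in T = [exists i, e i == V].
Proof.
rewrite -mem_enum eT; apply/mapP/existsP => [[i _ ->]|[i /eqP <-]]; first by exists i.
by exists i; rewrite ?mem_enum.
Qed.

Lemma labelled_in i : e i \in T.
Proof. by rewrite labelled_mem; apply/existsP; exists i. Qed.

Lemma labelledP V : V \in T -> exists i, V = e i.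
Proof. by rewrite labelled_mem => /existsP[i /eqP <-]; exists i. Qed.

Lemma labelled_big (U : Type) (idx : U) (op : Monoid.com_law idx) (F : vtx -> U) :
  \big[op/idx]_(V in T) F V = \big[op/idx]_i F (e i).
Proof.
rewrite -big_enum /= eT big_map -[in RHS]big_enum /=.
by apply: eq_bigl.
Qed.

End lab.
End labelling.

Lemma labelled_facet (vtx : finType) k (T : {set vtx}) (e : 'I_k.+2 -> vtx) i :
  labelled T e -> labelled (T :\ e i) (e \o lift i).
Proof.
move=> eT; rewrite /labelled.
transitivity [seq e j | j <- [seq lift i j | j <- enum 'I_k.+1]]; last by rewrite -map_comp.
rewrite -filter_ord_neq.
have -> : enum (T :\ e i) = [seq V <- enum T | V != e i].
  rewrite /enum_mem -filter_predI; apply: eq_filter => V /=.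
  by rewrite !inE.
rewrite eT filter_map; congr (map _ _); apply: eq_filter => j /=.
by rewrite (inj_eq (labelled_inj eT)).
Qed.

(** * Barycentric coordinates and hat functions of a cell *)

Section cell.
Context {R : realType} {d : nat} {M : mesh R d}.
Local Notation pt := 'rV[R]_d.
Local Notation vtx := (vtx M).
Local Notation pos := (@pos R d M).
Implicit Types (T F : {set vtx}) (x y : pt).

Lemma labelled_vertices k T (e : 'I_k.+1 -> vtx) : labelled T e ->
  vertices (M := M) T = pos \o e :> ('I_k.+1 -> pt).
Proof.
move=> eT; apply/funext => i; rewrite /vertices eT -map_comp.
by rewrite (nth_map i) ?size_enum_ord// nth_ord_enum.
Qed.

Definition simplicial T := #|T| = d.+1 /\ aff_indep T.

(** A row of weights times this matrix gives the sum of the weights and the weighted sum of the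
    points, so that affine independence becomes invertibility. *)
Definition homog (p : 'I_d.+1 -> pt) : 'M[R]_(1 + d) :=
  \matrix_(i, j) (row_mx (1%:M : 'M[R]_1) (p i)) 0 j.

Lemma homog_mul (p : 'I_d.+1 -> pt) (l : 'rV[R]_(1 + d)) :
  l *m homog p = row_mx (\sum_i l 0 i)%:M (\sum_i l 0 i *: p i).
Proof.
rewrite -[LHS]hsubmxK; congr row_mx; apply/rowP => j.
  rewrite ord1 !mxE /= mulr1n; apply: eq_bigr => i _.
  by rewrite mxE (row_mxEl (1%:M : 'M[R]_1)) mxE mulr1.
rewrite !mxE summxE; apply: eq_bigr => i _.
by rewrite mxE (row_mxEr (1%:M : 'M[R]_1)) mxE.
Qed.

Lemma homog_unit (p : 'I_d.+1 -> pt) :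
  (forall l : 'I_d.+1 -> R, \sum_i l i = 0 -> \sum_i l i *: p i = 0 ->
     forall i, l i = 0) -> homog p \in unitmx.
Proof.
move=> h; rewrite unitmxE unitfE; apply/negP => /det0P[v v0 vH].
move: vH; rewrite homog_mul -[X in _ = X]row_mx0 => /eq_row_mx[h1 h2].
case/eqP: v0; apply/rowP => i; rewrite mxE.
apply: (h (fun i => v 0 i)) => //.
by have /matrixP/(_ 0 0) := h1; rewrite !mxE.
Qed.

(** The coordinates of x are the row (1, x) times the inverse of [homog p], hence affine in x. *)
Lemma bary_exists (p : 'I_d.+1 -> pt) : homog p \in unitmx ->
  exists lam : 'I_d.+1 -> pt -> R, [/\ forall i, pdeg 1 (lam i),
    forall x, \sum_i lam i x = 1,
    forall x, \sum_i lam i x *: p i = x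
    & forall l : 'I_d.+1 -> R, \sum_i l i = 1 ->
        forall i, lam i (\sum_j l j *: p j) = l i].
Proof.
move=> uH.
pose L x : 'rV[R]_(1 + d) := row_mx (1%:M : 'M[R]_1) x *m invmx (homog p).
have LH x : L x *m homog p = row_mx (1%:M : 'M[R]_1) x by rewrite mulmxKV.
exists (fun i x => L x 0 i).
have hL x : (\sum_i L x 0 i)%:M = 1%:M :> 'M[R]_1 /\ \sum_i L x 0 i *: p i = x.
  by have := LH x; rewrite homog_mul => /eq_row_mx.
split=> [i|x|x|l l1 i].
- apply: (@pdeg_leq _ _ 1) => //.
  have -> : (fun x => L x 0 i) = (fun x => \sum_(j < 1 + d)
     (row_mx (1%:M : 'M[R]_1) x) 0 j * invmx (homog p) j i).
    by apply/funext => x; rewrite mxE.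
  apply: pdeg_sum => j _; apply: (@pdeg_mul _ _ 1 0); last exact: pdeg_cst.
  case: (splitP j) => k jk.
    have -> : j = lshift d k by exact: val_inj.
    have -> : (fun x => row_mx (1%:M : 'M[R]_1) x 0 (lshift d k)) = (fun=> 1%:M 0 k).
      by apply/funext => x; rewrite row_mxEl.
    exact: pdeg_cst.
  have -> : j = rshift 1 k by exact: val_inj.
  have -> : (fun x => row_mx (1%:M : 'M[R]_1) x 0 (rshift 1 k)) = (fun x => x 0 k).
    by apply/funext => x; rewrite row_mxEr.
  exact: pdeg_coord.
- by have [/matrixP/(_ 0 0)] := hL x; rewrite !mxE.
- by have [_] := hL x.
- have -> : L (\sum_j l j *: p j) = \row_j l j; last by rewrite mxE.
  rewrite /L; apply: (canLR (mulmxK uH)); rewrite homog_mul; congr row_mx.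
    by congr (_%:M); rewrite -l1; apply: eq_bigr => j _; rewrite mxE.
  by apply: eq_bigr => j _; rewrite mxE.
Qed.

Lemma sum_off T k (e : 'I_k.+1 -> vtx) (U : zmodType) (F : vtx -> U) : labelled T e ->
  (forall V, V \notin T -> F V = 0) -> \sum_V F V = \sum_i F (e i).
Proof.
move=> eT F0; rewrite -(labelled_big eT) [LHS](bigID (mem T)) /=.
by rewrite [X in _ + X]big1 ?addr0// => V VT; exact: F0.
Qed.

Definition extend_by0 k (e : 'I_k.+1 -> vtx) (U : zmodType) (l : 'I_k.+1 -> U) V : U :=
  if [pick i | e i == V] is Some i then l i else 0.

Lemma extend_by0E T k (e : 'I_k.+1 -> vtx) (U : zmodType) (l : 'I_k.+1 -> U) i :
  labelled T e -> extend_by0 e l (e i) = l i.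
Proof.
move=> eT; rewrite /extend_by0; case: pickP => [j /eqP/(labelled_inj eT) ->//|].
by move=> /(_ i); rewrite eqxx.
Qed.

Lemma extend_by0_off T k (e : 'I_k.+1 -> vtx) (U : zmodType) (l : 'I_k.+1 -> U) V :
  labelled T e -> V \notin T -> extend_by0 e l V = 0.
Proof.
move=> eT; rewrite (labelled_mem eT) /extend_by0; case: pickP => // i ei.
by move=> /existsP[]; exists i.
Qed.

Lemma simplicial_homog T (e : 'I_d.+1 -> vtx) : simplicial T -> labelled T e ->
  homog (pos \o e) \in unitmx.
Proof.
move=> [_ aT] eT; apply: homog_unit => l l0 lp0 i.
rewrite -(extend_by0E l i eT); apply: aT => [V VT||].
- exact: extend_by0_off VT.
- rewrite (sum_off eT); last by move=> V; exact: extend_by0_off.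
  by rewrite -[RHS]l0; apply: eq_bigr => j _; rewrite (extend_by0E _ _ eT).
- rewrite (sum_off eT); last by move=> V VT; rewrite (extend_by0_off _ eT VT) scale0r.
  by rewrite -[RHS]lp0; apply: eq_bigr => j _; rewrite (extend_by0E _ _ eT).
Qed.

Section hat_functions.
Variable T : {set vtx}.
Hypothesis sT : simplicial T.

Let labT : exists e : 'I_d.+1 -> vtx, labelled T e.
Proof. by case: sT => /labelled_exists. Qed.

(** The case [k = 1] of [lagrange_unique], whose lattice consists of the vertices. *)
Lemma vertex_unique (q : pt -> R) : poly_le 1 q ->
  (forall W, W \in T -> q (pos W) = 0) -> forall x, q x = 0.
Proof.
move=> hq q0; have [e eT] := labT.
have [lam [ld _ _ lu]] := bary_exists (simplicial_homog sT eT).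
apply: (lagrange_unique (k := 1) (p := pos \o e) (lam := lam)) => // b b1.
have [i bi] : exists i, b i != 0%N.
  case: (pickP (fun i => b i != 0%N)) => [i bi|h]; first by exists i.
  by move: b1; rewrite big1// => i _; move: (h i) => /negbFE/eqP.
have bj j : b j = (j == i).
  have := b1; rewrite (bigD1 i)//= => H.
  have bi1 : b i = 1%N by move: bi H; case: (b i) => [|[]]//.
  have s0 : (\sum_(j | j != i) b j = 0)%N by move: H; rewrite bi1 add1n => -[].
  case: eqP => [->//|/eqP ji].
  by apply/eqP; move/eqP: s0; rewrite sum_nat_eq0 => /forallP/(_ j)/implyP/(_ ji).
rewrite /lattice_pt (bigD1 i)//= big1 => [|j /negbTE ji]; last first.
  by rewrite bj ji mul0r scale0r.
by rewrite addr0 bj eqxx divr1 scale1r q0//; exact: labelled_in.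
Qed.

Lemma hat_spec V : poly_le 1 (hat V T) /\
  forall W, W \in T -> hat V T (pos W) = (W == V)%:R.
Proof.
have [e eT] := labT.
have [lam [ld _ _ lu]] := bary_exists (simplicial_homog sT eT).
rewrite /hat; apply: (@xgetPex _ (fun _ => 0) [set p : pt -> R | poly_le 1 p /\
    forall W, W \in T -> p (pos W) = (W == V)%:R]).
have lp i j : lam i (pos (e j)) = (i == j)%:R.
  have := lu (fun k => (k == j)%:R) _ i; rewrite (bigD1 j)//= eqxx big1 ?addr0.
    move=> /(_ erefl); rewrite (bigD1 j)//= eqxx scale1r big1 ?addr0// => k /negbTE->.
    by rewrite scale0r.
  by move=> k /negbTE->.
have [VT|VT] := boolP (V \in T).
  have [i ->] := labelledP eT VT.
  exists (lam i); split; first exact/pdegP.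
  move=> W WT; have [j ->] := labelledP eT WT.
  by rewrite lp (inj_eq (labelled_inj eT)) eq_sym.
exists (fun=> 0); split; first by apply/pdegP; exact: pdeg_cst.
by move=> W WT; case: eqP => // WV; rewrite WV (negbTE VT) in WT.
Qed.

Lemma pdeg_hat V : pdeg 1 (hat V T).
Proof. by apply/pdegP; case: (hat_spec V). Qed.

Lemma hat_vertex V W : W \in T -> hat V T (pos W) = (W == V)%:R.
Proof. by case: (hat_spec V) => _; apply. Qed.

Lemma hat_off V x : V \notin T -> hat V T x = 0.
Proof.
move=> VT; apply: vertex_unique; first by case: (hat_spec V).
by move=> W WT; rewrite hat_vertex//; case: eqP => // WV; rewrite WV (negbTE VT) in WT.
Qed.

Lemma hat_sum x : \sum_V hat V T x = 1.
Proof.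
apply/eqP; rewrite -subr_eq0; apply/eqP.
apply: (vertex_unique (q := fun x => \sum_V hat V T x - 1)).
  apply/pdegP; apply: pdeg_sub; last exact: pdeg_cst.
  by apply: pdeg_sum => V _; exact: pdeg_hat.
move=> W WT; rewrite (bigD1 W)//= big1 ?addr0 => [|V VW].
  by rewrite hat_vertex// eqxx subrr.
by rewrite hat_vertex// eq_sym (negbTE VW).
Qed.

Lemma hat_comb x : \sum_V hat V T x *: pos V = x.
Proof.
apply/rowP => j; apply/eqP; rewrite -subr_eq0; apply/eqP.
apply: (vertex_unique (q := fun x => (\sum_V hat V T x *: pos V) 0 j - x 0 j)).
  apply/pdegP; apply: pdeg_sub; last exact: pdeg_coord.
  have -> : (fun x => (\sum_V hat V T x *: pos V) 0 j) =
    (fun x => \sum_V hat V T x * pos V 0 j).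
    by apply/funext => y; rewrite summxE; apply: eq_bigr => V _; rewrite mxE.
  by apply: pdeg_sum => V _; apply: (pdeg_mul (pdeg_hat V) (pdeg_cst 0 _)).
move=> W WT; rewrite (bigD1 W)//= big1 ?addr0 => [|V VW].
  by rewrite hat_vertex// eqxx scale1r subrr.
by rewrite hat_vertex// eq_sym (negbTE VW) scale0r.
Qed.

Lemma hat_affine V x y t : hat V T (x + t *: (y - x)) =
  hat V T x + t * (hat V T y - hat V T x).
Proof.
have [P [sP hP]] := pdeg_line x (y - x) (pdeg_hat V).
rewrite hP.
have h0 := hP 0; rewrite scale0r addr0 in h0.
have h1 := hP 1; rewrite scale1r addrC subrK in h1.
have E s : P.[s] = P`_0 + P`_1 * s.
  rewrite (horner_coef_wide s sP) !big_ord_recl big_ord0 /= addr0.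
  by rewrite expr0 mulr1 expr1.
rewrite h0 h1 !E mulr0 addr0 mulr1; ring.
Qed.

(** The gradient of an affine function is constant, see [grad_hat]; the origin is just a point of
    evaluation. *)
Definition ghat V : pt := grad (hat V T) 0.

Lemma hat_diff V x y : hat V T y - hat V T x = dot (ghat V) (y - x).
Proof.
have dh := pdeg_differentiable (pdeg_hat V).
have dpart j z : partial j (hat V T) z = partial j (hat V T) 0.
  have [hp _] := pdeg_partial j (pdeg_hat V).
  have [P [sP hP]] := pdeg_line 0 z hp.
  have sP1 : (size P <= 1)%N by [].
  have := hP 1; have := hP 0; rewrite scale0r scale1r addr0 add0r => -> ->.
  by rewrite (size1_polyC sP1) !hornerC.
have -> : dot (ghat V) (y - x) = 'D_(y - x) (hat V T) x.
  rewrite derive_partial//; apply: eq_bigr => j _.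
  by rewrite mxE [in RHS]dpart mulrC.
apply/esym/derive_affine => h.
by rewrite [h *: _ + x]addrC hat_affine addrC addKr.
Qed.

Lemma grad_hat V x : grad (hat V T) x = ghat V.
Proof.
apply/rowP => j; rewrite !mxE /partial; apply: derive_affine => h.
rewrite hat_diff addrK dotZr; congr (_ * _).
rewrite /dot (bigD1 j)//= !mxE !eqxx mulr1 big1 ?addr0// => l /negbTE lj.
by rewrite !mxE lj andbF mulr0.
Qed.

(** The differences [hat V T x - w V] form an affine dependence among the vertices of [T]. *)
Lemma hat_unique (w : vtx -> R) : (forall V, V \notin T -> w V = 0) ->
  \sum_V w V = 1 -> forall V, hat V T (\sum_W w W *: pos W) = w V.
Proof.
move=> w0 w1 V; have [_ aT] := sT.
set x := \sum_W _.
apply/eqP; rewrite -subr_eq0; apply/eqP.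
apply: (aT (fun V => hat V T x - w V)) => [W WT||].
- by rewrite hat_off// w0// subrr.
- by rewrite sumrB hat_sum w1 subrr.
- under eq_bigr do rewrite scalerBl.
  by rewrite sumrB hat_comb subrr.
Qed.

Lemma hullP x : hull T x <-> forall V, 0 <= hat V T x.
Proof.
split=> [[w [w0 wT w1 ->]] V|h]; first by rewrite hat_unique.
exists (fun V => hat V T x); split=> //; first by move=> V; exact: hat_off.
- exact: hat_sum.
- by rewrite hat_comb.
Qed.

Lemma sub_hullP F x : F \subset T ->
  hull F x <-> (forall V, 0 <= hat V T x) /\ (forall V, V \notin F -> hat V T x = 0).
Proof.
move=> /fintype.subsetP FT; split=> [[w [w0 wF w1 ->]]|[h1 h2]].
  have wT V : V \notin T -> w V = 0.
    by move=> VT; apply: wF; apply: contra VT; exact: FT.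
  by split=> V; rewrite hat_unique//; exact: wF.
exists (fun V => hat V T x); split=> //; [exact: hat_sum|by rewrite hat_comb].
Qed.

Lemma lagrange_spec k (g : pt -> R) : (0 < k)%N ->
  poly_le k (Defs.lagrange k T g) /\
  forall z, Defs.lattice k T z -> Defs.lagrange k T g z = g z.
Proof.
move=> k0; have [e eT] := labT.
have [lam [ld _ _ lu]] := bary_exists (simplicial_homog sT eT).
rewrite /Defs.lagrange; apply: (@xgetPex _ (fun _ => 0) [set p : pt -> R | poly_le k p /\
    forall z, Defs.lattice k T z -> p z = g z]).
have [q [hq qE]] := lagrange_exists (p := pos \o e) (lam := lam) k0 ld lu g.
exists q; split=> // z [a [aT ak ->]].
have E (F : vtx -> nat) : (forall V, V \notin T -> F V = 0%N) ->
    (\sum_V F V = \sum_i F (e i))%N.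
  move=> F0; rewrite -(labelled_big eT) [LHS](bigID (mem T)) /=.
  by rewrite [X in (_ + X)%N]big1 ?addn0// => V VT; exact: F0.
have -> : \sum_W ((a W)%:R / k%:R) *: pos W = lattice_pt (pos \o e) k (a \o e).
  by rewrite (sum_off eT)// => V VT; rewrite aT// mul0r scale0r.
by apply: qE; rewrite -E.
Qed.

Lemma lattice_unique k (q : pt -> R) : (0 < k)%N -> poly_le k q ->
  (forall z, Defs.lattice k T z -> q z = 0) -> forall x, q x = 0.
Proof.
move=> k0 hq q0; have [e eT] := labT.
have [lam [ld _ _ lu]] := bary_exists (simplicial_homog sT eT).
apply: (lagrange_unique (p := pos \o e) (lam := lam) (k := k)) => // b bk.
apply: q0.
pose a V := if [pick i | e i == V] is Some i then b i else 0%N.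
have aE i : a (e i) = b i.
  rewrite /a; case: pickP => [j /eqP/(labelled_inj eT) ->//|/(_ i)].
  by rewrite eqxx.
have a0 V : V \notin T -> a V = 0%N.
  rewrite (labelled_mem eT) /a; case: pickP => // i ei.
  by move=> /existsP[]; exists i.
exists a; split=> //.
  rewrite -bk [LHS](bigID (mem T)) /= [X in (_ + X)%N]big1 ?addn0; last first.
    by move=> V VT; exact: a0.
  by rewrite (labelled_big eT); apply: eq_bigr => i _; rewrite aE.
rewrite (sum_off eT); last by move=> V VT; rewrite a0// mul0r scale0r.
by apply: eq_bigr => i _; rewrite aE.
Qed.

End hat_functions.
End cell.

(** * Volumes of simplices *)

Section determinants.
Context {R : realType} {d : nat}.
Local Notation pt := 'rV[R]_d.

(** A block factorisation in which [L] adds the row of vertex [ord0] back to the edges. *)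
Lemma det_homog (p : 'I_d.+1 -> pt) : \det (homog p) = \det (simplex_edges p).
Proof.
pose L : 'M[R]_(1 + d) := block_mx 1%:M 0 (const_mx 1) 1%:M.
pose U : 'M[R]_(1 + d) := block_mx 1%:M (p ord0) 0 (simplex_edges p).
have -> : homog p = L *m U.
  rewrite mulmx_block !(mul1mx, mulmx1, mul0mx, mulmx0, addr0, add0r).
  have e0 (k : 'I_1) : lshift d k = ord0 by apply: val_inj; rewrite /= ord1.
  have eS (k : 'I_d) : rshift 1 k = lift ord0 k by exact: val_inj.
  have sl (k : 'I_1) : fintype.split (lshift d k) = inl k := unsplitK (inl k).
  have sr (k : 'I_d) : fintype.split (rshift 1 k) = inr k := unsplitK (inr k).
  rewrite -[LHS]submxK; congr block_mx; apply/matrixP => i j; rewrite !mxE.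
  - by rewrite sl !ord1 mxE.
  - by rewrite sr e0 ord1.
  - by rewrite sl !ord1 mxE.
  - by rewrite sr eS big_ord1 mxE mul1r addrCA subrr addr0.
by rewrite det_mulmx det_lblock det_ublock !det1 !mul1r.
Qed.

(** A change of base vertex, awkward in [simplex_edges], is a mere row permutation of [homog]. *)
Lemma det_edges_perm (p : 'I_d.+1 -> pt) (s : {perm 'I_d.+1}) :
  `|\det (simplex_edges (p \o s))| = `|\det (simplex_edges p)|.
Proof.
rewrite -!det_homog.
have -> : homog (p \o s) = row_perm s (homog p) by apply/matrixP => i j; rewrite !mxE.
by rewrite row_permE det_mulmx det_perm normrM normr_sign mul1r.
Qed.

Lemma sqrt_gram_square (p : 'I_d.+1 -> pt) :
  Num.sqrt (\det (simplex_edges p *m (simplex_edges p)^T)) = `|\det (simplex_edges p)|.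
Proof. by rewrite det_mulmx det_tr -expr2 sqrtr_sqr. Qed.

End determinants.

Section facet_volume.
Context {R : realType} {n : nat}.
Local Notation pt := 'rV[R]_n.+1.

Lemma dot_mulmx (u v : pt) : (u *m v^T) 0 0 = dot u v.
Proof. by rewrite mxE; apply: eq_bigr => i _; rewrite mxE. Qed.

(** Height times base: expressed in the normal and the edges of the facet, the edge matrix is
    triangular, with the signed height as its only diagonal entry other than 1. *)
Lemma facet_gram (p : 'I_n.+2 -> pt) i (nrm : pt) (h : R) (mu : 'I_n.+1 -> R) :
  dot nrm nrm = 1 ->
  (forall j, dot nrm (p (lift i j) - p (lift i ord0)) = 0) ->
  \sum_j mu j = 1 -> p i + h *: nrm = \sum_j mu j *: p (lift i j) ->
  `|\det (simplex_edges p)| = `|h| *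
   Num.sqrt (\det (simplex_edges (p \o lift i) *m (simplex_edges (p \o lift i))^T)).
Proof.
move=> nn1 nF mu1 hp.
(* Reorders the vertices so that the base point lies in the facet and the first edge leads to the
   opposite vertex [i]. *)
pose s : {perm 'I_n.+2} := (tperm ord0 (lift ord0 ord0) * lift_perm ord0 i 1)%g.
rewrite -(det_edges_perm p s).
set EF := simplex_edges (p \o lift i).
pose N : 'M[R]_(1 + n) := col_mx nrm EF.
have s0 : s ord0 = lift i ord0 by rewrite permM tpermL lift_perm_lift perm1.
have s1 : s (lift ord0 ord0) = i by rewrite permM tpermR lift_perm_id.
have sS (j : 'I_n) : s (lift ord0 (lift ord0 j)) = lift i (lift ord0 j).
  rewrite permM tpermD ?lift_perm_lift ?perm1//.
pose u : 'rV[R]_n := \row_j mu (lift ord0 j).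
have HV : p i - p (lift i ord0) = (- h) *: nrm + u *m EF.
  rewrite mulmx_sum_row.
  rewrite (eq_bigr (fun j : 'I_n => mu (lift ord0 j) *: p (lift i (lift ord0 j))
      - mu (lift ord0 j) *: p (lift i ord0))); last first.
    move=> j _; rewrite -scalerBr mxE; congr (_ *: _).
    by apply/rowP => k; rewrite !mxE.
  rewrite sumrB -scaler_suml.
  have m0 : \sum_(j < n) mu (lift ord0 j) = 1 - mu ord0.
    by rewrite -mu1 big_ord_recl addrAC subrr add0r.
  have m1 : \sum_(j < n) mu (lift ord0 j) *: p (lift i (lift ord0 j)) =
      p i + h *: nrm - mu ord0 *: p (lift i ord0).
    by rewrite hp big_ord_recl addrAC subrr add0r.
  by rewrite m0 m1 scalerBl scale1r; apply/rowP => k; rewrite !mxE; ring.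
have e0 : lshift n (ord0 : 'I_1) = ord0 by exact: val_inj.
have eS (k : 'I_n) : rshift 1 k = lift ord0 k by exact: val_inj.
have E : simplex_edges (p \o s) = block_mx (- h)%:M u 0 1%:M *m N.
  rewrite mul_block_col mul0mx mul1mx add0r mul_scalar_mx -HV.
  rewrite -[LHS](@vsubmxK _ 1 n). apply: (f_equal2 (@col_mx R 1 n n.+1)); apply/matrixP => k j.
    by rewrite [k]ord1 !mxE e0 /= s0 s1.
  by rewrite !mxE eS /= s0 sS.
(* The normal is a unit vector orthogonal to the facet, so the squared determinant of [N] is the
   Gramian of the facet. *)
have NN : N *m N^T = block_mx 1%:M 0 0 (EF *m EF^T).
  rewrite tr_col_mx mul_col_row; congr block_mx.
  - by apply/matrixP => k l; rewrite !ord1 dot_mulmx nn1 mxE.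
  - apply/matrixP => k l; rewrite !mxE -[RHS](nF (lift ord0 l)) /dot.
    by apply: eq_bigr => q _; rewrite [k]ord1 !mxE.
  - apply/matrixP => k l; rewrite !mxE -[RHS](nF (lift ord0 k)) /dot.
    by apply: eq_bigr => q _; rewrite [l]ord1 !mxE mulrC.
have dN : \det N ^+ 2 = \det (EF *m EF^T).
  by rewrite expr2 -{2}det_tr -det_mulmx NN det_ublock det1 mul1r.
rewrite -dN sqrtr_sqr E det_mulmx (@det_ublock _ 1 n) det1 mulr1 normrM.
by rewrite det_scalar1 normrN.
Qed.

End facet_volume.

(** * Outward normals and Gauss's theorem on a cell *)

Section cell_geometry.
Context {R : realType} {n : nat} {M : mesh R n.+1}.
Local Notation d := n.+1.
Local Notation pt := 'rV[R]_n.+1.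
Local Notation vtx := (vtx M).
Local Notation pos := (@pos R n.+1 M).
Implicit Types (T F : {set vtx}) (V W : vtx) (x c nrm : pt).

Section one_cell.
Variable T : {set vtx}.
Hypothesis sT : simplicial T.

Lemma facet_mem V : V \in T -> exists W, W \in T :\ V.
Proof.
move=> VT; apply/set0Pn; rewrite -card_gt0.
by have := cardsD1 V T; rewrite VT add1n; case: sT => -> _ [<-].
Qed.

Lemma ghat_sum : \sum_V ghat T V = 0.
Proof.
apply/eqP; rewrite -dot_eq0; apply/eqP; set g := \sum_V _.
rewrite {1}/g dot_suml.
transitivity (\sum_V (hat V T g - hat V T 0)).
  by apply: eq_bigr => V _; rewrite hat_diff// subr0.
by rewrite sumrB !hat_sum// subrr.
Qed.

Lemma ghat_comb c : \sum_V dot (ghat T V) c *: pos V = c.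
Proof.
transitivity (\sum_V (hat V T c - hat V T 0) *: pos V).
  by apply: eq_bigr => V _; rewrite hat_diff// subr0.
under eq_bigr do rewrite scalerBl.
by rewrite sumrB !hat_comb// subr0.
Qed.

Lemma ghat_off V : V \notin T -> ghat T V = 0.
Proof.
move=> VT; apply/eqP; rewrite -dot_eq0 -[X in dot _ X]subr0 -hat_diff//.
by rewrite !hat_off// subrr.
Qed.

Lemma ghat_edge V W : V \in T -> W \in T :\ V -> dot (ghat T V) (pos V - pos W) = 1.
Proof.
move=> VT; rewrite !inE => /andP[WV WT].
by rewrite -hat_diff// !hat_vertex// eqxx (negbTE WV) subr0.
Qed.

Lemma ghat_neq0 V : V \in T -> 0 < dot (ghat T V) (ghat T V).
Proof.
move=> VT; rewrite lt_neqAle dot_ge0 andbT eq_sym dot_eq0; apply/eqP => g0.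
have [W WF] := facet_mem VT.
by have := ghat_edge VT WF; rewrite g0 dot0l => /eqP; rewrite eq_sym oner_eq0.
Qed.

(** By [ghat_comb] any vector is a combination of the vertices with weights of sum zero. As [nrm]
    takes equal values on the vertices of the facet, it only sees the weight at [V]. *)
Lemma normal_direction V W nrm : V \in T -> W \in T :\ V ->
  (forall A B, A \in T :\ V -> B \in T :\ V -> dot nrm (pos A - pos B) = 0) ->
  nrm = dot nrm (pos V - pos W) *: ghat T V.
Proof.
move=> VT WF h; apply/eqP; rewrite -subr_eq0 -dot_eq0; apply/eqP.
set c := nrm - _; rewrite {1}/c dotBl dotZl; clearbody c.
rewrite -{1}(ghat_comb c) dot_sumr.
have E U : dot nrm (dot (ghat T U) c *: pos U) =
    dot (ghat T U) c * dot nrm (pos W) +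
    (U == V)%:R * (dot (ghat T U) c * dot nrm (pos V - pos W)).
  rewrite dotZr; have [->|UV] := eqVneq U V.
    by rewrite mul1r -mulrDr -dotDr addrC subrK.
  rewrite mul0r addr0; have [UT|UT] := boolP (U \in T); last first.
    by rewrite ghat_off// dot0l !mul0r.
  rewrite -[in LHS](subrK (pos W) (pos U)) dotDr (h U W) ?add0r//.
  by rewrite !inE UV.
rewrite (eq_bigr _ (fun U _ => E U)) big_split /= -mulr_suml -dot_suml ghat_sum dot0l.
rewrite mul0r add0r (bigD1 V)//= eqxx big1 ?addr0 => [|U /negbTE->]; last by rewrite mul0r.
by rewrite mul1r [X in _ - X]mulrC subrr.
Qed.

(** The hat function of [V] decreases towards the opposite facet, hence the minus sign. *)
Definition unit_normal V : pt := - (Num.sqrt (dot (ghat T V) (ghat T V)))^-1 *: ghat T V.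

Lemma sqrt_ghat_gt0 V : V \in T -> 0 < Num.sqrt (dot (ghat T V) (ghat T V)).
Proof. by move=> VT; rewrite sqrtr_gt0 ghat_neq0. Qed.

Lemma unit_normalP V : V \in T -> is_normal T (T :\ V) (unit_normal V).
Proof.
move=> VT; have g0 := sqrt_ghat_gt0 VT; split.
- rewrite /unit_normal dotZl dotZr; set s := Num.sqrt _ in g0 *.
  have -> : dot (ghat T V) (ghat T V) = s * s by rewrite -expr2 sqr_sqrtr ?dot_ge0.
  by field; rewrite gt_eqF.
- move=> A B; rewrite !inE => /andP[AV AT] /andP[BV BT].
  by rewrite dotZl -hat_diff// !hat_vertex// (negbTE AV) (negbTE BV) subrr mulr0.
- move=> A B AT; rewrite !inE AT andbT negbK => /eqP-> BF.
  by rewrite dotZl ghat_edge ?inE// mulr1 oppr_lt0 invr_gt0.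
Qed.

(** Orthogonality to the facet fixes the line, normalisation the length, and the last condition the
    sign. This makes the choice in [outer_normal] explicit. *)
Lemma normal_unique V nrm : V \in T -> is_normal T (T :\ V) nrm -> nrm = unit_normal V.
Proof.
move=> VT [n1 nF nV]; have [W WF] := facet_mem VT.
have E := normal_direction VT WF nF.
have neg : dot nrm (pos V - pos W) < 0 by apply: (nV V W VT _ WF); rewrite setD11.
move: E neg; set h := dot nrm _ => E neg.
have h2 : h ^+ 2 * dot (ghat T V) (ghat T V) = 1.
  by rewrite -n1 E dotZl dotZr mulrA -expr2.
have g0 := sqrt_ghat_gt0 VT.
rewrite E /unit_normal; congr (_ *: _).
have -> : h = - `|h| by rewrite ltr0_norm// opprK.
congr (- _); apply: (mulIf (lt0r_neq0 g0)); rewrite mulVf ?gt_eqF//.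
by rewrite -sqrtr_sqr -sqrtrM ?sqr_ge0// h2 sqrtr1.
Qed.

Lemma outer_normalE V : V \in T -> outer_normal T (T :\ V) = unit_normal V.
Proof.
move=> VT; apply: normal_unique => //.
apply: (@xgetPex _ 0 [set nrm | is_normal T (T :\ V) nrm]).
by exists (unit_normal V); exact: unit_normalP.
Qed.

Lemma outer_normalP V : V \in T -> is_normal T (T :\ V) (outer_normal T (T :\ V)).
Proof. by move=> VT; rewrite outer_normalE//; exact: unit_normalP. Qed.

Lemma cell_intE (e : 'I_n.+2 -> vtx) (g : pt -> R) : labelled T e ->
  cell_int T g = `|\det (simplex_edges (pos \o e))| *
     sint (fun y => g (simplex_param (pos \o e) y)).
Proof.
by move=> eT; rewrite /cell_int (labelled_vertices eT) /simplex_int sqrt_gram_square.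
Qed.

Lemma face_intE (e : 'I_n.+1 -> vtx) F (g : pt -> R) : labelled F e ->
  face_int F g = Num.sqrt (\det (simplex_edges (pos \o e) *m (simplex_edges (pos \o e))^T)) *
     sint (fun y => g (simplex_param (pos \o e) y)).
Proof. by move=> eF; rewrite /face_int /= (labelled_vertices eF). Qed.

(** The gradient of a hat function has length 1 / height. No factorials occur, because both factors
    are densities with respect to reference simplices. *)
Lemma facet_measure (e : 'I_n.+2 -> vtx) i : labelled T e ->
  `|\det (simplex_edges (pos \o e))| *: ghat T (e i) =
  - Num.sqrt (\det (simplex_edges (pos \o e \o lift i) *m
                   (simplex_edges (pos \o e \o lift i))^T)) *:
    outer_normal T (T :\ e i).
Proof.
move=> eT; have VT : e i \in T by exact: labelled_in.
have eF := labelled_facet i eT.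
have [n1 nF nV] := unit_normalP VT.
have g0 := sqrt_ghat_gt0 VT.
set s := Num.sqrt (dot _ _) in g0.
(* The foot of the perpendicular from vertex [e i]; its barycentric coordinates are the weights [mu]
   required by [facet_gram]. *)
pose y := pos (e i) + s^-1 *: unit_normal (e i).
have ss : s * s = dot (ghat T (e i)) (ghat T (e i)).
  by rewrite -expr2 /s sqr_sqrtr// dot_ge0.
have gu : dot (ghat T (e i)) (unit_normal (e i)) = - s.
  by rewrite /unit_normal dotZr -/s -ss; field; rewrite gt_eqF.
have hy : hat (e i) T y = 0.
  have -> : hat (e i) T y = hat (e i) T (pos (e i)) + (hat (e i) T y - hat (e i) T (pos (e i))).
    by rewrite addrC subrK.
  rewrite hat_diff// hat_vertex// eqxx /y addrAC subrr add0r dotZr gu.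
  by rewrite mulrN mulVf ?subrr// gt_eqF.
rewrite (facet_gram (i := i) (nrm := unit_normal (e i)) (h := s^-1)
   (mu := fun j => hat (e (lift i j)) T y)) //.
- rewrite outer_normalE// /unit_normal -/s scalerA gtr0_norm ?invr_gt0//.
  by congr (_ *: _); rewrite mulrNN mulrC.
- by move=> j; apply: nF; rewrite (labelled_in eF).
- rewrite -(hat_sum sT y) (sum_off eT); last by move=> V; exact: hat_off.
  rewrite (bigD1 i)//= hy add0r (reindex_omap (lift i) (unlift i)) /=; last first.
    by move=> j ji; case: unliftP ji => [k ->|->]; rewrite ?eqxx.
  by apply: eq_bigl => j; rewrite eq_sym neq_lift liftK eqxx.
- rewrite -/y -[LHS](hat_comb sT y) (sum_off eT); last first.
    by move=> V VT'; rewrite hat_off// scale0r.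
  rewrite (bigD1 i)//= hy scale0r add0r (reindex_omap (lift i) (unlift i)) /=; last first.
    by move=> j ji; case: unliftP ji => [k ->|->]; rewrite ?eqxx.
  by apply: eq_bigl => j; rewrite eq_sym neq_lift liftK eqxx.
Qed.

Lemma cell_facesE : cell_faces T = [set T :\ V | V in T]%SET.
Proof.
apply/finset.setP => F; rewrite !inE; apply/andP/imsetP => [[/eqP Fd /exists_inP[T']]|[V VT ->]].
  rewrite inE => /eqP -> FT.
  have : #|T :\: F| = 1%N.
    have := cardsID F T; rewrite (finset.setIidPr FT) Fd; case: sT => -> _.
    by rewrite -[X in _ = X]addn1 => /addnI.
  move=> /eqP/cards1P[V TF].
  have /finset.setP/(_ V) := TF; rewrite !inE eqxx => /andP[VF VT].
  exists V => //; apply/eqP; rewrite finset.eqEsubset subsetD1 FT VF /=.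
  apply/fintype.subsetP => W; rewrite !inE => /andP[WV WT].
  have /finset.setP/(_ W) := TF; rewrite !inE WT andbT (negbTE WV) => /negbFE//.
split.
  by have := cardsD1 V T; rewrite VT add1n; case: sT => -> _ [<-].
by apply/exists_inP; exists T; rewrite ?inE// subD1set.
Qed.

Lemma big_cell_faces (U : zmodType) (P : pred {set vtx}) (Phi : {set vtx} -> U) :
  \sum_(F in cell_faces T | P F) Phi F = \sum_(V in T | P (T :\ V)) Phi (T :\ V).
Proof.
rewrite cell_facesE big_mkcondr big_imset /= -?big_mkcondr// => V W VT WT E.
apply/eqP; apply/negPn/negP => VW.
by have /finset.setP/(_ V) := E; rewrite !inE eqxx VT VW.
Qed.

(** The vector [c] is a combination of the vertices with weights [dot (ghat T (e i)) c] of sum zero.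
    Its directional derivative is thus a combination of edge derivatives, to which [sint_gauss]
    applies. *)
Lemma cell_gauss (g : pt -> R) c : C1 g ->
  cell_int T (fun x => dot (grad g x) c) =
  \sum_(F in cell_faces T) dot (outer_normal T F) c * face_int F g.
Proof.
move=> C1g; have [e eT] := labelled_exists sT.1.
rewrite (cell_intE _ eT).
have -> : \sum_(F in cell_faces T) dot (outer_normal T F) c * face_int F g =
    \sum_(V in T) dot (outer_normal T (T :\ V)) c * face_int (T :\ V) g.
  transitivity (\sum_(F in cell_faces T | xpredT F)
      dot (outer_normal T F) c * face_int F g).
    by apply: eq_bigl => F; rewrite andbT.
  by rewrite big_cell_faces; apply: eq_bigl => V; rewrite andbT.
rewrite (labelled_big eT).
pose p := pos \o e.
pose I i := sint (fun y => g (simplex_param (p \o lift i) y)).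
have gam0 : \sum_i dot (ghat T (e i)) c = 0.
  rewrite -dot_suml -(sum_off (F := ghat T) eT) ?ghat_sum ?dot0l//.
  by move=> V; exact: ghat_off.
have gamc : \sum_i dot (ghat T (e i)) c *: p i = c.
  rewrite -[RHS]ghat_comb (sum_off eT)// => V VT.
  by rewrite ghat_off// dot0l scale0r.
have dg := C1g.1.
have Eg x : dot (grad g x) c = \sum_i dot (ghat T (e i)) c * 'D_(p i - p ord0) g x.
  under eq_bigr do rewrite derive_dot_grad// dotBr mulrBr.
  rewrite sumrB -mulr_suml gam0 mul0r subr0 -{1}gamc dot_sumr.
  by apply: eq_bigr => i _; rewrite dotZr.
have iD i : sintegrable (fun y => dot (ghat T (e i)) c *
    'D_(p i - p ord0) g (simplex_param p y)).
  by apply: sintegrableZ; exact: (sintegrable_cont p (continuous_derive (c := p i - p ord0) C1g)).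
have -> : sint (fun y => dot (grad g (simplex_param p y)) c) =
    - \sum_i dot (ghat T (e i)) c * I i.
  transitivity (sint (fun y => \sum_i dot (ghat T (e i)) c *
      'D_(p i - p ord0) g (simplex_param p y))).
    by apply: eq_sint => y _; rewrite Eg.
  rewrite /sint (integrable_Rsum _ iD).2.
  transitivity (\sum_i (dot (ghat T (e i)) c * I ord0 - dot (ghat T (e i)) c * I i)).
    apply: eq_bigr => i _; rewrite -/(sint _).
    rewrite sintZ; last by exact: (sintegrable_cont p (continuous_derive (c := p i - p ord0) C1g)).
    by rewrite sint_gauss// mulrBr.
  (* The terms [I ord0] common to all edge formulas cancel, as the weights sum to zero. *)
  by rewrite sumrB -[X in X - _]mulr_suml gam0 mul0r sub0r.
rewrite mulrN mulr_sumr -sumrN; apply: eq_bigr => i _.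
have eF := labelled_facet i eT.
rewrite (face_intE _ eF) mulrA -dotZl (facet_measure i eT) dotZl mulNr mulNr opprK.
by rewrite -mulrA mulrCA.
Qed.

End one_cell.
End cell_geometry.

(** * Bump functions of class C^1 *)

Section bump_functions.
Context {R : realType}.

Definition pospart (s : R) : R := (s + `|s|) / 2.

Lemma pospart_le0 s : s <= 0 -> pospart s = 0.
Proof. by move=> s0; rewrite /pospart ler0_norm// subrr mul0r. Qed.

Lemma pospart_ge0 s : 0 <= s -> pospart s = s.
Proof. by move=> s0; rewrite /pospart ger0_norm//; lra. Qed.

Lemma continuous_pospart : continuous pospart.
Proof.
move=> s; apply: cvgM; last exact: cvg_cst.
by apply: cvgD; [exact: cvg_id|exact: norm_continuous].
Qed.

(** The remainder is quadratic across the kink as well, which makes the squared positive part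
    differentiable at 0. *)
Lemma pospart_taylor s h :
  `|pospart (s + h) ^+ 2 - pospart s ^+ 2 - h * (2 * pospart s)| <= h ^+ 2.
Proof.
have [s0|s0] := leP 0 s; have [sh|sh] := leP 0 (s + h).
- rewrite !pospart_ge0// ler_norml; apply/andP; split; nra.
- rewrite (pospart_ge0 s0) (pospart_le0 (ltW sh)) ler_norml; apply/andP; split; nra.
- rewrite (pospart_ge0 sh) (pospart_le0 (ltW s0)) ler_norml; apply/andP; split; nra.
- rewrite (pospart_le0 (ltW s0)) (pospart_le0 (ltW sh)) expr0n !mulr0 !subr0 normr0.
  exact: sqr_ge0.
Qed.

Lemma is_derive_sq_pospart (s : R) :
  is_derive s 1 (fun s => pospart s ^+ 2) (2 * pospart s).
Proof.
have H : (fun h : R => h^-1 *: (((fun s => pospart s ^+ 2) \o shift s) (h *: 1)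
    - pospart s ^+ 2)) @ 0^' --> 2 * pospart s.
  apply/cvgrPdist_le => e e0; near=> h.
  have h0 : h != 0 by near: h; exact: nbhs_dnbhs_neq.
  rewrite distrC /= [h *: 1]mulr1 addrC [h + s]addrC.
  have := pospart_taylor s h.
  set D := pospart (s + h) ^+ 2 - _ => hD.
  have -> : - (2 * pospart s) + h^-1 *: D = h^-1 * (D - h * (2 * pospart s)).
    by rewrite mulrBr mulKf// addrC.
  rewrite normrM normfV ler_pdivrMl ?normr_gt0//.
  apply: le_trans hD _; rewrite -real_normK ?num_real// expr2 ler_wpM2l//.
  near: h; apply: dnbhs0_le => //.
by split; [apply/cvg_ex; exists (2 * pospart s)|apply/cvg_lim].
Unshelve. all: by end_near. Qed.

Context {d : nat}.
Local Notation pt := 'rV[R]_d.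

(** Test functions need only be C^1, so a squared positive part suffices. For positive [e], it is
    the square of the radius of the support. *)
Definition bumpf (x0 : pt) (e : R) (x : pt) : R :=
  pospart (e - dot (x - x0) (x - x0)) ^+ 2.

Lemma pdeg_sqdist (x0 : pt) e : pdeg 2 (fun x => e - dot (x - x0) (x - x0)).
Proof.
apply: pdeg_sub; first exact: pdeg_cst.
apply: pdeg_sum => i _.
have -> : (fun x : pt => (x - x0) 0 i * (x - x0) 0 i) =
    (fun x => (x 0 i - x0 0 i) * (x 0 i - x0 0 i)).
  by apply/funext => x; rewrite !mxE.
by apply: (@pdeg_mul _ _ 1 1); apply: pdeg_sub; (exact: pdeg_coord || exact: pdeg_cst).
Qed.

Lemma differentiable_sq_pospart (q : pt -> R) x : differentiable q x ->
  differentiable (fun x => pospart (q x) ^+ 2) x.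
Proof.
move=> dq; apply: (@differentiable_comp _ _ _ _ q (fun s => pospart s ^+ 2)) => //.
by apply/derivable1_diffP; case: (is_derive_sq_pospart (q x)).
Qed.

Lemma derive_sq_pospart (q : pt -> R) x v : differentiable q x ->
  'D_v (fun x => pospart (q x) ^+ 2) x = 2 * pospart (q x) * 'D_v q x.
Proof.
move=> dq; rewrite deriveE; last exact: differentiable_sq_pospart.
have ds : differentiable (fun s => pospart s ^+ 2) (q x).
  by apply/derivable1_diffP; case: (is_derive_sq_pospart (q x)).
rewrite (_ : (fun x => _) = (fun s => pospart s ^+ 2) \o q)//.
rewrite diff_comp//= -[X in 'd _ _ X]mulr1 -[_ * 1]/(_ *: 1) linearZ /=.
rewrite -(deriveE _ dq) -(deriveE _ ds) (@derive_val _ _ _ _ _ _ _ (is_derive_sq_pospart (q x))).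
exact: mulrC.
Qed.

Lemma C1_bump x0 e : C1 (bumpf x0 e).
Proof.
have hq := pdeg_sqdist x0 e; have dq := pdeg_differentiable hq.
split=> [x|i]; first exact: differentiable_sq_pospart.
have -> : partial i (bumpf x0 e) = (fun x => (2 * pospart (e - dot (x - x0) (x - x0))) *
    partial i (fun x => e - dot (x - x0) (x - x0)) x).
  by apply/funext => x; rewrite /partial derive_sq_pospart.
have cq := differentiable_cont dq.
have cp := (pdeg_C1 hq).2 i.
have cpp : continuous (fun x : pt => pospart (e - dot (x - x0) (x - x0))).
  by move=> x; apply: (continuous_comp (cq x)); exact: continuous_pospart.
by move=> x; exact: (cvgM (cvgM (cvg_cst (2 : R)) (cpp x)) (cp x)).
Qed.

Lemma bump0 x0 e x : e <= dot (x - x0) (x - x0) -> bumpf x0 e x = 0.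
Proof. by move=> h; rewrite /bumpf pospart_le0 ?expr0n// subr_le0. Qed.

Lemma bump_ge0 x0 e x : 0 <= bumpf x0 e x.
Proof. exact: sqr_ge0. Qed.

Lemma bump_gt0 x0 e : 0 < e -> 0 < bumpf x0 e x0.
Proof.
move=> e0; rewrite /bumpf subrr dot0l subr0 pospart_ge0 ?ltW//.
by rewrite exprn_gt0.
Qed.

Lemma grad_bump0 x0 e x : e <= dot (x - x0) (x - x0) -> grad (bumpf x0 e) x = 0.
Proof.
move=> h; have dq := pdeg_differentiable (pdeg_sqdist x0 e).
apply/rowP => i; rewrite !mxE /partial derive_sq_pospart// pospart_le0 ?subr_le0//.
by rewrite mulr0 mul0r.
Qed.

Lemma test_fun_bump (q : pt -> R) k x0 e : 0 <= e -> pdeg k q ->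
  test_fun setT (fun x => q x * bumpf x0 e x).
Proof.
move=> e0 hq; split; first by apply: C1_mul; [exact: pdeg_C1 hq|exact: C1_bump].
exists [set x | dot (x - x0) (x - x0) <= e]; split=> //.
  apply: bounded_closed_compact.
    exists (e + 1 + `|x0|); split; first exact: num_real.
    move=> N hN x /= hx; apply: le_trans (ltW hN).
    rewrite -{1}(subrK x0 x) (le_trans (ler_normD _ _))// lerD2r.
    rewrite leNgt; apply/negP => h.
    have : `|x - x0| ^+ 2 <= e by apply: le_trans (norm_le_dot _) hx.
    have : 0 <= `|x - x0| by [].
    by move: h e0; set u := `|_|; nra.
  have cq := differentiable_cont (pdeg_differentiable (pdeg_sqdist x0 e)).
  have -> : [set x | dot (x - x0) (x - x0) <= e] =
     (fun x => e - dot (x - x0) (x - x0)) @^-1` [set y | 0 <= y].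
    by apply/seteqP; split=> x /=; rewrite subr_ge0.
  by apply: preimage_closed => [x _|]; [exact: cq|exact: closed_ge].
by move=> x /negP; rewrite -ltNge => h; rewrite bump0 ?mulr0// ltW.
Qed.

End bump_functions.

(** * Normal and tangential components of matrices *)

Section normals.
Context {R : realType} {d : nat}.
Implicit Types (tau : 'M[R]_d) (nrm : 'rV[R]_d).

Lemma nnN tau nrm : nn tau (- nrm) = nn tau nrm.
Proof. by rewrite /nn mulNmx dotNl dotNr opprK. Qed.

Lemma ntN tau nrm : nt tau (- nrm) = - nt tau nrm.
Proof. by rewrite /nt mulNmx dotNl dotNr opprK scalerN opprD. Qed.

Lemma ntD tau1 tau2 nrm : nt (tau1 + tau2) nrm = nt tau1 nrm + nt tau2 nrm.
Proof. by rewrite /nt linearD /= mulmxDr dotDl scalerDl opprD addrACA. Qed.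

Lemma ntZ (a : R) tau nrm : nt (a *: tau) nrm = a *: nt tau nrm.
Proof. by rewrite /nt linearZ /= -scalemxAr dotZl scalerBr scalerA. Qed.

Lemma nt0 nrm : nt (0 : 'M[R]_d) nrm = 0.
Proof. by rewrite -(scale0r 0) ntZ scale0r. Qed.

Lemma ntB tau1 tau2 nrm : nt (tau1 - tau2) nrm = nt tau1 nrm - nt tau2 nrm.
Proof. by rewrite ntD -scaleN1r ntZ scaleN1r. Qed.

Lemma nnD tau1 tau2 nrm : nn (tau1 + tau2) nrm = nn tau1 nrm + nn tau2 nrm.
Proof. by rewrite /nn linearD /= mulmxDr dotDr. Qed.

Lemma nnZ (a : R) tau nrm : nn (a *: tau) nrm = a * nn tau nrm.
Proof. by rewrite /nn linearZ /= -scalemxAr dotZr. Qed.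

Lemma nnB tau1 tau2 nrm : nn (tau1 - tau2) nrm = nn tau1 nrm - nn tau2 nrm.
Proof. by rewrite nnD -scaleN1r nnZ mulN1r. Qed.

Lemma nn0 nrm : nn (0 : 'M[R]_d) nrm = 0.
Proof. by rewrite -(scale0r 0) nnZ mul0r. Qed.

Lemma nn_scalar (a : R) nrm : dot nrm nrm = 1 -> nn a%:M nrm = a.
Proof. by move=> n1; rewrite /nn tr_scalar_mx mul_mx_scalar dotZr n1 mulr1. Qed.

Lemma nt_scalar (a : R) nrm : dot nrm nrm = 1 -> nt a%:M nrm = 0.
Proof.
by move=> n1; rewrite /nt tr_scalar_mx mul_mx_scalar dotZl n1 mulr1 subrr.
Qed.

Lemma dot_nt_normal tau nrm : dot nrm nrm = 1 -> dot (nt tau nrm) nrm = 0.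
Proof. by move=> n1; rewrite /nt dotBl dotZl n1 mulr1 subrr. Qed.

(** With c_t as tangential test vector, both components recombine to the full normal flux; this is
    why the pairs (c, c_t) behave like constants. *)
Lemma dot_nn_nt tau nrm (c : 'rV[R]_d) : dot nrm nrm = 1 ->
  nn tau nrm * dot c nrm + dot (nt tau nrm) (c - dot c nrm *: nrm) =
  dot (nrm *m tau^T) c.
Proof.
move=> n1; rewrite /nn /nt !dotBl !dotBr !dotZl !dotZr n1 (dotC nrm c) (dotC nrm (nrm *m _)).
by ring.
Qed.

End normals.

(** * Facets and jumps in a triangulation *)

Section mesh_geometry.
Context {R : realType} {n : nat} {M : mesh R n.+1}.
Local Notation d := n.+1.
Local Notation pt := 'rV[R]_n.+1.
Local Notation vtx := (vtx M).
Local Notation pos := (@pos R n.+1 M).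
Local Notation cells := (cells M).
Implicit Types (T F : {set vtx}) (V W : vtx) (x y c nrm : pt).
Variable Omega : set pt.
Hypothesis hM : triangulation M Omega.

Lemma cell_simplicial T : T \in cells -> simplicial T.
Proof. by case: hM => _ h _ _ _; exact: h. Qed.

Lemma hull_inter T1 T2 x : T1 \in cells -> T2 \in cells ->
  hull T1 x -> hull T2 x -> hull (T1 :&: T2)%SET x.
Proof. by case: hM => _ _ _ h _ c1 c2 h1 h2; rewrite -(h _ _ c1 c2). Qed.

Lemma in_faces_of (C : {set {set vtx}}) F :
  F \in faces_of C <-> #|F| = d /\ exists2 T, T \in C & F \subset T.
Proof.
rewrite inE; split=> [/andP[/eqP Fd /exists_inP[T TC FT]]|[-> [T TC FT]]].
  by split=> //; exists T.
by rewrite eqxx; apply/exists_inP; exists T.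
Qed.

Lemma in_cell_faces T F : F \in cell_faces T <-> #|F| = d /\ F \subset T.
Proof.
rewrite /cell_faces in_faces_of; split=> -[Fd].
  by move=> [T']; rewrite inE => /eqP ->.
by move=> FT; split=> //; exists T => //; rewrite inE.
Qed.

Lemma cell_face_ex T F : T \in cells -> F \in cell_faces T ->
  exists2 V, V \in T & F = T :\ V.
Proof.
move=> /cell_simplicial sT; rewrite (cell_facesE sT) => /imsetP[V VT ->].
by exists V.
Qed.

Lemma outerP T F : T \in cells -> F \in cell_faces T ->
  is_normal T F (outer_normal T F).
Proof.
move=> cT FT; have [V VT ->] := cell_face_ex cT FT.
exact: (outer_normalP (cell_simplicial cT) VT).
Qed.

Lemma outer_unit T F : T \in cells -> F \in cell_faces T ->
  dot (outer_normal T F) (outer_normal T F) = 1.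
Proof. by move=> cT FT; have [] := outerP cT FT. Qed.

Definition barycenter (A : {set vtx}) : pt := \sum_V ((V \in A)%:R / #|A|%:R) *: pos V.

Lemma hat_barycenter T (A : {set vtx}) V : T \in cells -> A \subset T -> (0 < #|A|)%N ->
  hat V T (barycenter A) = (V \in A)%:R / #|A|%:R.
Proof.
move=> cT AT A0; rewrite (hat_unique (cell_simplicial cT))// => [W WT|].
  case: (boolP (W \in A)) => WA; rewrite ?mul0r//.
  by move/fintype.subsetP/(_ W WA): AT => h; rewrite h in WT.
rewrite -mulr_suml (_ : \sum_V _ = #|A|%:R) ?divff ?pnatr_eq0 -?lt0n//.
by rewrite -sum1_card [in RHS]big_mkcond [RHS]natr_sum; apply: eq_bigr => W _; case: (W \in A).
Qed.

Lemma common_facet_notin T1 T2 (A : vtx) F : T1 \in cells -> T2 \in cells -> T1 != T2 ->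
  A \in T1 -> F = T1 :\ A -> F \subset T2 -> A \notin T2.
Proof.
move=> c1 c2 T12 AT1 FE FT2; apply/negP => AT2; case/eqP: T12.
apply/eqP; rewrite eqEcard (cell_simplicial c1).1 (cell_simplicial c2).1 leqnn andbT.
apply/fintype.subsetP => W WT1; have [->//|WA] := eqVneq W A.
by apply: (fintype.subsetP FT2); rewrite FE !inE WA.
Qed.

(* Otherwise both cells lie on the same side of F and overlap near F. *)
Lemma outer_opposite T1 T2 F : T1 \in cells -> T2 \in cells -> T1 != T2 ->
  F \in cell_faces T1 -> F \in cell_faces T2 ->
  outer_normal T2 F = - outer_normal T1 F.
Proof.
move=> c1 c2 T12 F1 F2.
have [A AT1 FA] := cell_face_ex c1 F1; have [B BT2 FB] := cell_face_ex c2 F2.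
have [s1 s2] := (cell_simplicial c1, cell_simplicial c2).
have [/in_cell_faces[Fd FT1] /in_cell_faces[_ FT2]] := (F1, F2).
have [n1u n1F n1A] := outerP c1 F1; have [n2u n2F n2B] := outerP c2 F2.
set n1 := outer_normal T1 F in n1u n1F n1A *.
set n2 := outer_normal T2 F in n2u n2F n2B *.
have [W WF] := facet_mem s1 AT1.
have E1 : n1 = dot n1 (pos A - pos W) *: ghat T1 A.
  by apply: normal_direction => // ? ?; rewrite -FA; exact: n1F.
have E2 : n2 = dot n2 (pos A - pos W) *: ghat T1 A.
  by apply: normal_direction => // ? ?; rewrite -FA; exact: n2F.
rewrite -FA in WF.
have AF : A \notin F by rewrite FA setD11.
have BF : B \notin F by rewrite FB setD11.
have neg1 : dot n1 (pos A - pos W) < 0 by exact: n1A.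
move: E1 E2 neg1; set a1 := dot n1 _; set a2 := dot n2 _ => E1 E2 neg1.
have sq : a1 ^+ 2 = a2 ^+ 2.
  have g0 := ghat_neq0 s1 AT1; apply: (mulIf (lt0r_neq0 g0)).
  have -> : a1 ^+ 2 * dot (ghat T1 A) (ghat T1 A) = dot n1 n1.
    by rewrite E1 dotZl dotZr mulrA -expr2.
  have -> : a2 ^+ 2 * dot (ghat T1 A) (ghat T1 A) = dot n2 n2.
    by rewrite E2 dotZl dotZr mulrA -expr2.
  by rewrite n1u n2u.
move/eqP: sq; rewrite eqf_sqr => /orP[/eqP a12|/eqP a12]; last first.
  by rewrite E2 E1 a12 scaleNr opprK.
have WT2 : W \in T2 by exact: (fintype.subsetP FT2).
have WT1 : W \in T1 by exact: (fintype.subsetP FT1).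
have n12 : n2 = n1 by rewrite E1 E2 a12.
have : dot n2 (pos B - pos W) < 0 by exact: n2B.
(* With equal normals [B] lies on the same side of [F] as [A], so that the hat function of [A] on
   [T1] is positive at [pos B]. *)
rewrite n12 E1 dotZl nmulr_rlt0// -hat_diff// (hat_vertex s1 _ WT1).
have WA : (W == A) = false by apply/eqP => WA; rewrite -WA WF in AF.
rewrite WA subr0 => hB.
have F0 : (0 < #|F|)%N by rewrite Fd.
set y := pos B in hB; set x0 := barycenter F.
pose K := \sum_V `|hat V T1 y - hat V T1 x0|.
have K0 : 0 <= K by apply: sumr_ge0.
have D0 : 0 < d%:R :> R by rewrite ltr0n.
(* So short a step from the barycenter towards [pos B] changes no coordinate on [T1] by more than 1
   / d, its value at the vertices of [F]. *)
pose t := (d%:R * (1 + K))^-1.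
have K1 : 0 < 1 + K by rewrite ltr_pwDl.
have t0 : 0 < t by rewrite invr_gt0 mulr_gt0.
have t1 : t <= 1.
  rewrite invf_le1 ?mulr_gt0//; apply: (@le_trans _ _ (1 * 1)); first by rewrite mulr1.
  by apply: ler_pM => //; rewrite ?ler1n// lerDl.
pose x := x0 + t *: (y - x0).
have x0E T V : T \in cells -> F \subset T -> hat V T x0 = (V \in F)%:R / d%:R.
  by move=> cT FT; rewrite hat_barycenter// Fd.
have x0off T V : T \in cells -> F \subset T -> V \notin F -> hat V T x0 = 0.
  by move=> cT FT /negbTE VF; rewrite x0E// VF mul0r.
have h1 : hull T1 x.
  apply/(hullP s1) => V; rewrite hat_affine//.
  have [VF|VF] := boolP (V \in F).
    have hx : hat V T1 x0 = d%:R^-1 by rewrite x0E// VF mul1r.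
    have h : t * `|hat V T1 y - hat V T1 x0| <= d%:R^-1.
      apply: (@le_trans _ _ (t * K)).
        rewrite ler_pM2l// /K (bigD1 V)//= lerDl.
        by apply: sumr_ge0.
      rewrite /t invfM -mulrA ler_piMr ?invr_ge0 ?ler0n//.
      by rewrite ler_pdivrMl// mulr1 lerDr.
    have : - (t * `|hat V T1 y - hat V T1 x0|) <= t * (hat V T1 y - hat V T1 x0).
      rewrite -mulrN ler_pM2l// lerNl.
      by rewrite (le_trans (ler_norm _))// normrN.
    move: h; set z := t * `|_|; set w := t * (_ - _); rewrite hx => h1 h2.
    by rewrite -lerBlDl sub0r (le_trans _ h2)// lerN2.
  rewrite (x0off T1 V)// subr0 add0r.
  have [->|VA] := eqVneq V A; first by rewrite mulr_ge0 ?ltW.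
  by rewrite hat_off ?mulr0//; move: VF; rewrite FA !inE VA.
have h2 : hull T2 x.
  apply/(hullP s2) => V; rewrite hat_affine// x0E// hat_vertex//.
  rewrite (_ : _ + _ = (1 - t) * ((V \in F)%:R / d%:R) + t * (B == V)%:R); last by ring.
  apply: addr_ge0; apply: mulr_ge0; [by rewrite subr_ge0|exact: divr_ge0|exact: ltW|exact: ler0n].
(* Conformity puts the common point into the hull of the common vertices, which do not include [A],
   although its coordinate at [A] is positive. *)
have := hull_inter c1 c2 h1 h2.
have AT2 := common_facet_notin c1 c2 T12 AT1 FA FT2.
move=> /(sub_hullP s1 _ (finset.subsetIl _ _))[_ /(_ A)].
rewrite inE (negbTE AT2) andbF => /(_ isT).
rewrite hat_affine// (x0off T1 A)// subr0 add0r => /eqP; rewrite mulf_eq0.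
by rewrite !gt_eqF.
Qed.

Lemma outer_neq_opp T F : T \in cells -> F \in cell_faces T ->
  outer_normal T F != - outer_normal T F.
Proof.
move=> cT FT; apply/eqP => E; have := outer_unit cT FT.
by rewrite {1}E dotNl outer_unit// => {E} h; lra.
Qed.

(** Three nonzero normals cannot be pairwise opposite. *)
Lemma facet_at_most_two T1 T2 T3 F : T1 \in cells -> T2 \in cells -> T3 \in cells ->
  F \in cell_faces T1 -> F \in cell_faces T2 -> F \in cell_faces T3 ->
  T1 != T2 -> T1 != T3 -> T2 = T3.
Proof.
move=> c1 c2 c3 F1 F2 F3 T12 T13; apply/eqP/negPn/negP => T23.
have e12 := outer_opposite c1 c2 T12 F1 F2.
have e13 := outer_opposite c1 c3 T13 F1 F3.
have e23 := outer_opposite c2 c3 T23 F2 F3.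
have := outer_neq_opp c1 F1; rewrite -e13 e23 e12 opprK eqxx//.
Qed.

Section jumps.
Variables (C : {set {set vtx}}) (F : {set vtx}).
Hypothesis Ccells : forall T, T \in C -> T \in cells.
Hypothesis FC : F \in faces_of C.

Lemma cell1P : cell1 C F \in C /\ F \subset cell1 C F.
Proof.
have [Fd [T TC FT]] := (in_faces_of C F).1 FC.
rewrite /cell1; case: pickP => [T' /andP[]//|/(_ T)].
by rewrite TC FT.
Qed.

Lemma facet_of_C T : T \in C -> F \subset T -> F \in cell_faces T.
Proof. by move=> TC FT; apply/in_cell_faces; have [] := (in_faces_of C F).1 FC. Qed.

Lemma outer_face_normal T : T \in C -> F \subset T ->
  outer_normal T F = if T == cell1 C F then face_normal C F else - face_normal C F.
Proof.
move=> TC FT; have [c1 F1] := cell1P.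
case: eqP => [->//|/eqP Tc]; rewrite /face_normal.
apply: outer_opposite; rewrite ?Ccells ?facet_of_C//.
by rewrite eq_sym.
Qed.

Lemma face_normal_unit : dot (face_normal C F) (face_normal C F) = 1.
Proof.
have [c1 F1] := cell1P.
by apply: outer_unit; [exact: Ccells|exact: facet_of_C].
Qed.

Lemma jump_nt (tau : {set vtx} -> 'M[R]_n.+1) :
  jump C F (fun T => nt (tau T) (face_normal C F)) =
  \sum_(T in C | F \subset T) nt (tau T) (outer_normal T F).
Proof.
apply: eq_bigr => T /andP[TC FT]; rewrite outer_face_normal//.
by case: eqP => // _; rewrite ntN.
Qed.

(** [nn] is even in the normal and the normal trace is odd, so the sign of the jump moves to the
    trace; by continuity each cell may use its own trace of [v]. *)
Lemma jump_nn (tau : {set vtx} -> 'M[R]_n.+1) (v : {set vtx} -> pt) :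
  (forall T, T \in C -> F \subset T ->
     dot (v T) (face_normal C F) = dot (v (cell1 C F)) (face_normal C F)) ->
  jump C F (fun T => nn (tau T) (face_normal C F)) *
    dot (v (cell1 C F)) (face_normal C F) =
  \sum_(T in C | F \subset T) nn (tau T) (outer_normal T F) * dot (v T) (outer_normal T F).
Proof.
move=> hv; rewrite /jump mulr_suml; apply: eq_bigr => T /andP[TC FT].
rewrite outer_face_normal//; case: eqP => [->//|_].
by rewrite nnN dotNr hv// mulNr mulrN.
Qed.

End jumps.

(** A cell containing [x] contains [A] by conformity, as the coordinates on [A] are positive. Any
    other cell has a negative coordinate at [x] and avoids a neighbourhood; there are finitely many
    cells. *)
Lemma near_interior_facet T (A : {set vtx}) x : T \in cells -> A \subset T ->
  (forall V, V \in A -> 0 < hat V T x) -> (forall V, V \notin A -> hat V T x = 0) ->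
  \forall y \near x, forall T', T' \in cells -> hull T' y ->
     A \subset T' /\ forall V, V \in A -> 0 < hat V T' y.
Proof.
move=> cT AT xA x0.
have sT := cell_simplicial cT.
have hTx : hull T x.
  by apply/(hullP sT) => V; have [VA|VA] := boolP (V \in A); [exact/ltW/xA|rewrite x0].
have ch V T' : T' \in cells -> continuous (hat V T').
  by move=> c'; exact: differentiable_cont (pdeg_differentiable (pdeg_hat (cell_simplicial c') V)).
pose P (T' : {set vtx}) (y : pt) := T' \in cells -> hull T' y ->
  A \subset T' /\ forall V, V \in A -> 0 < hat V T' y.
suff H : forall T', \forall y \near x, P T' y by exact: (filter_forall _ H).
move=> T'; rewrite /P.
have [c'|c'] := boolP (T' \in cells); last by near=> y.
have s' := cell_simplicial c'.
have [hT'|hT'] := pselect (hull T' x).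
  have AT' : A \subset T'.
    apply/fintype.subsetP => V VA; apply/negPn/negP => VT'.
    have := hull_inter cT c' hTx hT'.
    move=> /(sub_hullP sT _ (finset.subsetIl _ _))[_ /(_ V)].
    rewrite inE (negbTE VT') andbF => /(_ isT) E.
    by have := xA V VA; rewrite E ltxx.
  have hpos V : V \in A -> 0 < hat V T' x.
    move=> VA.
    have -> : hat V T' x = hat V T x.
      rewrite -{1}(hat_comb sT x) (hat_unique s')//; last exact: hat_sum.
      move=> W WT'; apply: x0; apply: contra WT'; exact: (fintype.subsetP AT').
    exact: xA.
  have H : \forall y \near x, forall V, V \in A -> 0 < hat V T' y.
    suff H V : \forall y \near x, V \in A -> 0 < hat V T' y by exact: (filter_forall _ H).
    have [VA|VA] := boolP (V \in A); last by near=> y.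
    have h := cvgr_gt (hat V T' x) (ch V T' c' x) 0 (hpos V VA).
    by near=> y => _; near: y; exact: h.
  by near=> y => _ _; split=> // V VA; move: V VA; near: y; exact: H.
have [V hV] : exists V, hat V T' x < 0.
  apply: contra_notP hT' => /forallNP h; apply/(hullP s') => V.
  by rewrite leNgt; apply/negP; exact: h.
have H : \forall y \near x, hat V T' y < 0.
  have h := cvgr_lt (hat V T' x) (ch V T' c' x) 0 hV.
  exact: h.
near=> y => _ /(hullP s')/(_ V); rewrite leNgt => /negP[]; near: y; exact: H.
Unshelve. all: by end_near. Qed.

End mesh_geometry.

(** * Linearity and positivity of simplex integrals *)

Section simplex_int_theory.
Context {R : realType} {d m : nat}.
Local Notation pt := 'rV[R]_d.
Variable p : 'I_m.+1 -> pt.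
Implicit Types (g h : pt -> R).

Definition sinteg g := sintegrable (fun y => g (simplex_param p y)).

Lemma simplex_intE g : simplex_int p g =
  Num.sqrt (\det (simplex_edges p *m (simplex_edges p)^T)) *
  sint (fun y => g (simplex_param p y)).
Proof. by []. Qed.

Lemma eq_simplex_int g h :
  (forall y, @ref_simplex R m y -> g (simplex_param p y) = h (simplex_param p y)) ->
  simplex_int p g = simplex_int p h.
Proof. by move=> gh; rewrite !simplex_intE (eq_sint gh). Qed.

Lemma simplex_int0 g :
  (forall y, @ref_simplex R m y -> g (simplex_param p y) = 0) -> simplex_int p g = 0.
Proof.
move=> g0; rewrite simplex_intE (eq_sint (k := fun=> 0))//.
by rewrite sint_cst mul0r mulr0.
Qed.

Lemma sinteg_cont g : continuous g -> sinteg g.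
Proof. exact: sintegrable_cont. Qed.

Lemma sintegD g h : sinteg g -> sinteg h -> sinteg (fun x => g x + h x).
Proof. exact: sintegrableD. Qed.

Lemma sintegZ c g : sinteg g -> sinteg (fun x => c * g x).
Proof. exact: sintegrableZ. Qed.

Lemma simplex_intD g h : sinteg g -> sinteg h ->
  simplex_int p (fun x => g x + h x) = simplex_int p g + simplex_int p h.
Proof. by move=> ig ih; rewrite !simplex_intE sintD// mulrDr. Qed.

Lemma simplex_intB g h : sinteg g -> sinteg h ->
  simplex_int p (fun x => g x - h x) = simplex_int p g - simplex_int p h.
Proof. by move=> ig ih; rewrite !simplex_intE sintB// mulrBr. Qed.

Lemma simplex_intZ c g : sinteg g ->
  simplex_int p (fun x => c * g x) = c * simplex_int p g.
Proof. by move=> ig; rewrite !simplex_intE sintZ// mulrCA. Qed.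

Lemma sinteg_sum (I : Type) (s : seq I) (P : pred I) (F : I -> pt -> R) :
  (forall i, P i -> sinteg (F i)) ->
  sinteg (fun x => \sum_(i <- s | P i) F i x) /\
  simplex_int p (fun x => \sum_(i <- s | P i) F i x) =
  \sum_(i <- s | P i) simplex_int p (F i).
Proof.
move=> hF; elim: s => [|i s [IH1 IH2]].
  rewrite big_nil (_ : (fun x => _) = (fun=> 0)); last first.
    by apply/funext => x; rewrite big_nil.
  split; last exact: simplex_int0.
  exact: (sintegrable_cst m 0).
have [Pi|Pi] := boolP (P i).
  have -> : (fun x => \sum_(j <- i :: s | P j) F j x) =
      (fun x => F i x + \sum_(j <- s | P j) F j x).
    by apply/funext => x; rewrite big_cons Pi.
  by rewrite big_cons Pi -IH2 -simplex_intD; [split=> //; apply: sintegD|..]; try exact: hF.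
have -> : (fun x => \sum_(j <- i :: s | P j) F j x) =
    (fun x => \sum_(j <- s | P j) F j x).
  by apply/funext => x; rewrite big_cons (negbTE Pi).
by rewrite big_cons (negbTE Pi).
Qed.

(** Needed for the load [f], which is only square integrable: the product is dominated by g^2 +
    q^2. *)
Lemma sinteg_L2 g q : simplex_L2 p g -> continuous q -> sinteg (fun x => g x * q x).
Proof.
move=> [mg ig2] cq.
have mref := @measurable_ref_simplex R m.
have cq2 : continuous (fun x => q x * q x) by move=> x; exact: (cvgM (cq x) (cq x)).
have iq2 := sinteg_cont cq2; have iq := sinteg_cont cq.
have i2 : sintegrable (fun y => g (simplex_param p y) ^+ 2 +
    q (simplex_param p y) * q (simplex_param p y)) by exact: sintegrableD.
apply: (le_integrable mref _ _ i2).
  apply/measurable_EFinP; apply: measurable_funM; first exact: mg.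
  by apply/measurable_EFinP; exact: (measurable_int _ iq).
move=> y yr; rewrite /= lee_fin -expr2 [leRHS]ger0_norm ?addr_ge0 ?sqr_ge0//.
set a := g _; set b := q _; rewrite ler_norml; apply/andP; split.
  by have := sqr_ge0 (a + b); have := sqr_ge0 a; have := sqr_ge0 b; nra.
by have := sqr_ge0 (a - b); have := sqr_ge0 a; have := sqr_ge0 b; nra.
Qed.

Lemma simplex_int_eq0 h l : \det (simplex_edges p *m (simplex_edges p)^T) > 0 ->
  continuous h -> (forall y, @ref_simplex R m y -> 0 <= h (simplex_param p y)) ->
  simplex_int p h = 0 -> std_simplex l -> h (bary_comb p l) = 0.
Proof.
move=> dp ch h0; rewrite simplex_intE => /eqP; rewrite mulf_eq0.
rewrite gt_eqF ?sqrtr_gt0//= => /eqP hi hl.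
exact: sint_eq0.
Qed.

End simplex_int_theory.

(** * Integrals over cells and facets, Green's formula *)

Section cell_face_integrals.
Context {R : realType} {n : nat} {M : mesh R n.+1}.
Local Notation d := n.+1.
Local Notation pt := 'rV[R]_n.+1.
Local Notation vtx := (vtx M).
Local Notation pos := (@pos R n.+1 M).
Local Notation cells := (cells M).
Implicit Types (T F : {set vtx}) (V W : vtx) (x : pt) (g h : pt -> R).

Lemma labelled_hull k (A : {set vtx}) (e : 'I_k.+1 -> vtx) x : labelled A e ->
  hull A x <-> exists2 l, std_simplex l & x = bary_comb (pos \o e) l.
Proof.
move=> eA; split=> [[w [w0 wA w1 ->]]|[l [l0 l1] ->]].
  exists (w \o e); last by rewrite (sum_off eA)// => V VA; rewrite wA// scale0r.
  by split=> [i|]; [exact: w0|rewrite -w1 (sum_off eA)].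
exists (extend_by0 e l); split.
- by move=> V; rewrite /extend_by0; case: pickP.
- by move=> V; exact: extend_by0_off.
- rewrite (sum_off eA); last by move=> V; exact: extend_by0_off.
  by rewrite -l1; apply: eq_bigr => i _; rewrite (extend_by0E _ _ eA).
- rewrite (sum_off eA); last by move=> V VA; rewrite (extend_by0_off _ eA VA) scale0r.
  by apply: eq_bigr => i _; rewrite (extend_by0E _ _ eA).
Qed.

Lemma vertices_hull k (A : {set vtx}) y : #|A| = k.+1 -> @ref_simplex R k y ->
  hull A (simplex_param (@vertices R d M k A) y).
Proof.
move=> /labelled_exists[e eA] yr; rewrite (labelled_vertices eA).
apply/(labelled_hull _ eA); exists (bary_coord y); last exact: simplex_paramE.
exact: std_simplex_bary.
Qed.

Definition cinteg T g := sinteg (@vertices R d M d T) g.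
Definition finteg F g := sinteg (@vertices R d M n F) g.

Lemma eq_cell_int T g h : #|T| = d.+1 -> (forall x, hull T x -> g x = h x) ->
  cell_int T g = cell_int T h.
Proof. by move=> Td gh; apply: eq_simplex_int => y yr; apply: gh; exact: vertices_hull. Qed.

Lemma eq_face_int F g h : #|F| = d -> (forall x, hull F x -> g x = h x) ->
  face_int F g = face_int F h.
Proof. by move=> Fd gh; apply: eq_simplex_int => y yr; apply: gh; exact: vertices_hull. Qed.

Lemma cell_int0 T g : #|T| = d.+1 -> (forall x, hull T x -> g x = 0) -> cell_int T g = 0.
Proof. by move=> Td g0; apply: simplex_int0 => y yr; apply: g0; exact: vertices_hull. Qed.

Lemma face_int0 F g : #|F| = d -> (forall x, hull F x -> g x = 0) -> face_int F g = 0.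
Proof. by move=> Fd g0; apply: simplex_int0 => y yr; apply: g0; exact: vertices_hull. Qed.

Lemma cinteg_cont T g : continuous g -> cinteg T g.
Proof. exact: sinteg_cont. Qed.

Lemma finteg_cont F g : continuous g -> finteg F g.
Proof. exact: sinteg_cont. Qed.

Lemma cell_det_neq0 T (e : 'I_d.+1 -> vtx) : simplicial T -> labelled T e ->
  \det (simplex_edges (pos \o e)) != 0.
Proof.
move=> sT eT; rewrite -det_homog -unitfE -unitmxE.
exact: simplicial_homog sT eT.
Qed.

Lemma cell_int_eq0 T h : simplicial T -> continuous h ->
  (forall x, hull T x -> 0 <= h x) -> cell_int T h = 0 ->
  forall x, hull T x -> h x = 0.
Proof.
move=> sT ch h0 hi x; have [e eT] := labelled_exists sT.1.
move=> /(labelled_hull _ eT)[l hl ->].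
move: hi; rewrite /cell_int (labelled_vertices eT) => hi.
apply: (simplex_int_eq0 _ ch _ hi hl).
  rewrite det_mulmx det_tr -expr2 lt_neqAle sqr_ge0 andbT eq_sym expf_neq0//.
  exact: (cell_det_neq0 sT eT).
move=> y yr; rewrite -(labelled_vertices eT); apply: h0.
exact: vertices_hull sT.1 yr.
Qed.

(** A degenerate facet would, by [facet_measure], annihilate the gradient of the opposite hat
    function. *)
Lemma face_gram_gt0 T F : simplicial T -> F \in cell_faces T ->
  0 < \det (simplex_edges (@vertices R d M n F) *m (simplex_edges (@vertices R d M n F))^T).
Proof.
move=> sT; rewrite (cell_facesE sT) => /imsetP[V VT ->].
have [e eT] := labelled_exists sT.1.
have [i Vi] := labelledP eT VT; rewrite Vi.
rewrite (labelled_vertices (labelled_facet i eT)) -sqrtr_gt0.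
rewrite lt_neqAle sqrtr_ge0 andbT eq_sym; apply/eqP => h0.
have := facet_measure sT i eT; rewrite h0 oppr0 scale0r => /eqP.
rewrite scaler_eq0 normr_eq0 (negbTE (cell_det_neq0 sT eT)) /= => /eqP g0.
by have := ghat_neq0 sT (labelled_in eT i); rewrite g0 dot0l ltxx.
Qed.

Lemma face_int_eq0 T F h : simplicial T -> F \in cell_faces T -> continuous h ->
  (forall x, hull F x -> 0 <= h x) -> face_int F h = 0 ->
  forall x, hull F x -> h x = 0.
Proof.
move=> sT FT ch h0 hi x; have Fd : #|F| = d by have [] := (in_cell_faces T F).1 FT.
have [e eF] := labelled_exists Fd.
move=> /(labelled_hull _ eF)[l hl ->].
have gp := face_gram_gt0 sT FT.
move: hi gp; rewrite /face_int /= (labelled_vertices eF) => hi gp.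
apply: (simplex_int_eq0 gp ch _ hi hl).
move=> y yr; rewrite -(labelled_vertices eF); apply: h0.
exact: vertices_hull Fd yr.
Qed.

Lemma cell_int1_gt0 T : simplicial T -> 0 < cell_int T (fun=> 1).
Proof.
move=> sT; rewrite lt_neqAle; apply/andP; split; last first.
  apply: mulr_ge0; first exact: sqrtr_ge0.
  exact: (@refvol_ge0 R d).
apply/eqP => /esym h.
have [e eT] := labelled_exists sT.1.
have [x xT] : exists x, hull T x.
  pose l : 'I_d.+1 -> R := fun i => (i == ord0)%:R.
  exists (bary_comb (pos \o e) l); apply/(labelled_hull _ eT); exists l => //.
  split=> [i|]; first exact: ler0n.
  by rewrite (bigD1 ord0)//= big1 ?addr0// => i /negbTE h0; rewrite /l h0.
have := cell_int_eq0 sT (@cst_continuous _ _ (1 : R)) (fun _ _ => ler01) h xT.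
by move/eqP; rewrite oner_eq0.
Qed.

Lemma face_int1_ge0 F : 0 <= face_int F (fun=> 1 : R).
Proof.
apply: mulr_ge0; first exact: sqrtr_ge0.
exact: (@refvol_ge0 R n).
Qed.

Lemma grad_dot_delta g x i : dot (grad g x) (delta_mx 0 i) = partial i g x.
Proof.
rewrite /dot (bigD1 i)//= !mxE !eqxx mulr1 big1 ?addr0// => j /negbTE ji.
by rewrite !mxE ji andbF mulr0.
Qed.

(** [cell_gauss] applied to each component times [psi]. The field is polynomial, but [psi] is only
    C^1, like the bumps. *)
Lemma cell_green T k (v : pt -> pt) psi : simplicial T ->
  (forall i, pdeg k (fun x => v x 0 i)) -> C1 psi ->
  cell_int T (fun x => dot (v x) (grad psi x)) + cell_int T (fun x => divv v x * psi x) =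
  \sum_(F in cell_faces T) face_int F (fun x => dot (v x) (outer_normal T F) * psi x).
Proof.
move=> sT hv hpsi.
have dv i := pdeg_differentiable (hv i).
have cv i := differentiable_cont (dv i).
have [dp cdp] := hpsi; have cp := differentiable_cont dp.
have cdv i : continuous (partial i (fun x => v x 0 i)) by exact: (pdeg_C1 (hv i)).2.
have i1 i : cinteg T (fun x => v x 0 i * partial i psi x).
  by apply: cinteg_cont => x; exact: (cvgM (cv i x) (cdp i x)).
have i2 i : cinteg T (fun x => partial i (fun x => v x 0 i) x * psi x).
  by apply: cinteg_cont => x; exact: (cvgM (cdv i x) (cp x)).
have -> : cell_int T (fun x => dot (v x) (grad psi x)) =
    \sum_i cell_int T (fun x => v x 0 i * partial i psi x).
  rewrite /cell_int -(sinteg_sum _ (fun i _ => i1 i)).2.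
  by apply: eq_simplex_int => y _; apply: eq_bigr => i _; rewrite mxE.
have -> : cell_int T (fun x => divv v x * psi x) =
    \sum_i cell_int T (fun x => partial i (fun x => v x 0 i) x * psi x).
  rewrite /cell_int -(sinteg_sum _ (fun i _ => i2 i)).2.
  by apply: eq_simplex_int => y _; rewrite mulr_suml.
rewrite -big_split /=.
transitivity (\sum_i \sum_(F in cell_faces T)
    dot (outer_normal T F) (delta_mx 0 i) * face_int F (fun x => v x 0 i * psi x)).
  apply: eq_bigr => i _; rewrite -(cell_gauss sT (delta_mx 0 i) (C1_mul (pdeg_C1 (hv i)) hpsi)).
  rewrite addrC -simplex_intD; [|exact: i2|exact: i1].
  apply: eq_simplex_int => y _.
  by rewrite grad_dot_delta partialM.
rewrite exchange_big /=; apply: eq_bigr => F FT.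
have i3 i : finteg F (fun x => v x 0 i * psi x).
  by apply: finteg_cont => x; exact: (cvgM (cv i x) (cp x)).
have i4 i : finteg F (fun x => dot (outer_normal T F) (delta_mx 0 i) * (v x 0 i * psi x)).
  exact: (sintegZ _ (i3 i)).
rewrite (eq_bigr (fun i => face_int F (fun x =>
    dot (outer_normal T F) (delta_mx 0 i) * (v x 0 i * psi x)))); last first.
  by move=> i _; rewrite /face_int simplex_intZ//; exact: i3.
rewrite /face_int -(sinteg_sum _ (fun i _ => i4 i)).2.
apply: eq_simplex_int => y _; rewrite /dot mulr_suml; apply: eq_bigr => i _.
rewrite (bigD1 i)//= !mxE !eqxx mulr1 big1 ?addr0 => [|j /negbTE ji].
  by rewrite mulrA [outer_normal _ _ _ _ * _]mulrC.
by rewrite !mxE ji andbF mulr0.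
Qed.

End cell_face_integrals.

(** * Weakly divergence-free fields *)

Section weak_divergence.
Context {R : realType} {n : nat} {M : mesh R n.+1}.
Local Notation d := n.+1.
Local Notation pt := 'rV[R]_n.+1.
Local Notation vtx := (vtx M).
Local Notation pos := (@pos R n.+1 M).
Local Notation cells := (cells M).
Implicit Types (T F : {set vtx}) (V W : vtx) (x : pt).
Variable Omega : set pt.
Hypothesis hM : triangulation M Omega.

Lemma pdeg_divv k (v : pt -> pt) : (forall i, pdeg k (fun x => v x 0 i)) ->
  pdeg k.-1 (divv v).
Proof. by move=> hv; apply: pdeg_sum => i _; case: (pdeg_partial i (hv i)). Qed.

Lemma pdeg_dot k (v : pt -> pt) (c : pt) : (forall i, pdeg k (fun x => v x 0 i)) ->
  pdeg k (fun x => dot (v x) c).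
Proof.
move=> hv; apply: pdeg_sum => i _.
by have := pdeg_mul (hv i) (pdeg_cst 0 (c 0 i)); rewrite addn0.
Qed.

Lemma grad_mul0 (q b : pt -> R) x : differentiable q x -> differentiable b x ->
  b x = 0 -> grad b x = 0 -> grad (fun y => q y * b y) x = 0.
Proof.
move=> dq db b0 g0; apply/rowP => i; rewrite mxE partialM// b0 mulr0 add0r.
by have /rowP/(_ i) := g0; rewrite !mxE => ->; rewrite mulr0.
Qed.

(* Around a point in the relative interior of A there is a test function that
   is supported near A. *)
Lemma local_bump T (A : {set vtx}) x0 : T \in cells -> A \subset T ->
  (forall V, V \in A -> 0 < hat V T x0) -> (forall V, V \notin A -> hat V T x0 = 0) ->
  exists2 e, 0 < e & forall T' x, T' \in cells -> hull T' x ->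
    e <= dot (x - x0) (x - x0) \/
    A \subset T' /\ forall V, V \in A -> 0 < hat V T' x.
Proof.
move=> cT AT pA zA.
have /nbhs_ballP[r /= r0 hr] := near_interior_facet hM cT AT pA zA.
exists (r ^+ 2); first exact: exprn_gt0.
move=> T' x c' hx; have [h|h] := leP (r ^+ 2) (dot (x - x0) (x - x0)); first by left.
right; apply: (hr x) => //; rewrite -ball_normE /= distrC.
have := le_lt_trans (norm_le_dot _) h.
by rewrite ltr_pXn2r// ?nnegrE// ltW.
Qed.

Variables (k : nat) (v : vfield M).
Hypothesis hv : forall T, T \in cells -> forall i, pdeg k (fun x => v T x 0 i).
Hypothesis hdiv : has_div setT v (fun _ _ => 0).

Lemma weak_div0 psi : test_fun setT psi ->
  \sum_(T in cells) cell_int T (fun x => dot (v T x) (grad psi x)) = 0.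
Proof.
move=> /hdiv; rewrite /ip_v /ip_s /omega_int => h; rewrite -[RHS]h.
rewrite [X in _ = _ + X]big1 ?addr0// => T cT.
by apply: cell_int0 => [|x _]; [exact: (cell_simplicial hM cT).1|rewrite mul0r].
Qed.

(** The test function is the divergence times a bump that vanishes on the other cells and on the
    facets of [T]. Green's formula leaves the integral of the squared divergence times the bump. *)
Lemma div_zero_interior T x0 : T \in cells -> (forall V, V \in T -> 0 < hat V T x0) ->
  divv (v T) x0 = 0.
Proof.
move=> cT pT; have sT := cell_simplicial hM cT.
have zT V : V \notin T -> hat V T x0 = 0 by exact: hat_off.
have [e e0 he] := local_bump cT (fintype.subxx T) pT zT.
have hq := pdeg_divv (hv cT).
have dq := pdeg_differentiable hq; have cq := differentiable_cont dq.
have C1b := C1_bump x0 e; have cb := differentiable_cont C1b.1.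
pose psi x := divv (v T) x * bumpf x0 e x.
have C1p : C1 psi by exact: C1_mul (pdeg_C1 hq) C1b.
have h0 := weak_div0 (test_fun_bump x0 (ltW e0) hq).
rewrite (bigD1 T)//= big1 ?addr0 in h0; last first.
  move=> T' /andP[c' T'T]; apply: cell_int0; first exact: (cell_simplicial hM c').1.
  move=> x hx; rewrite grad_mul0 ?dot0r//; first exact: C1b.1.
    case: (he T' x c' hx) => [|[TT' _]]; first exact: bump0.
    case/eqP: T'T; apply/eqP; rewrite eq_sym eqEcard TT'.
    by rewrite (cell_simplicial hM c').1 sT.1 leqnn.
  case: (he T' x c' hx) => [|[TT' _]]; first exact: grad_bump0.
  case/eqP: T'T; apply/eqP; rewrite eq_sym eqEcard TT'.
  by rewrite (cell_simplicial hM c').1 sT.1 leqnn.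
have := cell_green sT (hv cT) C1p; rewrite h0 add0r big1.
  move=> hi.
  have cc : continuous (fun x => divv (v T) x * (divv (v T) x * bumpf x0 e x)).
    by move=> x; exact: (cvgM (cq x) (cvgM (cq x) (cb x))).
  have c1 : forall x, hull T x -> 0 <= divv (v T) x * (divv (v T) x * bumpf x0 e x).
    by move=> x _; rewrite mulrA -expr2 mulr_ge0 ?sqr_ge0 ?bump_ge0.
  have c2 : hull T x0.
    apply/(hullP sT) => V; have [VT|VT] := boolP (V \in T); first exact/ltW/pT.
    by rewrite zT.
  have /eqP := cell_int_eq0 sT cc c1 hi c2.
  by rewrite mulf_eq0 [_ * bumpf _ _ _ == 0]mulf_eq0 (gt_eqF (bump_gt0 x0 e0)) orbF orbb => /eqP.
move=> F FT; apply: face_int0; first by have [] := (in_cell_faces T F).1 FT.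
move=> x; have [V VT ->] := cell_face_ex hM cT FT.
move=> /(sub_hullP sT _ (subsetDl _ _))[h1 h2].
have hx : hull T x by apply/(hullP sT).
case: (he T x cT hx) => [h|[_ /(_ V VT)]]; first by rewrite /psi bump0// !mulr0.
by rewrite h2 ?ltxx// !inE eqxx.
Qed.

(** Valid for every [x], inside [T] or not: on the line through [x] and the barycenter the
    polynomial vanishes near the barycenter. *)
Lemma div_zero T x : T \in cells -> divv (v T) x = 0.
Proof.
move=> cT; have sT := cell_simplicial hM cT.
have hq := pdeg_divv (hv cT).
have T0 : (0 < #|T|)%N by rewrite sT.1.
pose x0 := barycenter T.
have p0 V : V \in T -> 0 < hat V T x0.
  by move=> VT; rewrite (hat_barycenter hM)// VT divr_gt0 ?ltr01 ?ltr0n.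
have H : \forall y \near x0, forall V, V \in T -> 0 < hat V T y.
  suff H V : \forall y \near x0, V \in T -> 0 < hat V T y by exact: (filter_forall _ H).
  have [VT|VT] := boolP (V \in T); last by near=> y.
  have ch := differentiable_cont (pdeg_differentiable (pdeg_hat sT V)).
  have h := cvgr_gt (hat V T x0) (ch x0) 0 (p0 V VT).
  by near=> y => _; near: y; exact: h.
have /nbhs_ballP[r /= r0 hr] := H.
have w1 : 0 < `|x - x0| + 1 by rewrite ltr_wpDl.
have := pdeg_line_eq0 (x := x0) (w := x - x0) (e := r / (`|x - x0| + 1)) hq.
have E1 : x0 + 1 *: (x - x0) = x by rewrite scale1r addrC subrK.
move=> /(_ (divr_gt0 r0 w1) _ 1); rewrite E1; apply.
move=> t /andP[t0 tr]; apply: div_zero_interior => //.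
apply: hr; rewrite -ball_normE /= opprD addrA subrr add0r normrN normrZ gtr0_norm//.
apply: (@le_lt_trans _ _ (t * (`|x - x0| + 1))); first by rewrite ler_pM2l// lerDl.
by rewrite -ltr_pdivlMr.
Unshelve. all: by end_near. Qed.

(** The test function is the sum itself times a bump, and Green's formula leaves the integral of a
    square over [F]. Boundary facets are covered, since test functions on [setT] need not vanish
    there. *)
Lemma sum_normal_interior T F x0 : T \in cells -> F \in cell_faces T ->
  (forall V, V \in F -> 0 < hat V T x0) -> (forall V, V \notin F -> hat V T x0 = 0) ->
  \sum_(T' in cells | F \subset T') dot (v T' x0) (outer_normal T' F) = 0.
Proof.
move=> cT FcT pF zF; have sT := cell_simplicial hM cT.
have [Fd FT] := (in_cell_faces T F).1 FcT.
have [e e0 he] := local_bump cT FT pF zF.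
pose q x := \sum_(T' in cells | F \subset T') dot (v T' x) (outer_normal T' F).
have hq : pdeg k q.
  by apply: pdeg_sum => T' /andP[c' _]; apply: pdeg_dot; exact: hv.
have dq := pdeg_differentiable hq; have cq := differentiable_cont dq.
have C1b := C1_bump x0 e; have cb := differentiable_cont C1b.1.
pose psi x := q x * bumpf x0 e x.
have C1p : C1 psi by exact: C1_mul (pdeg_C1 hq) C1b.
have cpsi := differentiable_cont C1p.1.
have h0 := weak_div0 (test_fun_bump x0 (ltW e0) hq).
have green T' : T' \in cells ->
   cell_int T' (fun x => dot (v T' x) (grad psi x)) =
   if F \subset T' then face_int F (fun x => dot (v T' x) (outer_normal T' F) * psi x)
   else 0.
  move=> c'; have s' := cell_simplicial hM c'.
  have := cell_green s' (hv c') C1p.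
  rewrite [X in _ + X]cell_int0 ?addr0; [|exact: s'.1|]; last first.
    by move=> x _; rewrite div_zero// mul0r.
  move=> ->.
  have other F' : F' \in cell_faces T' -> F' != F ->
     face_int F' (fun x => dot (v T' x) (outer_normal T' F') * psi x) = 0.
    move=> F'c F'F; have [F'd F'T'] := (in_cell_faces T' F').1 F'c.
    apply: face_int0 => // x /(sub_hullP s' _ F'T')[h1 h2].
    have hx : hull T' x by apply/(hullP s').
    case: (he T' x c' hx) => [h|[FT' hpos]]; first by rewrite /psi bump0// !mulr0.
    have /fintype.subsetPn[V VF VF'] : ~~ (F \subset F').
      apply: contra F'F => FF'; rewrite eq_sym eqEcard FF'.
      by rewrite Fd F'd leqnn.
    by have := hpos V VF; rewrite h2// ltxx.
  case: ifPn => FT'.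
    have Fc' : F \in cell_faces T' by apply/in_cell_faces.
    by rewrite (bigD1 F)//= big1 ?addr0// => F' /andP[]; exact: other.
  rewrite big1// => F' F'c; apply: other => //.
  by apply: contra FT' => /eqP <-; have [] := (in_cell_faces T' F').1 F'c.
have hi : face_int F (fun x => q x * psi x) = 0.
  rewrite -[RHS]h0 (eq_bigr _ (fun T' c' => green T' c')) -big_mkcondr.
  rewrite /face_int -(sinteg_sum _ _).2; last first.
    move=> T' /andP[c' _]; apply: sinteg_cont => x.
    have cd := differentiable_cont (pdeg_differentiable (pdeg_dot (outer_normal T' F) (hv c'))).
    exact: (cvgM (cd x) (cpsi x)).
  by apply: eq_simplex_int => y _; rewrite /q mulr_suml.
have cc : continuous (fun x => q x * psi x) by move=> x; exact: (cvgM (cq x) (cpsi x)).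
have c1 x : hull F x -> 0 <= q x * psi x.
  by move=> _; rewrite /psi mulrA -expr2 mulr_ge0 ?sqr_ge0 ?bump_ge0.
have c2 : hull F x0.
  apply/(sub_hullP sT _ FT); split=> // V.
  by have [VF|VF] := boolP (V \in F); [exact/ltW/pF|rewrite zF].
have /eqP := face_int_eq0 sT FcT cc c1 hi c2.
by rewrite /psi mulf_eq0 [_ * bumpf _ _ _ == 0]mulf_eq0 (gt_eqF (bump_gt0 x0 e0)) orbF orbb => /eqP.
Qed.

Lemma sum_normal T F x : T \in cells -> F \in cell_faces T -> hull F x ->
  \sum_(T' in cells | F \subset T') dot (v T' x) (outer_normal T' F) = 0.
Proof.
move=> cT FcT hx; have sT := cell_simplicial hM cT.
have [Fd FT] := (in_cell_faces T F).1 FcT.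
pose q x := \sum_(T' in cells | F \subset T') dot (v T' x) (outer_normal T' F).
have hq : pdeg k q.
  by apply: pdeg_sum => T' /andP[c' _]; apply: pdeg_dot; exact: hv.
pose x0 := barycenter F.
have F0 : (0 < #|F|)%N by rewrite Fd.
have E0 V : hat V T x0 = (V \in F)%:R / d%:R by rewrite (hat_barycenter hM)// Fd.
have [h1 h2] := (sub_hullP sT x FT).1 hx.
have := pdeg_line_eq0 (x := x0) (w := x - x0) (e := 1) hq ltr01.
have E1 : x0 + 1 *: (x - x0) = x by rewrite scale1r addrC subrK.
move=> /(_ _ 1); rewrite E1; apply.
move=> t /andP[t0 t1]; apply: sum_normal_interior cT FcT _ _ => V VF.
  rewrite hat_affine// E0 VF mul1r.
  rewrite (_ : _ + _ = (1 - t) * d%:R^-1 + t * hat V T x); last by ring.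
  rewrite ltr_pwDl//; first by rewrite mulr_gt0 ?subr_gt0 ?invr_gt0 ?ltr0n.
  by rewrite mulr_ge0 ?(ltW t0).
by rewrite hat_affine// E0 (negbTE VF) mul0r h2// subrr mulr0 addr0.
Qed.

Lemma normal_continuous T1 T2 F x : T1 \in cells -> T2 \in cells ->
  F \in cell_faces T1 -> F \in cell_faces T2 -> hull F x ->
  dot (v T1 x) (outer_normal T1 F) = dot (v T2 x) (outer_normal T1 F).
Proof.
move=> c1 c2 F1 F2 hx; have [->//|T12] := eqVneq T1 T2.
have [FT1 FT2] := (((in_cell_faces T1 F).1 F1).2, ((in_cell_faces T2 F).1 F2).2).
have := sum_normal c1 F1 hx.
rewrite (bigD1 T1) ?c1 ?FT1//= (bigD1 T2) ?c2 ?FT2 1?eq_sym//= big1 ?addr0.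
  by rewrite (outer_opposite hM c1 c2 T12 F1 F2) dotNr => /eqP; rewrite subr_eq0 => /eqP.
move=> T3 /andP[/andP[/andP[c3 FT3] T31] T32]; exfalso; case/eqP: T32.
have F3 : F \in cell_faces T3 by apply/in_cell_faces; split=> //; exact: ((in_cell_faces T1 F).1 F1).1.
by apply/esym; apply: (facet_at_most_two hM c1 c2 c3 F1 F2 F3 T12); rewrite eq_sym.
Qed.

Lemma normal_zero T F x : T \in cells -> F \in cell_faces T ->
  (forall T', T' \in cells -> F \subset T' -> T' = T) -> hull F x ->
  dot (v T x) (outer_normal T F) = 0.
Proof.
move=> cT FcT huniq hx; have FT := ((in_cell_faces T F).1 FcT).2.
have := sum_normal cT FcT hx; rewrite (bigD1 T) ?cT ?FT//= big1 ?addr0//.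
by move=> T' /andP[/andP[c' F'] /eqP[]]; exact: huniq.
Qed.

End weak_divergence.

(** * Boundary facets and boundary vertices *)

Section boundary.
Context {R : realType} {n : nat} {M : mesh R n.+1}.
Local Notation d := n.+1.
Local Notation pt := 'rV[R]_n.+1.
Local Notation vtx := (vtx M).
Local Notation pos := (@pos R n.+1 M).
Local Notation cells := (cells M).
Implicit Types (T F : {set vtx}) (V W : vtx) (x : pt).
Variable Omega : set pt.
Hypothesis hM : triangulation M Omega.
Hypothesis hOmega : domain Omega.

Lemma hull_closure T x : T \in cells -> hull T x -> closure Omega x.
Proof. by case: hM => _ _ _ _ -> cT hx; exists T. Qed.

Lemma closure_hull x : closure Omega x -> exists2 T, T \in cells & hull T x.
Proof. by case: hM => _ _ _ _ -> [T cT hx]; exists T. Qed.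

Lemma barycenter_hull T F : T \in cells -> F \in cell_faces T -> hull F (barycenter F).
Proof.
move=> cT FcT; have [Fd FT] := (in_cell_faces T F).1 FcT.
have F0 : (0 < #|F|)%N by rewrite Fd.
apply/(sub_hullP (cell_simplicial hM cT) _ FT); split=> V.
  by rewrite (hat_barycenter hM)// divr_ge0.
by move=> /negbTE VF; rewrite (hat_barycenter hM)// VF mul0r.
Qed.

Lemma outer_ghat T V : T \in cells -> V \in T ->
  exists2 a, a < 0 & outer_normal T (T :\ V) = a *: ghat T V.
Proof.
move=> cT VT; have sT := cell_simplicial hM cT.
rewrite outer_normalE// /unit_normal; eexists; last reflexivity.
by rewrite oppr_lt0 invr_gt0; exact: sqrt_ghat_gt0.
Qed.

Lemma near_hat_gt0 T V x : T \in cells -> 0 < hat V T x ->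
  \forall y \near x, 0 < hat V T y.
Proof.
move=> cT hx; have sT := cell_simplicial hM cT.
have ch := differentiable_cont (pdeg_differentiable (pdeg_hat sT V)).
exact: cvgr_gt (hat V T x) (ch x) 0 hx.
Qed.

(* Two cells sharing F cover a neighbourhood of the barycenter of F, so that it
   is an interior point of the closure of the domain. *)
Lemma bd_face_single T T' F : T \in cells -> T' \in cells -> F \in cell_faces T ->
  F \in cell_faces T' -> on_bd Omega F -> T' = T.
Proof.
move=> cT cT' FT FT' /asboolP bF; apply/eqP/negPn/negP; rewrite eq_sym => TT'.
have sT := cell_simplicial hM cT; have sT' := cell_simplicial hM cT'.
pose x0 := barycenter F.
have [clx nO] := bF _ (barycenter_hull cT FT).
apply: nO; have [_ _ _ _ <-] := hOmega; rewrite /interior /=.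
have [Fd sFT] := (in_cell_faces T F).1 FT; have [_ sFT'] := (in_cell_faces T' F).1 FT'.
have F0 : (0 < #|F|)%N by rewrite Fd.
have [A AT FA] := cell_face_ex hM cT FT; have [B BT' FB] := cell_face_ex hM cT' FT'.
have hpos T1 V : T1 \in cells -> F \subset T1 -> V \in F -> 0 < hat V T1 x0.
  by move=> c1 F1 VF; rewrite (hat_barycenter hM)// VF divr_gt0// ltr0n.
have near1 T1 : T1 \in cells -> F \subset T1 ->
    \forall y \near x0, forall V, V \in F -> 0 < hat V T1 y.
  move=> c1 F1.
  suff H V : \forall y \near x0, V \in F -> 0 < hat V T1 y by exact: (filter_forall _ H).
  have [VF|VF] := boolP (V \in F); last by near=> y.
  have h := near_hat_gt0 c1 (hpos T1 V c1 F1 VF).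
  by near=> y => _; near: y; exact: h.
have N1 := near1 T cT sFT; have N2 := near1 T' cT' sFT'.
have zero T1 V : T1 \in cells -> F \subset T1 -> V \notin F -> hat V T1 x0 = 0.
  by move=> c1 F1 /negbTE VF; rewrite (hat_barycenter hM)// VF mul0r.
have AF : A \notin F by rewrite FA setD11.
have BF : B \notin F by rewrite FB setD11.
have inhull T1 C y : T1 \in cells -> F = T1 :\ C ->
    (forall V, V \in F -> 0 < hat V T1 y) -> 0 <= hat C T1 y -> hull T1 y.
  move=> c1 FC hF hC; have s1 := cell_simplicial hM c1; apply/(hullP s1) => V.
  have [VF|VF] := boolP (V \in F); first exact/ltW/hF.
  have [->//|VC] := eqVneq V C.
  by rewrite hat_off//; move: VF; rewrite FC !inE VC.
have hopp := outer_opposite hM cT cT' TT' FT FT'.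
have [a a0 na] := outer_ghat cT AT; have [b b0 nb] := outer_ghat cT' BT'.
near=> y.
have h1 : forall V, V \in F -> 0 < hat V T y by near: y; exact: N1.
have h2 : forall V, V \in F -> 0 < hat V T' y by near: y; exact: N2.
have [hA|hA] := leP 0 (hat A T y).
  by apply: (hull_closure cT); exact: (inhull T A).
apply: (hull_closure cT'); apply: (inhull T' B) => //.
have : dot (outer_normal T F) (y - x0) > 0.
  rewrite FA na dotZl -hat_diff// (zero T A)// subr0.
  by rewrite nmulr_rgt0.
rewrite -oppr_lt0 -dotNl -hopp FB nb dotZl -hat_diff// (zero T' B)// subr0.
by rewrite nmulr_rlt0// => /ltW.
Unshelve. all: by end_near. Qed.

(** If [V] were in [Omega], so would be a relative interior point of [F] near [V]. A short step from
    there along the outward normal stays in [Omega], hence in a cell; that cell contains [F] and so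
    is [T], which lies on the other side. *)
Lemma single_face_bd T F V : T \in cells -> F \in cell_faces T -> V \in F ->
  (forall T', T' \in cells -> F \in cell_faces T' -> T' = T) -> bd_vertex Omega V.
Proof.
move=> cT FT VF huniq; have sT := cell_simplicial hM cT.
have [Fd sFT] := (in_cell_faces T F).1 FT.
have F0 : (0 < #|F|)%N by rewrite Fd.
have VT : V \in T by exact: (fintype.subsetP sFT).
have posT : hull T (pos V) by apply/(hullP sT) => W; rewrite hat_vertex.
apply/asboolP; split; first exact: (hull_closure cT posT).
move=> OV; have [_ oO _ _ _] := hOmega.
pose x0 := barycenter F.
have /nbhs_ballP[r /= r0 hr] := oO _ OV.
have w1 : 0 < `|x0 - pos V| + 1 by rewrite ltr_wpDl.
(* The first bound keeps the weight 1 - t positive, the second keeps [x] in the ball around [pos V]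
   contained in [Omega]. *)
pose t := Num.min (1 / 2) (r / 2 / (`|x0 - pos V| + 1)).
have t0 : 0 < t by rewrite lt_min !divr_gt0.
have t1 : t < 1 by rewrite gt_min; apply/orP; left; lra.
have tr : t * `|x0 - pos V| < r.
  have h1 : t <= r / 2 / (`|x0 - pos V| + 1) by rewrite ge_min lexx orbT.
  apply: (@le_lt_trans _ _ (r / 2 / (`|x0 - pos V| + 1) * (`|x0 - pos V| + 1))).
    by apply: ler_pM => //; [exact: ltW|rewrite lerDl].
  by rewrite divfK ?gt_eqF//; lra.
pose x := pos V + t *: (x0 - pos V).
have Ox : Omega x.
  apply: hr; rewrite -ball_normE /= opprD addrA subrr add0r normrN normrZ.
  by rewrite gtr0_norm.
have hx W : hat W T x = (1 - t) * (W == V)%:R + t * ((W \in F)%:R / d%:R).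
  rewrite hat_affine// hat_vertex// (hat_barycenter hM)// Fd eq_sym.
  by ring.
have xF W : W \in F -> 0 < hat W T x.
  move=> WF; rewrite hx WF ltr_wpDl// ?mulr_ge0 ?subr_ge0 ?(ltW t1)//.
  by rewrite mulr_gt0// divr_gt0// ltr0n.
have x0F W : W \notin F -> hat W T x = 0.
  move=> WF; rewrite hx (negbTE WF) mul0r mulr0 addr0.
  by case: eqP => [WV|]; rewrite ?mulr0// WV VF in WF *.
have [A AT FA] := cell_face_ex hM cT FT.
have AF : A \notin F by rewrite FA setD11.
have /nbhs_ballP[e /= e0 he] := near_interior_facet hM cT sFT xF x0F.
have /nbhs_ballP[e' /= e'0 he'] := oO _ Ox.
pose nrm := outer_normal T F.
have g1 : 0 < `|nrm| + 1 by rewrite ltr_wpDl.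
pose s := Num.min (e / 2) (e' / 2) / (`|nrm| + 1).
have m0 : 0 < Num.min (e / 2) (e' / 2) by rewrite lt_min !divr_gt0.
have s0 : 0 < s by rewrite divr_gt0.
have sn : s * `|nrm| <= Num.min (e / 2) (e' / 2).
  by rewrite /s mulrAC ler_pdivrMr// ler_pM2l// lerDl.
pose y := x + s *: nrm.
have dist : `|x - y| <= Num.min (e / 2) (e' / 2).
  by rewrite /y opprD addrA subrr add0r normrN normrZ gtr0_norm.
have ye : ball x e y.
  rewrite -ball_normE /=; apply: (le_lt_trans dist).
  by rewrite gt_min; apply/orP; left; lra.
have ye' : ball x e' y.
  rewrite -ball_normE /=; apply: (le_lt_trans dist).
  by rewrite gt_min; apply/orP; right; lra.
have [T' cT' hy] := closure_hull (subset_closure (he' _ ye')).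
have [FT' _] := he _ ye T' cT' hy.
have TT' : T' = T by apply: huniq => //; apply/in_cell_faces.
rewrite {}TT' in hy.
have [a a0 na] := outer_ghat cT AT.
have := (hullP sT y).1 hy A.
rewrite -(subrK (hat A T x) (hat A T y)) hat_diff// (x0F A)// addr0.
rewrite /y addrAC subrr add0r /nrm FA na scalerA dotZr pmulr_lge0 ?ghat_neq0//.
by rewrite leNgt pmulr_rlt0// a0.
Qed.

Lemma exchange_cells_faces (C : {set {set vtx}}) (U : zmodType)
    (Phi : {set vtx} -> {set vtx} -> U) :
  \sum_(T in C) \sum_(F in cell_faces T) Phi T F =
  \sum_(F in faces_of C) \sum_(T in C | F \subset T) Phi T F.
Proof.
rewrite (exchange_big_dep (mem (faces_of C))) /=; last first.
  move=> T F TC /in_cell_faces[Fd FT]; apply/in_faces_of; split=> //.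
  by exists T.
apply: eq_bigr => F /in_faces_of[Fd _]; apply: eq_bigl => T.
apply: andb_id2l => TC; apply/idP/idP => [/in_cell_faces[]//|FT].
exact/in_cell_faces.
Qed.

Lemma hat_facet_eq T1 T2 F V x : T1 \in cells -> T2 \in cells ->
  F \subset T1 -> F \subset T2 -> hull F x -> hat V T1 x = hat V T2 x.
Proof.
move=> c1 c2 F1 F2 hx; have [s1 s2] := (cell_simplicial hM c1, cell_simplicial hM c2).
have [_ z1] := (sub_hullP s1 x F1).1 hx.
rewrite -{2}(hat_comb s1 x) (hat_unique s2)//; last exact: hat_sum.
move=> W WT2; apply: z1; apply: contra WT2; exact: (fintype.subsetP F2).
Qed.

Lemma L2_s_cont (q : sfield M) : (forall T, T \in cells -> continuous (q T)) -> L2_s q.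
Proof.
move=> cq T cT; split.
  by apply/measurable_EFinP; have /measurable_int := sinteg_cont (@vertices R d M d T) (cq T cT).
have := sinteg_cont (g := fun x => q T x ^+ 2) (@vertices R d M d T) _.
by apply=> x; rewrite /GRing.exp; exact: (cvgM (cq T cT x) (cq T cT x)).
Qed.

(** After Gauss's theorem on each cell, the facet terms of two neighbours cancel, and a facet with a
    single cell does not contain [V], so that the hat function vanishes on it. *)
Lemma hat_H10 V (a : R) : ~~ bd_vertex Omega V ->
  H10_s (fun T x => a * hat V T x : R) .
Proof.
move=> Vint.
have ch T : T \in cells -> continuous (hat V T).
  by move=> cT; exact: differentiable_cont (pdeg_differentiable (pdeg_hat (cell_simplicial hM cT) V)).
split.
  by apply: L2_s_cont => T cT x; exact: (cvgM (cvg_cst a) (ch T cT x)).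
exists (fun T x => a *: ghat T V); split.
  move=> i; apply: L2_s_cont => T cT; exact: cst_continuous.
move=> psi [C1p _] j; have [dp cdp] := C1p; have cp := differentiable_cont dp.
rewrite /ip_s /omega_int -big_split /=.
transitivity (\sum_(T in cells) \sum_(F in cell_faces T)
   a * (outer_normal T F 0 j * face_int F (fun x => hat V T x * psi x))).
  apply: eq_bigr => T cT; have sT := cell_simplicial hM cT.
  have dh := pdeg_differentiable (pdeg_hat sT V).
  have C1h := pdeg_C1 (pdeg_hat sT V).
  have i1 : cinteg T (fun x => hat V T x * partial j psi x).
    by apply: cinteg_cont => x; exact: (cvgM (ch T cT x) (cdp j x)).
  have i2 : cinteg T (fun x => ghat T V 0 j * psi x).
    by apply: cinteg_cont => x; exact: (cvgM (cvg_cst (ghat T V 0 j)) (cp x)).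
  rewrite -mulr_sumr.
  have -> : \sum_(F in cell_faces T) outer_normal T F 0 j *
       face_int F (fun x => hat V T x * psi x) =
     \sum_(F in cell_faces T) dot (outer_normal T F) (delta_mx 0 j) *
       face_int F (fun x => hat V T x * psi x).
    apply: eq_bigr => F _; congr (_ * _).
    rewrite /dot (bigD1 j)//= !mxE !eqxx mulr1 big1 ?addr0// => l /negbTE lj.
    by rewrite !mxE lj andbF mulr0.
  rewrite -(cell_gauss sT (delta_mx 0 j) (C1_mul C1h C1p)).
  have -> : cell_int T (fun x => dot (grad (fun x => hat V T x * psi x) x) (delta_mx 0 j)) =
      cell_int T (fun x => hat V T x * partial j psi x) +
      cell_int T (fun x => ghat T V 0 j * psi x).
    rewrite -simplex_intD; [|exact: i1|exact: i2]; apply: eq_simplex_int => y _.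
    rewrite grad_dot_delta partialM// addrC; congr (_ + _ * _).
    by rewrite -(grad_hat sT V (simplex_param (@vertices R d M d T) y)) mxE.
  rewrite mulrDr /cell_int -!simplex_intZ; [|exact: i2|exact: i1].
  by congr (_ + _); apply: eq_simplex_int => y _; rewrite ?mxE mulrA.
rewrite exchange_cells_faces big1// => F /in_faces_of[Fd [T cT FT]].
have FcT : F \in cell_faces T by apply/in_cell_faces.
have [[T' [cT' FT' TT']]|nT'] := pselect (exists T', [/\ T' \in cells, F \in cell_faces T' & T != T']).
  have sFT' := ((in_cell_faces T' F).1 FT').2.
  rewrite (bigD1 T) ?cT//= (bigD1 T') ?cT' ?sFT' 1?eq_sym//= big1 ?addr0; last first.
    move=> T3 /andP[/andP[/andP[c3 F3] T31] T32]; exfalso; case/eqP: T32.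
    have F3' : F \in cell_faces T3 by apply/in_cell_faces.
    by apply/esym; apply: (facet_at_most_two hM cT cT' c3 FcT FT' F3' TT'); rewrite eq_sym.
  rewrite (outer_opposite hM cT cT' TT' FcT FT') mxE.
  rewrite (@eq_face_int _ _ _ F (fun x => hat V T' x * psi x) (fun x => hat V T x * psi x))//.
    by rewrite mulNr mulrN subrr.
  by move=> x hx; rewrite (hat_facet_eq V cT' cT sFT' FT hx).
have huniq T' : T' \in cells -> F \in cell_faces T' -> T' = T.
  move=> c' F'; apply/eqP/negPn/negP => TT'; apply: nT'; exists T'; split=> //.
  by rewrite eq_sym.
have VF : V \notin F.
  by apply: contra Vint => VF; exact: single_face_bd cT FcT VF huniq.
rewrite big1// => T' /andP[c' F']; rewrite face_int0 ?mulr0// => x hx.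
by have [_ ->] := (sub_hullP (cell_simplicial hM c') x F').1 hx; rewrite ?mul0r.
Qed.

End boundary.

(** * The bubble projector *)

Section bubbles.
Context {R : realType} {n : nat} {M : mesh R n.+1}.
Local Notation d := n.+1.
Local Notation pt := 'rV[R]_n.+1.
Local Notation vtx := (vtx M).
Local Notation cells := (cells M).
Implicit Types (T F : {set vtx}) (V W : vtx) (x : pt) (g h : pt -> R).
Variable k : nat.
Hypothesis k0 : (0 < k)%N.

Section one_cell.
Variable T : {set vtx}.
Hypothesis sT : simplicial T.
Local Notation lag := (@Defs.lagrange R n.+1 M k T).

Lemma pdeg_lag g : pdeg k (lag g).
Proof. by apply/pdegP; have [] := lagrange_spec sT g k0. Qed.

Lemma lag_unique g q : pdeg k q -> (forall z, Defs.lattice k T z -> q z = g z) ->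
  forall x, lag g x = q x.
Proof.
move=> hq qg x; apply/eqP; rewrite -subr_eq0; apply/eqP.
apply: (lattice_unique sT k0 (q := fun x => lag g x - q x)).
  by apply/pdegP; apply: pdeg_sub => //; exact: pdeg_lag.
by move=> z hz; have [_ ->//] := lagrange_spec sT g k0; rewrite qg// subrr.
Qed.

Lemma lag_id g : pdeg k g -> forall x, lag g x = g x.
Proof. by move=> hg; exact: lag_unique. Qed.

Lemma lagB g h x : lag (fun x => g x - h x) x = lag g x - lag h x.
Proof.
apply: (lag_unique (q := fun x => lag g x - lag h x)).
  by apply: pdeg_sub; exact: pdeg_lag.
move=> z hz; have [_ ->//] := lagrange_spec sT g k0.
by have [_ ->//] := lagrange_spec sT h k0.
Qed.

Lemma lag_sum (I : finType) (P : pred I) (G : I -> pt -> R) x :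
  lag (fun x => \sum_(i | P i) G i x) x = \sum_(i | P i) lag (G i) x.
Proof.
apply: (lag_unique (q := fun x => \sum_(i | P i) lag (G i) x)).
  by apply: pdeg_sum => i _; exact: pdeg_lag.
move=> z hz; apply: eq_bigr => i _.
by have [_ ->//] := lagrange_spec sT (G i) k0.
Qed.

Lemma lag_ext g h x : (forall x, g x = h x) -> lag g x = lag h x.
Proof. by move=> gh; congr (lag _ x); exact/funext. Qed.

Lemma pdeg_bubble V (v : vfield M) i : pdeg k (fun x => bubble k V v T x 0 i).
Proof.
have -> : (fun x => bubble k V v T x 0 i) = lag (fun y => hat V T y * v T y 0 i).
  by apply/funext => x; rewrite mxE.
exact: pdeg_lag.
Qed.

Lemma bubbleB V (v w : vfield M) x :
  bubble k V (fun T x => v T x - w T x) T x = bubble k V v T x - bubble k V w T x.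
Proof.
apply/rowP => i; rewrite !mxE -lagB; apply: lag_ext => y.
by rewrite !mxE mulrBr.
Qed.

(** The product is in P_1, hence in P_k as k is positive, and is not altered by interpolation. This
    is how a constant in the local residual becomes a test function of the primal method. *)
Lemma bubble_cst V (c x : pt) : bubble k V (fun _ _ => c) T x = hat V T x *: c.
Proof.
apply/rowP => i; rewrite !mxE lag_id//.
by have := pdeg_mul (pdeg_leq k0 (pdeg_hat sT V)) (pdeg_cst 0 (c 0 i)); rewrite addn0.
Qed.

Lemma bubble_zero V x : bubble k V (fun _ _ => 0) T x = 0.
Proof. by rewrite bubble_cst scaler0. Qed.

Lemma bubble_sum (v : vfield M) x : (forall i, pdeg k (fun x => v T x 0 i)) ->
  \sum_(V in T) bubble k V v T x = v T x.
Proof.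
move=> hv; apply/rowP => i; rewrite summxE.
under eq_bigr do rewrite mxE.
rewrite -lag_sum -[RHS](lag_id (hv i)); apply: lag_ext => y.
rewrite -mulr_suml -[RHS]mul1r; congr (_ * _).
rewrite -[RHS](hat_sum sT y) [RHS](bigID (mem T)) /= [X in _ = _ + X]big1 ?addr0//.
by move=> V VT; exact: hat_off.
Qed.

End one_cell.
End bubbles.

(** * Polynomial fields and linearity of cell and facet integrals *)

Section cell_functionals.
Context {R : realType} {n : nat} {M : mesh R n.+1}.
Local Notation d := n.+1.
Local Notation pt := 'rV[R]_n.+1.
Local Notation vtx := (vtx M).
Local Notation cells := (cells M).
Implicit Types (T F : {set vtx}) (V W : vtx) (x : pt) (g h : pt -> R).

(** The degree is forgotten wherever only smoothness and integrability matter. *)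
Definition spoly (g : pt -> R) := exists k, pdeg k g.
Definition vpoly (v : pt -> pt) := forall i, spoly (fun x => v x 0 i).
Definition mpoly (tau : pt -> 'M[R]_d) := forall i j, spoly (fun x => tau x i j).

Lemma spoly_cst c : spoly (fun=> c).
Proof. by exists 0%N; exact: pdeg_cst. Qed.

Lemma spolyD g h : spoly g -> spoly h -> spoly (fun x => g x + h x).
Proof.
move=> [k hg] [l hh]; exists (maxn k l); apply: pdeg_add.
  exact: pdeg_leq (leq_maxl _ _) hg.
exact: pdeg_leq (leq_maxr _ _) hh.
Qed.

Lemma spolyM g h : spoly g -> spoly h -> spoly (fun x => g x * h x).
Proof. by move=> [k hg] [l hh]; exists (k + l)%N; exact: pdeg_mul. Qed.

Lemma spolyZ c g : spoly g -> spoly (fun x => c * g x).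
Proof. exact: spolyM (spoly_cst c). Qed.

Lemma spolyB g h : spoly g -> spoly h -> spoly (fun x => g x - h x).
Proof. by move=> hg [k hh]; apply: spolyD hg _; exists k; exact: pdeg_opp. Qed.

Lemma spoly_sum (I : Type) (s : seq I) (P : pred I) (G : I -> pt -> R) :
  (forall i, P i -> spoly (G i)) -> spoly (fun x => \sum_(i <- s | P i) G i x).
Proof.
move=> hG; elim: s => [|i s IH].
  have -> : (fun x => \sum_(i <- [::] | P i) G i x) = fun=> 0.
    by apply/funext => x; rewrite big_nil.
  exact: spoly_cst.
have -> : (fun x => \sum_(j <- i :: s | P j) G j x) =
   (fun x => (if P i then G i x else 0) + \sum_(j <- s | P j) G j x).
  by apply/funext => x; rewrite big_cons; case: ifP; rewrite ?add0r.
apply: spolyD IH; case Pi: (P i); first exact: hG.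
exact: spoly_cst.
Qed.

Lemma spoly_partial g i : spoly g -> spoly (partial i g).
Proof. by move=> [k hg]; exists k.-1; case: (pdeg_partial i hg). Qed.

Lemma spoly_C1 g : spoly g -> C1 g.
Proof. by move=> [k hg]; exact: pdeg_C1 hg. Qed.

Lemma spoly_diff g x : spoly g -> differentiable g x.
Proof. by move=> /spoly_C1[]. Qed.

Lemma spoly_cont g : spoly g -> continuous g.
Proof. by move=> /spoly_C1[/differentiable_cont]. Qed.

Lemma spoly_dot (v w : pt -> pt) : vpoly v -> vpoly w -> spoly (fun x => dot (v x) (w x)).
Proof. by move=> hv hw; apply: spoly_sum => i _; exact: spolyM. Qed.

Lemma vpoly_cst c : vpoly (fun=> c).
Proof. by move=> i; exact: spoly_cst. Qed.

Lemma spoly_dotr (v : pt -> pt) c : vpoly v -> spoly (fun x => dot (v x) c).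
Proof. by move=> hv; exact: spoly_dot hv (vpoly_cst c). Qed.

Lemma vpolyZ g v : spoly g -> vpoly v -> vpoly (fun x => g x *: v x).
Proof.
move=> hg hv i; have -> : (fun x => (g x *: v x) 0 i) = fun x => g x * v x 0 i.
  by apply/funext => x; rewrite mxE.
exact: spolyM.
Qed.

Lemma vpolyB v w : vpoly v -> vpoly w -> vpoly (fun x => v x - w x).
Proof.
move=> hv hw i; have -> : (fun x => (v x - w x) 0 i) = fun x => v x 0 i - w x 0 i.
  by apply/funext => x; rewrite !mxE.
exact: spolyB.
Qed.

Lemma vpoly_grad g : spoly g -> vpoly (grad g).
Proof.
move=> hg i; have -> : (fun x => grad g x 0 i) = partial i g.
  by apply/funext => x; rewrite mxE.
exact: spoly_partial.
Qed.

Lemma spoly_divv v : vpoly v -> spoly (divv v).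
Proof. by move=> hv; apply: spoly_sum => i _; exact: spoly_partial. Qed.

Lemma vpoly_lapv v : vpoly v -> vpoly (lapv v).
Proof.
move=> hv i.
have -> : (fun x => lapv v x 0 i) =
    (fun x => \sum_j partial j (partial j (fun y => v y 0 i)) x).
  by apply/funext => x; rewrite mxE.
by apply: spoly_sum => j _; do 2!apply: spoly_partial.
Qed.

Lemma vpoly_divm tau : mpoly tau -> vpoly (divm tau).
Proof.
move=> ht i.
have -> : (fun x => divm tau x 0 i) = (fun x => \sum_j partial j (fun y => tau y i j) x).
  by apply/funext => x; rewrite mxE.
by apply: spoly_sum => j _; exact: spoly_partial.
Qed.

Lemma mpoly_gradv v : vpoly v -> mpoly (gradv v).
Proof.
move=> hv i j.
have -> : (fun x => gradv v x i j) = partial j (fun y => v y 0 i).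
  by apply/funext => x; rewrite mxE.
exact: spoly_partial.
Qed.

Lemma mpolyZ c tau : mpoly tau -> mpoly (fun x => c *: tau x).
Proof.
move=> ht i j; have -> : (fun x => (c *: tau x) i j) = (fun x => c * tau x i j).
  by apply/funext => x; rewrite mxE.
exact: spolyZ.
Qed.

Lemma mpolyB s t : mpoly s -> mpoly t -> mpoly (fun x => s x - t x).
Proof.
move=> hs ht i j; have -> : (fun x => (s x - t x) i j) = (fun x => s x i j - t x i j).
  by apply/funext => x; rewrite !mxE.
exact: spolyB.
Qed.

Lemma mpoly_sum (I : Type) (s : seq I) (P : pred I) (G : I -> pt -> 'M[R]_d) :
  (forall i, P i -> mpoly (G i)) -> mpoly (fun x => \sum_(i <- s | P i) G i x).
Proof.
move=> hG i j.
have -> : (fun x => (\sum_(l <- s | P l) G l x) i j) =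
    (fun x => \sum_(l <- s | P l) G l x i j).
  by apply/funext => x; rewrite summxE.
by apply: spoly_sum => l Pl; exact: hG.
Qed.

Lemma mpoly_scalar g : spoly g -> mpoly (fun x => (g x)%:M).
Proof.
move=> hg i j; have -> : (fun x => (g x)%:M i j) = (fun x => (i == j)%:R * g x).
  by apply/funext => x; rewrite mxE; case: eqP; rewrite ?mul1r ?mul0r.
exact: spolyZ.
Qed.

Lemma mpoly_mulmx tau (c : pt) : mpoly tau -> vpoly (fun x => c *m (tau x)^T).
Proof.
move=> ht i.
have -> : (fun x => (c *m (tau x)^T) 0 i) = (fun x => \sum_j c 0 j * tau x i j).
  by apply/funext => x; rewrite mxE; apply: eq_bigr => j _; rewrite mxE.
by apply: spoly_sum => j _; exact: spolyZ.
Qed.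

Lemma spoly_nn tau c : mpoly tau -> spoly (fun x => nn (tau x) c).
Proof. by move=> ht; apply: spoly_dot (vpoly_cst c) _; exact: mpoly_mulmx. Qed.

Lemma vpoly_nt tau c : mpoly tau -> vpoly (fun x => nt (tau x) c).
Proof.
move=> ht; apply: vpolyB; first exact: mpoly_mulmx.
apply: vpolyZ; last exact: vpoly_cst.
exact: spoly_dotr (mpoly_mulmx c ht).
Qed.

Lemma polyv_vpoly k v : polyv_le k v -> vpoly v.
Proof. by move=> hv i; exists k; exact/pdegP. Qed.

Lemma polym_mpoly k tau : polym_le k tau -> mpoly tau.
Proof. by move=> ht i j; exists k; exact/pdegP. Qed.

Lemma RT_vpoly k v : RT_poly k v -> vpoly v.
Proof.
move=> [a [b [ha hb hv]]] i.
have -> : (fun x => v x 0 i) = (fun x => a x 0 i + b x * x 0 i).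
  by apply/funext => x; rewrite hv !mxE.
apply: spolyD; first by exists k; exact/pdegP.
by apply: spolyM; [exists k; exact/pdegP|exists 1%N; exact: pdeg_coord].
Qed.

Lemma vpoly_uniform v : vpoly v -> exists k, forall i, pdeg k (fun x => v x 0 i).
Proof.
move=> /choice[k hk]; exists (\max_i k i) => i.
exact: pdeg_leq (leq_bigmax i) (hk i).
Qed.

Lemma cinteg_spoly T g : spoly g -> cinteg T g.
Proof. by move=> hg; apply: cinteg_cont; exact: spoly_cont. Qed.

Lemma finteg_spoly F g : spoly g -> finteg F g.
Proof. by move=> hg; apply: finteg_cont; exact: spoly_cont. Qed.

Lemma cell_intD T g h : cinteg T g -> cinteg T h ->
  cell_int T (fun x => g x + h x) = cell_int T g + cell_int T h.
Proof. exact: simplex_intD. Qed.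

Lemma cell_intB T g h : cinteg T g -> cinteg T h ->
  cell_int T (fun x => g x - h x) = cell_int T g - cell_int T h.
Proof. exact: simplex_intB. Qed.

Lemma cell_intZ T c g : cinteg T g -> cell_int T (fun x => c * g x) = c * cell_int T g.
Proof. exact: simplex_intZ. Qed.

Lemma face_intD F g h : finteg F g -> finteg F h ->
  face_int F (fun x => g x + h x) = face_int F g + face_int F h.
Proof. exact: simplex_intD. Qed.

Lemma face_intB F g h : finteg F g -> finteg F h ->
  face_int F (fun x => g x - h x) = face_int F g - face_int F h.
Proof. exact: simplex_intB. Qed.

Lemma face_intZ F c g : finteg F g -> face_int F (fun x => c * g x) = c * face_int F g.
Proof. exact: simplex_intZ. Qed.

Lemma face_int_sum (I : Type) (s : seq I) (P : pred I) F (G : I -> pt -> R) :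
  (forall i, P i -> finteg F (G i)) ->
  face_int F (fun x => \sum_(i <- s | P i) G i x) = \sum_(i <- s | P i) face_int F (G i).
Proof. by move=> hG; exact: (sinteg_sum _ hG).2. Qed.

Lemma cell_int_sum (I : Type) (s : seq I) (P : pred I) T (G : I -> pt -> R) :
  (forall i, P i -> cinteg T (G i)) ->
  cell_int T (fun x => \sum_(i <- s | P i) G i x) = \sum_(i <- s | P i) cell_int T (G i).
Proof. by move=> hG; exact: (sinteg_sum _ hG).2. Qed.

Lemma green T (v : pt -> pt) psi : simplicial T -> vpoly v -> C1 psi ->
  cell_int T (fun x => dot (v x) (grad psi x)) + cell_int T (fun x => divv v x * psi x) =
  \sum_(F in cell_faces T) face_int F (fun x => dot (v x) (outer_normal T F) * psi x).
Proof. by move=> sT /vpoly_uniform[k hv]; exact: cell_green. Qed.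

Lemma divergence_thm T (v : pt -> pt) : simplicial T -> vpoly v ->
  cell_int T (divv v) =
  \sum_(F in cell_faces T) face_int F (fun x => dot (v x) (outer_normal T F)).
Proof.
move=> sT hv; have := green sT hv (spoly_C1 (spoly_cst 1)).
rewrite (cell_int0 (g := fun x => dot (v x) _) sT.1) ?add0r; last first.
  move=> x _; apply: big1 => i _; rewrite mxE /partial.
  by rewrite (_ : 'D_ _ _ _ = 0) ?mulr0//; exact: partial_cst.
have -> : cell_int T (fun x => divv v x * 1) = cell_int T (divv v).
  by apply: eq_simplex_int => y _; rewrite mulr1.
move=> ->; apply: eq_bigr => F _.
by apply: eq_simplex_int => y _; rewrite mulr1.
Qed.

Lemma cinteg_L2_dot (f : pt -> pt) T v : L2_v (fun_f M f) -> T \in cells -> vpoly v ->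
  cinteg T (fun x => dot (f x) (v x)).
Proof.
move=> hf cT hv; apply: (sinteg_sum _ _).1 => i _.
by apply: sinteg_L2; [exact: hf|exact: spoly_cont].
Qed.

End cell_functionals.

(** * Local problems *)

Lemma partial_sum (R : realType) (d : nat) (I : finType) j (G : I -> 'rV[R]_d -> R) x :
  (forall i, differentiable (G i) x) ->
  partial j (fun z => \sum_i G i z) x = \sum_i partial j (G i) x.
Proof.
move=> dG; suff H (s : seq I) : differentiable (fun z => \sum_(i <- s) G i z) x /\
    partial j (fun z => \sum_(i <- s) G i z) x = \sum_(i <- s) partial j (G i) x.
  by case: (H (index_enum I)).
elim: s => [|i s [IH1 IH2]].
  have -> : (fun z => \sum_(i <- [::]) G i z) = fun=> 0.
    by apply/funext => z; rewrite big_nil.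
  by rewrite partial_cst big_nil; split=> //; exact: differentiable_cst.
have -> : (fun z => \sum_(l <- i :: s) G l z) = (fun z => G i z + \sum_(l <- s) G l z).
  by apply/funext => z; rewrite big_cons.
by rewrite partialD// IH2 big_cons; split=> //; exact: differentiableD.
Qed.

Lemma subrACA (U : zmodType) (a b c e : U) : (a - b) - (c - e) = (a - c) - (b - e).
Proof. by rewrite opprD addrACA -opprD. Qed.

Lemma dot_mxtr (R : realType) (d : nat) (tau : 'M[R]_d) (a c : 'rV[R]_d) :
  dot (a *m tau^T) c = dot (c *m tau) a.
Proof.
rewrite /dot; under eq_bigr do rewrite mxE mulr_suml.
rewrite exchange_big /=; apply: eq_bigr => j _.
rewrite mxE mulr_suml; apply: eq_bigr => i _; rewrite !mxE; ring.
Qed.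

(** * Pairings and residuals as sums over cells *)

Section local_problems.
Context {R : realType} {n : nat} {M : mesh R n.+1}.
Local Notation d := n.+1.
Local Notation pt := 'rV[R]_n.+1.
Local Notation vtx := (vtx M).
Local Notation pos := (@pos R n.+1 M).
Local Notation cells := (cells M).
Implicit Types (T F : {set vtx}) (V W : vtx) (x c : pt).
Variable Omega : set pt.
Hypothesis hM : triangulation M Omega.
Hypothesis hOmega : domain Omega.

Lemma vpatch_cells V T : T \in vpatch V -> T \in cells.
Proof. by rewrite inE => /andP[]. Qed.

Lemma patch_faces_faces V F : F \in patch_faces Omega V -> F \in faces_of (vpatch V).
Proof. by rewrite inE => /andP[]. Qed.

Lemma exchange_patch V (U : zmodType) (Phi : {set vtx} -> {set vtx} -> U) :
  \sum_(F in patch_faces Omega V) \sum_(T in vpatch V | F \subset T) Phi T F =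
  \sum_(T in vpatch V) \sum_(F in cell_faces T | F \in patch_faces Omega V) Phi T F.
Proof.
under [RHS]eq_bigr do rewrite big_mkcondr.
rewrite exchange_cells_faces.
rewrite [RHS](bigID (mem (patch_faces Omega V))) /= [X in _ = _ + X]big1 ?addr0; last first.
  move=> F /andP[_ /negbTE FV]; apply: big1 => T _; by rewrite FV.
apply: eq_big => [F|F FV]; last by rewrite FV.
by rewrite andbC; case: (boolP (F \in patch_faces _ _)) => // /patch_faces_faces ->.
Qed.

Section pairings.
Variable (tau : mfield M).

Definition div_part (v : vfield M) T :=
  cell_int T (fun x => dot (divm (tau T) x) (v T x)).
Definition nn_part (v : vfield M) T F :=
  face_int F (fun x => nn (tau T x) (outer_normal T F) * dot (v T x) (outer_normal T F)).
Definition nt_part (vh : vfield M) T F :=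
  face_int F (fun x => dot (nt (tau T x) (outer_normal T F)) (vh F x)).

Lemma jump_nn_int (C : {set {set vtx}}) v F :
  (forall T, T \in C -> T \in cells) -> (forall T, T \in C -> mpoly (tau T)) ->
  (forall T, T \in C -> vpoly (v T)) -> F \in faces_of C ->
  (forall T x, T \in C -> F \subset T -> hull F x ->
     dot (v T x) (face_normal C F) = dot (v (cell1 C F) x) (face_normal C F)) ->
  face_int F (fun x => jump C F (fun T => nn (tau T x) (face_normal C F)) *
     dot (v (cell1 C F) x) (face_normal C F)) =
  \sum_(T in C | F \subset T) nn_part v T F.
Proof.
move=> Cc ht hv FC hc; have [Fd _] := (in_faces_of C F).1 FC.
rewrite -face_int_sum; last first.
  move=> T /andP[TC FT]; apply: finteg_spoly; apply: spolyM.
    exact: spoly_nn (ht T TC).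
  exact: spoly_dotr (hv T TC).
apply: eq_face_int => // x hx.
rewrite (@jump_nn _ _ _ _ hM C F Cc FC (tau^~ x) (v^~ x))// => T TC FT.
exact: hc.
Qed.

Lemma jump_nt_int (C : {set {set vtx}}) (vh : vfield M) F :
  (forall T, T \in C -> T \in cells) -> (forall T, T \in C -> mpoly (tau T)) ->
  vpoly (vh F) -> F \in faces_of C ->
  face_int F (fun x => dot (jump C F (fun T => nt (tau T x) (face_normal C F))) (vh F x)) =
  \sum_(T in C | F \subset T) nt_part vh T F.
Proof.
move=> Cc ht hv FC; have [Fd _] := (in_faces_of C F).1 FC.
rewrite -face_int_sum; last first.
  move=> T /andP[TC FT]; apply: finteg_spoly; apply: spoly_dot => //.
  exact: vpoly_nt (ht T TC).
apply: eq_face_int => // x hx.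
by rewrite (@jump_nt _ _ _ _ hM C F Cc FC (tau^~ x)) dot_suml.
Qed.

(** With continuous normal traces, each jump integral splits into contributions of the adjacent
    cells with their own outward normals, which eliminates the choice of [cell1]. *)
Lemma pairing_cellwise v : (forall T, T \in cells -> mpoly (tau T)) ->
  (forall T, T \in cells -> vpoly (v T)) ->
  (forall T1 T2 F x, T1 \in cells -> T2 \in cells -> F \in cell_faces T1 ->
     F \in cell_faces T2 -> hull F x ->
     dot (v T1 x) (outer_normal T1 F) = dot (v T2 x) (outer_normal T1 F)) ->
  pairing tau v =
  \sum_(T in cells) (div_part v T - \sum_(F in cell_faces T) nn_part v T F).
Proof.
move=> ht hv hc; rewrite sumrB; congr (_ - _).
rewrite exchange_cells_faces /faces; apply: eq_bigr => F FC.
apply: jump_nn_int => // T x TC FT hx.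
have [c1 F1] := cell1P FC.
have FT' := facet_of_C FC TC FT; have F1' := facet_of_C FC c1 F1.
by apply/esym; rewrite /face_normal; exact: hc.
Qed.

Section patch.
Variable V : vtx.

Lemma pairingV_cellwise v vh : (forall T, T \in vpatch V -> mpoly (tau T)) ->
  (forall T, T \in vpatch V -> vpoly (v T)) ->
  (forall F, F \in patch_faces Omega V -> vpoly (vh F)) ->
  (forall F T1 T2 x, F \in faces_of (vpatch V) -> T1 \in vpatch V -> T2 \in vpatch V ->
    F \subset T1 -> F \subset T2 -> hull F x ->
    dot (v T1 x) (face_normal (vpatch V) F) = dot (v T2 x) (face_normal (vpatch V) F)) ->
  pairingV Omega V tau v vh =
  \sum_(T in vpatch V) (div_part v T -
     \sum_(F in cell_faces T | F \in patch_faces Omega V)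
        (nn_part v T F + nt_part vh T F)).
Proof.
move=> ht hv hvh hc; rewrite sumrB; congr (_ - _).
rewrite -exchange_patch; apply: eq_bigr => F FV.
have FC := patch_faces_faces FV.
rewrite jump_nn_int ?jump_nt_int -?big_split//.
- exact: vpatch_cells.
- exact: hvh.
- exact: vpatch_cells.
- move=> T x TC FT hx; have [c1 F1] := cell1P FC; exact: hc.
Qed.

End patch.
End pairings.

Section residuals.
Variables (nu : R) (f : pt -> pt) (k : nat) (ub : vfield M) (pb : sfield M).
Hypothesis k0 : (0 < k)%N.
Hypothesis hf : L2_v (fun_f M f).
Hypothesis hub : forall T, T \in cells -> vpoly (ub T).
Hypothesis hpb : forall T, T \in cells -> spoly (pb T).

Local Notation sig := (stress_f nu ub).

Lemma mpoly_sig T : T \in cells -> mpoly (sig T).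
Proof. by move=> cT; apply: mpolyZ; exact: mpoly_gradv (hub cT). Qed.

Lemma mpoly_sigp T : T \in cells -> mpoly (fun x => sig T x - (pb T x)%:M).
Proof.
by move=> cT; apply: mpolyB; [exact: mpoly_sig|exact: mpoly_scalar (hpb cT)].
Qed.

Definition load T x := f x + nu *: lapv (ub T) x - grad (pb T) x.

Lemma vpoly_load_part T : T \in cells ->
  vpoly (fun x => nu *: lapv (ub T) x - grad (pb T) x).
Proof.
move=> cT; apply: vpolyB; last exact: vpoly_grad (hpb cT).
apply: vpolyZ; [exact: spoly_cst|exact: vpoly_lapv (hub cT)].
Qed.

Lemma loadE T b x :
  dot (load T x) b = dot (f x) b + dot (nu *: lapv (ub T) x - grad (pb T) x) b.
Proof. by rewrite -dotDl addrA. Qed.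

Lemma cinteg_load T b : T \in cells -> vpoly b -> cinteg T (fun x => dot (load T x) (b x)).
Proof.
move=> cT hb.
have -> : (fun x => dot (load T x) (b x)) = (fun x => dot (f x) (b x) +
    dot (nu *: lapv (ub T) x - grad (pb T) x) (b x)).
  by apply/funext => x; exact: loadE.
apply: sintegD; first exact: cinteg_L2_dot.
by apply: cinteg_spoly; apply: spoly_dot => //; exact: vpoly_load_part.
Qed.

(** The part of [residual] that sees the volume test field. It is applied to one bubble at a time
    and, after summation over the vertices, to the field itself. *)
Definition cell_residual T (b : pt -> pt) : R :=
  cell_int T (fun x => dot (load T x) (b x)) -
  \sum_(F in cell_faces T) face_int F (fun x =>
     nn (sig T x - (pb T x)%:M) (outer_normal T F) * dot (b x) (outer_normal T F)).

Lemma eq_cell_residual T b b' : (forall x, b x = b' x) ->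
  cell_residual T b = cell_residual T b'.
Proof. by move=> bb; congr (cell_residual T); exact/funext. Qed.

Lemma finteg_sigp T F (b : pt -> pt) : T \in cells -> vpoly b -> finteg F (fun x =>
     nn (sig T x - (pb T x)%:M) (outer_normal T F) * dot (b x) (outer_normal T F)).
Proof.
move=> cT hb; apply: finteg_spoly; apply: spolyM; last exact: spoly_dotr.
exact: spoly_nn (mpoly_sigp cT).
Qed.

Lemma cell_residualB T b b' : T \in cells -> vpoly b -> vpoly b' ->
  cell_residual T (fun x => b x - b' x) = cell_residual T b - cell_residual T b'.
Proof.
move=> cT hb hb'; rewrite /cell_residual.
have -> : cell_int T (fun x => dot (load T x) (b x - b' x)) =
    cell_int T (fun x => dot (load T x) (b x)) - cell_int T (fun x => dot (load T x) (b' x)).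
  rewrite -cell_intB; [|exact: cinteg_load|exact: cinteg_load].
  by apply: eq_simplex_int => y _; rewrite dotBr.
have -> : \sum_(F in cell_faces T) face_int F (fun x =>
     nn (sig T x - (pb T x)%:M) (outer_normal T F) * dot (b x - b' x) (outer_normal T F)) =
   \sum_(F in cell_faces T) face_int F (fun x =>
     nn (sig T x - (pb T x)%:M) (outer_normal T F) * dot (b x) (outer_normal T F)) -
   \sum_(F in cell_faces T) face_int F (fun x =>
     nn (sig T x - (pb T x)%:M) (outer_normal T F) * dot (b' x) (outer_normal T F)).
  rewrite -sumrB; apply: eq_bigr => F FT.
  rewrite -face_intB; [|exact: finteg_sigp|exact: finteg_sigp].
  by apply: eq_simplex_int => y _; rewrite dotBl mulrBr.
exact: subrACA.
Qed.

Lemma cell_residual_sum (I : finType) (P : pred I) T (b : I -> pt -> pt) : T \in cells ->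
  (forall i, P i -> vpoly (b i)) ->
  cell_residual T (fun x => \sum_(i | P i) b i x) = \sum_(i | P i) cell_residual T (b i).
Proof.
move=> cT hb; rewrite /cell_residual sumrB; congr (_ - _).
  rewrite -cell_int_sum; last by move=> i Pi; exact: cinteg_load (hb i Pi).
  by apply: eq_simplex_int => y _; rewrite dot_sumr.
rewrite exchange_big /=; apply: eq_bigr => F FT.
rewrite -face_int_sum; last by move=> i Pi; exact: finteg_sigp (hb i Pi).
by apply: eq_simplex_int => y _; rewrite dot_suml mulr_sumr.
Qed.

Definition nt_hat_part V (vh : vfield M) T F :=
  face_int F (fun x => dot (hat V T x *: nt (sig T x) (outer_normal T F)) (vh F x)).

Lemma residualE V v vh : residual Omega nu f k ub pb V v vh =
  \sum_(T in vpatch V) (cell_residual T (bubble k V v T) -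
    \sum_(F in cell_faces T | F \in patch_faces Omega V) nt_hat_part V vh T F).
Proof. by []. Qed.

Lemma vpoly_bubble V v T : T \in cells -> vpoly (bubble k V v T).
Proof.
by move=> cT i; exists k; exact: (pdeg_bubble k0 (cell_simplicial hM cT)).
Qed.

Lemma finteg_nt_hat V vh T F : T \in cells -> vpoly (vh F) -> finteg F (fun x =>
   dot (hat V T x *: nt (sig T x) (outer_normal T F)) (vh F x)).
Proof.
move=> cT hv; apply: finteg_spoly; apply: spoly_dot => //; apply: vpolyZ.
  by exists 1%N; exact: pdeg_hat (cell_simplicial hM cT) V.
exact: vpoly_nt (mpoly_sig cT).
Qed.

Lemma residualB V v w vh wh :
  (forall F, F \in patch_faces Omega V -> vpoly (vh F)) ->
  (forall F, F \in patch_faces Omega V -> vpoly (wh F)) ->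
  residual Omega nu f k ub pb V (fun T x => v T x - w T x) (fun F x => vh F x - wh F x) =
  residual Omega nu f k ub pb V v vh - residual Omega nu f k ub pb V w wh.
Proof.
move=> hv hw; rewrite !residualE -sumrB; apply: eq_bigr => T /vpatch_cells cT.
have sT := cell_simplicial hM cT.
have -> : cell_residual T (bubble k V (fun T x => v T x - w T x) T) =
    cell_residual T (bubble k V v T) - cell_residual T (bubble k V w T).
  rewrite -cell_residualB//; [|exact: vpoly_bubble|exact: vpoly_bubble].
  by apply: eq_cell_residual => x; rewrite (bubbleB k0 sT).
rewrite (eq_bigr (fun F => nt_hat_part V vh T F - nt_hat_part V wh T F)).
  by rewrite sumrB subrACA.
move=> F /andP[FT FV]; rewrite -face_intB; last 2 first.
- by apply: finteg_nt_hat => //; exact: hv.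
- by apply: finteg_nt_hat => //; exact: hw.
by apply: eq_simplex_int => y _; rewrite dotBr.
Qed.

Section constants.
Variables (V : vtx) (c : pt).

Definition cst_v : vfield M := fun _ _ => c.
(** The tangential part c_t, which does not depend on the sign of the normal. *)
Definition cst_vh : vfield M := fun F _ =>
  c - dot c (face_normal (vpatch V) F) *: face_normal (vpatch V) F.

Lemma vpoly_cst_vh F : vpoly (cst_vh F).
Proof. exact: vpoly_cst. Qed.

Lemma cst_vhE T F x : T \in vpatch V -> F \in cell_faces T ->
  cst_vh F x = c - dot c (outer_normal T F) *: outer_normal T F.
Proof.
move=> TV FcT; have [Fd FT] := (in_cell_faces T F).1 FcT.
have FC : F \in faces_of (vpatch V) by apply/in_faces_of; split=> //; exists T.
rewrite (outer_face_normal hM (@vpatch_cells V) FC TV FT) /cst_vh.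
by case: eqP => // _; rewrite dotNr scaleNr scalerN opprK.
Qed.

Hypothesis Vint : ~~ bd_vertex Omega V.

Lemma patch_faces_interior T F : T \in vpatch V -> F \in cell_faces T ->
  F \in patch_faces Omega V.
Proof.
move=> TV FcT; rewrite inE (negbTE Vint) andbT.
have [Fd FT] := (in_cell_faces T F).1 FcT.
by apply/in_faces_of; split=> //; exists T.
Qed.

Lemma big_patch_interior T (Phi : {set vtx} -> R) : T \in vpatch V ->
  \sum_(F in cell_faces T | F \in patch_faces Omega V) Phi F =
  \sum_(F in cell_faces T) Phi F.
Proof.
move=> TV; apply: eq_bigl => F; case: (boolP (F \in cell_faces T)) => //= FT.
exact: (patch_faces_interior TV).
Qed.

(** At an interior vertex no facet is removed, so the facet terms of each cell add up to the flux of
    [c *m tau T x] through its boundary and cancel the integral of the divergence. *)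
Lemma pairingV_cst tau : (forall T, T \in vpatch V -> mpoly (tau T)) ->
  pairingV Omega V tau cst_v cst_vh = 0.
Proof.
move=> ht; rewrite pairingV_cellwise//; first last.
- by move=> F _; exact: vpoly_cst_vh.
- by move=> T _; exact: vpoly_cst.
apply: big1 => T TV; have cT := vpatch_cells TV; have sT := cell_simplicial hM cT.
rewrite big_patch_interior//.
pose w x := c *m tau T x.
have hw : vpoly w.
  move=> j; have -> : (fun x => w x 0 j) = (fun x => \sum_i c 0 i * tau T x i j).
    by apply/funext => x; rewrite mxE.
  by apply: spoly_sum => i _; apply: spolyZ; exact: ht.
have -> : div_part tau cst_v T = cell_int T (divv w).
  apply: eq_simplex_int => y _; rewrite dotC /dot /divv.
  transitivity (\sum_j \sum_i c 0 i * partial j (fun z => tau T z i j)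
      (simplex_param (@vertices R d M d T) y)).
    rewrite exchange_big /=; apply: eq_bigr => i _.
    by rewrite mxE mulr_sumr.
  apply: eq_bigr => j _.
  have -> : (fun z => w z 0 j) = (fun z => \sum_i c 0 i * tau T z i j).
    by apply/funext => x; rewrite mxE.
  rewrite partial_sum; last by move=> i; apply: spoly_diff; apply: spolyZ; exact: ht.
  by apply: eq_bigr => i _; rewrite partialZ//; apply: spoly_diff; exact: ht.
rewrite divergence_thm// -sumrB big1// => F FT.
rewrite -face_intD; last 2 first.
- apply: finteg_spoly; apply: spolyM; [exact: spoly_nn (ht T TV)|exact: spoly_dotr (vpoly_cst c)].
- by apply: finteg_spoly; apply: spoly_dot; [exact: vpoly_nt (ht T TV)|exact: vpoly_cst].
apply/eqP; rewrite subr_eq0; apply/eqP; apply: eq_simplex_int => y _.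
rewrite (cst_vhE _ TV FT) dot_nn_nt; last exact: (outer_unit hM cT FT).
by rewrite dot_mxtr.
Qed.

Hypothesis hprimal : ip_v (fun_f M f) (fun T x => hat V T x *: c) =
  nu * ip_m (grad_f ub) (grad_f (fun T x => hat V T x *: c)) -
  ip_s (div_f (fun T x => hat V T x *: c)) pb.

(** The flux of sigma - p I in direction [c]. Its divergence is the load without [f], and its
    product with the gradient of the hat function is the integrand of the primal form. *)
Let w T x : pt := c *m sig T x - pb T x *: c.

Let vpoly_w T : T \in cells -> vpoly (w T).
Proof.
move=> cT; apply: vpolyB; last by apply: vpolyZ (hpb cT) (vpoly_cst c).
move=> j; have -> : (fun x => (c *m sig T x) 0 j) = (fun x => \sum_i c 0 i * sig T x i j).
  by apply/funext => x; rewrite mxE.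
by apply: spoly_sum => i _; apply: spolyZ; exact: mpoly_sig.
Qed.

Let div_w T x : T \in cells -> divv (w T) x = dot (nu *: lapv (ub T) x - grad (pb T) x) c.
Proof.
move=> cT; rewrite dotBl.
have E j : (fun z => w T z 0 j) =
    (fun z => \sum_i c 0 i * (nu * gradv (ub T) z i j) - c 0 j * pb T z).
  apply/funext => z; rewrite !mxE [c 0 j * _]mulrC; congr (_ - _).
  by apply: eq_bigr => i _; rewrite !mxE.
have sg i j : spoly (fun z => gradv (ub T) z i j) by exact: mpoly_gradv (hub cT) i j.
rewrite /divv.
transitivity (\sum_j (\sum_i c 0 i * (nu * partial j (fun z => gradv (ub T) z i j) x) -
    c 0 j * partial j (pb T) x)).
  apply: eq_bigr => j _; rewrite E partialB; last 2 first.
  - by apply: spoly_diff; apply: spoly_sum => i _; do 2!apply: spolyZ.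
  - by apply: spoly_diff; apply: spolyZ; exact: hpb.
  rewrite partial_sum; last by move=> i; apply: spoly_diff; do 2!apply: spolyZ.
  rewrite partialZ; last by apply: spoly_diff; exact: hpb.
  congr (_ - _); apply: eq_bigr => i _.
  rewrite partialZ; last by apply: spoly_diff; apply: spolyZ.
  by rewrite partialZ//; apply: spoly_diff.
rewrite sumrB; congr (_ - _); last first.
  by apply: eq_bigr => j _; rewrite mxE mulrC.
rewrite exchange_big /=; apply: eq_bigr => i _.
rewrite !mxE mulr_sumr mulr_suml; apply: eq_bigr => j _.
have -> : (fun z => gradv (ub T) z i j) = partial j (fun y => ub T y 0 i).
  by apply/funext => z; rewrite mxE.
by ring.
Qed.

Let dot_w_ghat T x : T \in cells -> dot (w T x) (ghat T V) =
  nu * frob (gradv (ub T) x) (gradv (fun y => hat V T y *: c) x) -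
  divv (fun y => hat V T y *: c) x * pb T x.
Proof.
move=> cT; have sT := cell_simplicial hM cT.
have dh := pdeg_differentiable (pdeg_hat sT V).
have E i j : partial j (fun y => (hat V T y *: c) 0 i) x = c 0 i * ghat T V 0 j.
  have -> : (fun y => (hat V T y *: c) 0 i) = (fun y => c 0 i * hat V T y).
    by apply/funext => y; rewrite mxE mulrC.
  by rewrite partialZ// -(grad_hat sT V x) mxE.
rewrite dotBl dotZl; congr (_ - _); last first.
  rewrite mulrC; congr (_ * _); rewrite /divv /dot; apply: eq_bigr => i _.
  by rewrite E.
rewrite /frob /dot.
under eq_bigr do rewrite mxE mulr_suml.
rewrite exchange_big mulr_sumr; apply: eq_bigr => i _ /=.
rewrite mulr_sumr; apply: eq_bigr => j _.
have -> : gradv (fun y => hat V T y *: c) x i j = c 0 i * ghat T V 0 j by rewrite mxE E.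
move: (ghat T V) => g; rewrite !mxE.
by ring.
Qed.

(** Normal and tangential facet terms recombine to the flux of [w] weighted by the hat function.
    With Green's formula the residual becomes the defect of the primal equation for
    [hat V T x *: c]. *)
Lemma residual_cst : residual Omega nu f k ub pb V cst_v cst_vh = 0.
Proof.
rewrite residualE.
transitivity (\sum_(T in vpatch V) (cell_int T (fun x => dot (f x) (hat V T x *: c)) -
    cell_int T (fun x => dot (w T x) (ghat T V)))).
  apply: eq_bigr => T TV; have cT := vpatch_cells TV; have sT := cell_simplicial hM cT.
  have vh : vpoly (fun x => hat V T x *: c).
    by apply: vpolyZ (vpoly_cst c); exists 1%N; exact: pdeg_hat.
  have sh : spoly (hat V T) by exists 1%N; exact: pdeg_hat.
  rewrite big_patch_interior//.
  rewrite (@eq_cell_residual T _ (fun x => hat V T x *: c)); last first.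
    by move=> x; rewrite (bubble_cst k0 sT).
  rewrite /cell_residual -addrA -opprD -big_split /=.
  rewrite (eq_bigr (fun F => face_int F (fun x => dot (w T x) (outer_normal T F) * hat V T x))).
    rewrite -green//; [|exact: vpoly_w|exact: spoly_C1].
    have -> : cell_int T (fun x => dot (load T x) (hat V T x *: c)) =
       cell_int T (fun x => dot (f x) (hat V T x *: c)) +
       cell_int T (fun x => divv (w T) x * hat V T x).
      rewrite -cell_intD; last 2 first.
      - exact: cinteg_L2_dot.
      - apply: cinteg_spoly; apply: spolyM => //; exact: spoly_divv (vpoly_w cT).
      apply: eq_simplex_int => y _; rewrite loadE; congr (_ + _).
      by rewrite div_w// dotZr mulrC.
    have -> : cell_int T (fun x => dot (w T x) (grad (hat V T) x)) =
        cell_int T (fun x => dot (w T x) (ghat T V)).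
      by apply: eq_simplex_int => y _; rewrite grad_hat.
    by ring.
  move=> F FT; have n1 := outer_unit hM cT FT.
  rewrite -face_intD; last 2 first.
  - exact: finteg_sigp.
  - by apply: finteg_nt_hat => //; exact: vpoly_cst_vh.
  apply: eq_simplex_int => y _; rewrite (cst_vhE _ TV FT).
  set x := simplex_param _ _.
  have -> : dot (w T x) (outer_normal T F) =
      dot (outer_normal T F *m (sig T x)^T) c - pb T x * dot c (outer_normal T F).
    by rewrite dotBl dotZl dot_mxtr.
  by rewrite nnB nn_scalar// !dotZl -(dot_nn_nt _ _ n1); ring.
transitivity (ip_v (fun_f M f) (fun T x => hat V T x *: c) -
  (nu * ip_m (grad_f ub) (grad_f (fun T x => hat V T x *: c)) -
   ip_s (div_f (fun T x => hat V T x *: c)) pb)); last by rewrite hprimal subrr.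
(* Off the patch the hat function and its gradient vanish, so that sums over the patch are sums over
   the mesh. *)
have zero T : T \in cells -> T \notin vpatch V ->
    (forall x, hat V T x = 0) /\ ghat T V = 0.
  move=> cT; rewrite inE cT /= => VT; have sT := cell_simplicial hM cT.
  by split=> [x|]; [exact: hat_off|exact: ghat_off].
have offsum (G : {set vtx} -> R) : (forall T, T \in cells -> T \notin vpatch V -> G T = 0) ->
    \sum_(T in vpatch V) G T = \sum_(T in cells) G T.
  move=> G0; rewrite [RHS](bigID (mem (vpatch V))) /= [X in _ = _ + X]big1 ?addr0.
    by apply: eq_bigl => T; rewrite inE andbA andbb.
  by move=> T /andP[]; exact: G0.
rewrite sumrB; congr (_ - _).
  apply: offsum => T cT TV; have [h0 _] := zero T cT TV.
  by apply: cell_int0 => [|x _]; [exact: (cell_simplicial hM cT).1|rewrite h0 scale0r dot0r].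
rewrite offsum; last first.
  move=> T cT TV; have [_ g0] := zero T cT TV.
  by apply: cell_int0 => [|x _]; [exact: (cell_simplicial hM cT).1|rewrite g0 dot0r].
rewrite /ip_m /ip_s /omega_int mulr_sumr -sumrB; apply: eq_bigr => T cT.
have sT := cell_simplicial hM cT.
have vh : vpoly (fun x => hat V T x *: c).
  by apply: vpolyZ (vpoly_cst c); exists 1%N; exact: pdeg_hat.
have sf : spoly (fun x => frob (gradv (ub T) x) (gradv (fun y => hat V T y *: c) x)).
  apply: spoly_sum => i _; apply: spoly_sum => j _.
  apply: spolyM; [exact: (mpoly_gradv (hub cT))|exact: (mpoly_gradv vh)].
rewrite -cell_intZ; last exact: cinteg_spoly.
rewrite -cell_intB; last 2 first.
- by apply: cinteg_spoly; exact: spolyZ.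
- by apply: cinteg_spoly; apply: spolyM; [exact: spoly_divv|exact: hpb].
by apply: eq_simplex_int => y _; rewrite dot_w_ghat.
Qed.

End constants.
End residuals.
End local_problems.

(** * Removal of the zero-mean constraint *)

Section local_equation.
Context {R : realType} {n : nat} {M : mesh R n.+1}.
Local Notation d := n.+1.
Local Notation pt := 'rV[R]_n.+1.
Local Notation vtx := (vtx M).
Local Notation pos := (@pos R n.+1 M).
Local Notation cells := (cells M).
Implicit Types (T F : {set vtx}) (V W : vtx) (x c : pt).
Variable Omega : set pt.
Hypothesis hM : triangulation M Omega.
Hypothesis hOmega : domain Omega.

Lemma vpatch_face_unit V F : F \in faces_of (vpatch V) ->
  dot (face_normal (vpatch V) F) (face_normal (vpatch V) F) = 1.
Proof. by move=> FC; exact: (face_normal_unit hM (@vpatch_cells _ _ _ V) FC). Qed.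

Section mean.
Variable V : vtx.
Local Notation FV := (patch_faces Omega V).
Local Notation nF := (face_normal (vpatch V)).

(** Maps [c] to the unnormalised mean of the pair (c, c_t), see [mean_cst]. As facets only see c_t,
    correcting a mean takes the inverse of this matrix rather than a division by the measure. *)
Definition mean_mx : 'M[R]_d :=
  (\sum_(T in vpatch V) cell_int T (fun=> 1))%:M +
  \sum_(F in FV) face_int F (fun=> 1) *: (1%:M - (nF F)^T *m nF F).

Lemma mulmx_outer (c m : pt) : c *m (m^T *m m) = dot c m *: m.
Proof.
rewrite mulmxA; apply/rowP => j; rewrite !mxE big_ord1; congr (_ * _).
by rewrite !mxE; apply: eq_bigr => i _; rewrite !mxE.
Qed.

Lemma mul_mean_mx c : c *m mean_mx =
  (\sum_(T in vpatch V) cell_int T (fun=> 1)) *: c +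
  \sum_(F in FV) face_int F (fun=> 1) *: (c - dot c (nF F) *: nF F).
Proof.
rewrite mulmxDr mul_mx_scalar mulmx_sumr; congr (_ + _); apply: eq_bigr => F _.
by rewrite -scalemxAr mulmxBr mulmx1 mulmx_outer.
Qed.

(** Positive definiteness: tested with [c], it gives the positive measure of the patch times |c|^2
    plus the nonnegative terms |F| |c_t|^2. *)
Lemma mean_mx_unit : mean_mx \in unitmx.
Proof.
rewrite -row_free_unit -kermx_eq0; apply/rowV0P => c /sub_kermxP.
rewrite mul_mean_mx => h0.
have a0 : 0 < \sum_(T in vpatch V) cell_int T (fun=> 1).
  have [_ _ /(_ V)[T cT VT] _ _] := hM.
  have TV : T \in vpatch V by rewrite inE cT.
  rewrite (bigD1 T)//= ltr_pwDl//; first exact: cell_int1_gt0 (cell_simplicial hM cT).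
  apply: sumr_ge0 => T' /andP[/vpatch_cells cT' _].
  by apply: ltW; exact: cell_int1_gt0 (cell_simplicial hM cT').
have h1 := dot0l c; rewrite -{1}h0 dotDl dotZl dot_suml in h1.
have b0 : 0 <= \sum_(F in FV) dot (face_int F (fun=> 1) *: (c - dot c (nF F) *: nF F)) c.
  apply: sumr_ge0 => F /patch_faces_faces FC; rewrite dotZl; apply: mulr_ge0.
    exact: face_int1_ge0.
  have -> : dot (c - dot c (nF F) *: nF F) c =
      dot (c - dot c (nF F) *: nF F) (c - dot c (nF F) *: nF F).
    rewrite !dotBl !dotBr !dotZl !dotZr (vpatch_face_unit FC) (dotC (nF F) c); ring.
  exact: dot_ge0.
apply/eqP; rewrite -dot_eq0 eq_le dot_ge0 andbT -(pmulr_rle0 _ a0).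
by rewrite -[leRHS]h1 lerDl.
Qed.

Lemma mean_cst c i : \sum_(T in vpatch V) cell_int T (fun=> c 0 i) +
  \sum_(F in FV) face_int F (fun x => cst_vh V c F x 0 i) = (c *m mean_mx) 0 i.
Proof.
have E1 T (a : R) : cell_int T (fun=> a) = cell_int T (fun=> 1) * a.
  rewrite mulrC -cell_intZ; last by apply: cinteg_spoly; exact: spoly_cst.
  by apply: eq_simplex_int => y _; rewrite mulr1.
have E2 F (a : R) : face_int F (fun=> a) = face_int F (fun=> 1) * a.
  rewrite mulrC -face_intZ; last by apply: finteg_spoly; exact: spoly_cst.
  by apply: eq_simplex_int => y _; rewrite mulr1.
rewrite mul_mean_mx [RHS]mxE [X in _ = X + _]mxE mulr_suml summxE; congr (_ + _).
  by apply: eq_bigr => T _; rewrite E1.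
by apply: eq_bigr => F _; rewrite [LHS](E2 F ((c - dot c (nF F) *: nF F) 0 i)) [RHS]mxE.
Qed.

End mean.

Section equation.
Variables (nu : R) (f : pt -> pt) (k : nat) (ub : vfield M) (pb : sfield M).
Variables (Vb : set (vfield M)) (Qb : set (sfield M)) (Rec : vfield M -> vfield M).
Hypothesis k0 : (0 < k)%N.
Hypothesis hf : L2_v (fun_f M f).
Hypothesis hub : forall T, T \in cells -> vpoly (ub T).
Hypothesis hpb : forall T, T \in cells -> spoly (pb T).
Hypothesis hRec : reconstruction Omega f k Vb Qb Rec.
Hypothesis hprimal : primal_solution nu f Vb Qb Rec ub pb.

(** For an interior vertex, [hat V T x *: c] is a P_1 field in H^1_0, on which [Rec] is the
    identity. *)
Lemma primal_hat V c : ~~ bd_vertex Omega V ->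
  ip_v (fun_f M f) (fun T x => hat V T x *: c) =
  nu * ip_m (grad_f ub) (grad_f (fun T x => hat V T x *: c)) -
  ip_s (div_f (fun T x => hat V T x *: c)) pb.
Proof.
move=> Vint; have [_ _ _ h4] := hRec; have [_ _ h3 _] := hprimal.
have [||hV hR] := h4 (fun T x => hat V T x *: c).
- move=> T cT i; apply/pdegP.
  have -> : (fun x => (hat V T x *: c) 0 i) = (fun x => c 0 i * hat V T x).
    by apply/funext => x; rewrite mxE mulrC.
  by apply: pdeg_scale; exact: pdeg_hat (cell_simplicial hM cT) V.
- move=> i; have -> : (fun T x => (hat V T x *: c) 0 i) = (fun T x => c 0 i * hat V T x).
    by apply/funext => T; apply/funext => x; rewrite mxE mulrC.
  exact: (hat_H10 hM hOmega (c 0 i) Vint).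
rewrite h3//; apply: eq_bigr => T cT.
by apply: eq_cell_int => [|x hx]; [exact: (cell_simplicial hM cT).1|rewrite hR].
Qed.

Variables (s : mfield M) (V : vtx).
Hypothesis hs : SigmaV k V s.

Let mpoly_s T : T \in vpatch V -> mpoly (s T).
Proof. by move=> TV; have [h _] := hs TV; exact: polym_mpoly h. Qed.

Lemma pairingVB v w vh wh : VV k V v -> VV k V w ->
  (forall F, F \in patch_faces Omega V -> vpoly (vh F)) ->
  (forall F, F \in patch_faces Omega V -> vpoly (wh F)) ->
  pairingV Omega V s (fun T x => v T x - w T x) (fun F x => vh F x - wh F x) =
  pairingV Omega V s v vh - pairingV Omega V s w wh.
Proof.
move=> [v1 v2] [w1 w2] hv hw.
have pv T : T \in vpatch V -> vpoly (v T) by move=> /v1; exact: RT_vpoly.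
have pw T : T \in vpatch V -> vpoly (w T) by move=> /w1; exact: RT_vpoly.
rewrite !(pairingV_cellwise hM)//; last 3 first.
- by move=> T TV; apply: vpolyB; [exact: pv|exact: pw].
- by move=> F FV; apply: vpolyB; [exact: hv|exact: hw].
- by move=> F T1 T2 x FC t1 t2 F1 F2 hx; rewrite !dotBl (v2 F T1 T2)// (w2 F T1 T2).
rewrite -sumrB; apply: eq_bigr => T TV.
have -> : div_part s (fun T x => v T x - w T x) T = div_part s v T - div_part s w T.
  rewrite -cell_intB; last 2 first.
  - by apply: cinteg_spoly; apply: spoly_dot; [exact: vpoly_divm (mpoly_s TV)|exact: pv].
  - by apply: cinteg_spoly; apply: spoly_dot; [exact: vpoly_divm (mpoly_s TV)|exact: pw].
  by apply: eq_simplex_int => y _; rewrite dotBr.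
rewrite (eq_bigr (fun F => (nn_part s v T F + nt_part s vh T F) -
    (nn_part s w T F + nt_part s wh T F))); first by rewrite sumrB subrACA.
move=> F /andP[_ FV].
have -> : nn_part s (fun T x => v T x - w T x) T F = nn_part s v T F - nn_part s w T F.
  rewrite -face_intB; last 2 first.
  - by apply: finteg_spoly; apply: spolyM; [exact: spoly_nn (mpoly_s TV)|exact: spoly_dotr (pv _ TV)].
  - by apply: finteg_spoly; apply: spolyM; [exact: spoly_nn (mpoly_s TV)|exact: spoly_dotr (pw _ TV)].
  by apply: eq_simplex_int => y _; rewrite dotBl mulrBr.
have -> : nt_part s (fun F x => vh F x - wh F x) T F = nt_part s vh T F - nt_part s wh T F.
  rewrite -face_intB; last 2 first.
  - by apply: finteg_spoly; apply: spoly_dot; [exact: vpoly_nt (mpoly_s TV)|exact: hv].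
  - by apply: finteg_spoly; apply: spoly_dot; [exact: vpoly_nt (mpoly_s TV)|exact: hw].
  by apply: eq_simplex_int => y _; rewrite dotBr.
by rewrite opprD addrACA.
Qed.

Lemma RT_polyB_cst v c : RT_poly k v -> RT_poly k (fun x => v x - c).
Proof.
move=> [a [b [ha hb hv]]]; exists (fun x => a x - c), b; split=> //.
- move=> i; apply/pdegP.
  have -> : (fun x => (a x - c) 0 i) = (fun x => a x 0 i - c 0 i).
    by apply/funext => x; rewrite !mxE.
  by apply: pdeg_sub; [exact/pdegP|exact: pdeg_cst].
- by move=> x; rewrite hv addrAC.
Qed.

Lemma RT_poly_cst c : RT_poly k (fun=> c).
Proof.
exists (fun=> c), (fun=> 0); split=> [i||x]; last by rewrite scale0r addr0.
- by apply/pdegP; exact: pdeg_cst.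
- by apply/pdegP; exact: pdeg_cst.
Qed.

Lemma VV_cst c : VV k V (cst_v c).
Proof. by split=> // T _; exact: RT_poly_cst. Qed.

Lemma VVB_cst v c : VV k V v -> VV k V (fun T x => v T x - c).
Proof.
move=> [v1 v2]; split=> [T TV|F T1 T2 x FC t1 t2 F1 F2 hx].
  exact: RT_polyB_cst (v1 _ TV).
by rewrite !dotBl (v2 F T1 T2).
Qed.

Lemma VhatVB_cst vh c : VhatV Omega k V vh ->
  VhatV Omega k V (fun F x => vh F x - cst_vh V c F x).
Proof.
move=> hv F FV; have [p1 p2] := hv F FV; split=> [i|x hx].
  apply/pdegP; have -> : (fun x => (vh F x - cst_vh V c F x) 0 i) =
      (fun x => vh F x 0 i - cst_vh V c F 0 0 i).
    by apply/funext => x; rewrite [LHS]mxE [(- _ : 'rV__) _ _]mxE.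
  by apply: pdeg_sub; [exact/pdegP|exact: pdeg_cst].
rewrite dotBl p2// sub0r dotBl dotZl (vpatch_face_unit (patch_faces_faces FV)).
by rewrite mulr1 subrr oppr0.
Qed.

Variables (u uh : vfield M) (p : sfield M).
Hypothesis hlocal : local_solution Omega nu f k ub pb V s u uh p.

(* For an interior vertex the test functions of the local problem have zero mean;
   the constants lost in this way satisfy the equation because hat V *: c is an
   admissible test function of the primal method. *)
Lemma local_equation v vh : VV k V v -> VhatV Omega k V vh ->
  (forall T x, T \in vpatch V -> divv (v T) x = 0) ->
  pairingV Omega V s v vh = residual Omega nu f k ub pb V v vh.
Proof.
move=> hv hvh dv; have [_ _ heq _] := hlocal.
have X0 (w wh : vfield M) : (forall T x, T \in vpatch V -> divv (w T) x = 0) ->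
    XV Omega k V w wh -> pairingV Omega V s w wh = residual Omega nu f k ub pb V w wh.
  move=> dw /heq <-; rewrite [X in _ = _ + X]big1 ?addr0// => T TV.
  have cT := vpatch_cells TV.
  by apply: cell_int0 => [|x _]; [exact: (cell_simplicial hM cT).1|rewrite dw// mul0r].
have [Vbd|Vint] := boolP (bd_vertex Omega V).
  by apply: X0 => //; split; rewrite // Vbd.
(* [S] is the mean without its normalising factor, and [c] below is the constant whose pair (c, c_t)
   has the same mean. *)
pose S : pt := \row_i (\sum_(T in vpatch V) cell_int T (fun x => v T x 0 i) +
  \sum_(F in patch_faces Omega V) face_int F (fun x => vh F x 0 i)).
pose c := S *m invmx (mean_mx V).
have Ec : c *m mean_mx V = S by rewrite mulmxKV// mean_mx_unit.
have pvh F : F \in patch_faces Omega V -> vpoly (vh F).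
  by move=> FV; have [h _] := hvh F FV; exact: polyv_vpoly h.
have pch F : F \in patch_faces Omega V -> vpoly (cst_vh V c F).
  by move=> _; exact: vpoly_cst_vh.
have pv T : T \in vpatch V -> vpoly (v T) by move=> /hv.1; exact: RT_vpoly.
have := X0 (fun T x => v T x - c) (fun F x => vh F x - cst_vh V c F x).
rewrite (pairingVB hv (VV_cst c) pvh pch) (pairingV_cst hM c Vint mpoly_s) subr0.
rewrite (residualB hM nu k0 hf hub hpb v (cst_v c) pvh pch).
rewrite (residual_cst hM k0 hf hub hpb Vint (primal_hat c Vint)) subr0.
apply.
  move=> T x TV; rewrite /divv -[RHS](dv T x TV); apply: eq_bigr => i _.
  have -> : (fun y => (v T y - c) 0 i) = (fun y => v T y 0 i - c 0 i).
    by apply/funext => y; rewrite !mxE.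
  rewrite partialB; first by rewrite partial_cst subr0.
    by apply: spoly_diff; exact: pv.
  by apply: spoly_diff; exact: spoly_cst.
split; [exact: VVB_cst|exact: VhatVB_cst|move=> _].
apply/rowP => i; rewrite !mxE.
suff -> : \sum_(T in vpatch V) cell_int T (fun x => (v T x - c) 0 i) +
    \sum_(F in patch_faces Omega V) face_int F (fun x => (vh F x - cst_vh V c F x) 0 i) =
    S 0 i - (c *m mean_mx V) 0 i by rewrite Ec subrr mulr0.
rewrite -mean_cst mxE opprD addrACA -!sumrB; congr (_ + _).
  apply: eq_bigr => T TV; rewrite -cell_intB; last 2 first.
  - by apply: cinteg_spoly; exact: pv.
  - by apply: cinteg_spoly; exact: spoly_cst.
  by apply: eq_simplex_int => y _; rewrite !mxE.
apply: eq_bigr => F FV; rewrite -face_intB; last 2 first.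
- by apply: finteg_spoly; exact: pvh.
- by apply: finteg_spoly; exact: pch.
by apply: eq_simplex_int => y _; rewrite [LHS]mxE [(- _ : 'rV__) _ _]mxE.
Qed.

End equation.
End local_equation.

(** * Equilibrium against divergence-free fields *)

Section equilibration.
Context {R : realType} {n : nat} {M : mesh R n.+1}.
Local Notation d := n.+1.
Local Notation pt := 'rV[R]_n.+1.
Local Notation vtx := (vtx M).
Local Notation pos := (@pos R n.+1 M).
Local Notation cells := (cells M).
Implicit Types (T F : {set vtx}) (V W : vtx) (x c : pt).
Variable Omega : set pt.
Hypothesis hM : triangulation M Omega.
Hypothesis hOmega : domain Omega.

Lemma exchange_cells_vertices (U : zmodType) (Phi : {set vtx} -> vtx -> U) :
  \sum_V \sum_(T in vpatch V) Phi T V = \sum_(T in cells) \sum_(V in T) Phi T V.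
Proof.
rewrite (exchange_big_dep (mem cells)) /=; last by move=> V T _ /vpatch_cells.
by apply: eq_bigr => T cT; apply: eq_bigl => V; rewrite inE cT.
Qed.

Lemma stress_deltaE (s : vtx -> mfield M) T x : T \in cells ->
  stress_delta s T x = \sum_(V in T) s V T x.
Proof.
move=> cT; rewrite /stress_delta [RHS]big_mkcond; apply: eq_bigr => V _.
by rewrite inE cT.
Qed.

Lemma divmB (s t : pt -> 'M[R]_d) x : mpoly s -> mpoly t ->
  divm (fun x => s x - t x) x = divm s x - divm t x.
Proof.
move=> hs ht; apply/rowP => i; rewrite !mxE -sumrB; apply: eq_bigr => j _.
have -> : (fun y => (s y - t y) i j) = (fun y => s y i j - t y i j).
  by apply/funext => y; rewrite !mxE.
by rewrite partialB//; apply: spoly_diff.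
Qed.

Lemma divm_sum (I : finType) (s : I -> pt -> 'M[R]_d) (P : pred I) x :
  (forall i, P i -> mpoly (s i)) ->
  divm (fun x => \sum_(i | P i) s i x) x = \sum_(i | P i) divm (s i) x.
Proof.
move=> hs; apply/rowP => i; rewrite mxE summxE.
under [RHS]eq_bigr do rewrite mxE.
rewrite exchange_big; apply: eq_bigr => j _.
have -> : (fun y => (\sum_(l | P l) s l y) i j) =
    (fun y => \sum_l (if P l then s l y i j else 0)).
  by apply/funext => y; rewrite summxE big_mkcond.
rewrite partial_sum => [|l].
  rewrite [RHS]big_mkcond; apply: eq_bigr => l _; case: (P l) => //.
  exact: partial_cst.
by case Pl: (P l); apply: spoly_diff; [exact: hs|exact: spoly_cst].
Qed.

Lemma lapv_divm (v : pt -> pt) (a : R) x : vpoly v ->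
  divm (fun y => a *: gradv v y) x = a *: lapv v x.
Proof.
move=> hv; apply/rowP => i; rewrite !mxE mulr_sumr; apply: eq_bigr => j _.
have -> : (fun y => (a *: gradv v y) i j) = (fun y => a * partial j (fun z => v z 0 i) y).
  by apply/funext => y; rewrite !mxE.
by rewrite partialZ//; apply: spoly_diff; exact: spoly_partial.
Qed.

Section cell_pairing.
Variables (T : {set vtx}) (w : pt -> pt).
Hypothesis hw : vpoly w.

(** All facets of the cell are included, even those removed from a patch problem; [normal_removed]
    reconciles the two. *)
Definition cell_pairing (t : pt -> 'M[R]_d) : R :=
  cell_int T (fun x => dot (divm t x) (w x)) -
  \sum_(F in cell_faces T) face_int F (fun x =>
    nn (t x) (outer_normal T F) * dot (w x) (outer_normal T F)).

Lemma cinteg_divm t : mpoly t -> cinteg T (fun x => dot (divm t x) (w x)).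
Proof. by move=> ht; apply: cinteg_spoly; apply: spoly_dot => //; exact: vpoly_divm. Qed.

Lemma finteg_nn t F c : mpoly t -> finteg F (fun x => nn (t x) c * dot (w x) c).
Proof.
by move=> ht; apply: finteg_spoly; apply: spolyM; [exact: spoly_nn|exact: spoly_dotr].
Qed.

Lemma cell_pairingB s t : mpoly s -> mpoly t ->
  cell_pairing (fun x => s x - t x) = cell_pairing s - cell_pairing t.
Proof.
move=> hs ht; rewrite /cell_pairing.
have -> : cell_int T (fun x => dot (divm (fun x => s x - t x) x) (w x)) =
    cell_int T (fun x => dot (divm s x) (w x)) - cell_int T (fun x => dot (divm t x) (w x)).
  rewrite -cell_intB; [|exact: cinteg_divm|exact: cinteg_divm].
  by apply: eq_simplex_int => y _; rewrite divmB// dotBl.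
rewrite (eq_bigr (fun F => face_int F (fun x =>
      nn (s x) (outer_normal T F) * dot (w x) (outer_normal T F)) -
    face_int F (fun x => nn (t x) (outer_normal T F) * dot (w x) (outer_normal T F)))).
  by rewrite sumrB subrACA.
move=> F _; rewrite -face_intB; [|exact: finteg_nn|exact: finteg_nn].
by apply: eq_simplex_int => y _; rewrite nnB mulrBl.
Qed.

Lemma nn_sum (I : finType) (P : pred I) (t : I -> 'M[R]_d) c :
  nn (\sum_(i | P i) t i) c = \sum_(i | P i) nn (t i) c.
Proof.
by apply: (big_morph (fun A : 'M[R]_d => nn A c)); [move=> A B; exact: nnD|exact: nn0].
Qed.

Lemma cell_pairing_sum (I : finType) (P : pred I) (t : I -> pt -> 'M[R]_d) :
  (forall i, P i -> mpoly (t i)) ->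
  cell_pairing (fun x => \sum_(i | P i) t i x) = \sum_(i | P i) cell_pairing (t i).
Proof.
move=> ht; rewrite /cell_pairing sumrB; congr (_ - _).
  rewrite -cell_int_sum; last by move=> i Pi; apply: cinteg_divm; exact: ht.
  by apply: eq_simplex_int => y _; rewrite divm_sum// dot_suml.
rewrite exchange_big /=; apply: eq_bigr => F _.
rewrite -face_int_sum; last by move=> i Pi; apply: finteg_nn; exact: ht.
by apply: eq_simplex_int => y _; rewrite nn_sum mulr_suml.
Qed.

End cell_pairing.

Section equation.
Variables (nu : R) (f : pt -> pt) (k : nat) (ub : vfield M) (pb : sfield M).
Hypothesis k0 : (0 < k)%N.
Hypothesis hf : L2_v (fun_f M f).
Hypothesis hub : forall T, T \in cells -> vpoly (ub T).
Hypothesis hpb : forall T, T \in cells -> spoly (pb T).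
Local Notation sig := (stress_f nu ub).

Lemma cell_residual_divfree T (w : pt -> pt) : T \in cells -> vpoly w ->
  (forall x, divv w x = 0) ->
  cell_residual nu f ub pb T w =
  cell_int T (fun x => dot (f x) (w x)) + cell_pairing T w (sig T).
Proof.
move=> cT hw dw; have sT := cell_simplicial hM cT.
rewrite /cell_residual /cell_pairing.
have -> : cell_int T (fun x => dot (load nu f ub pb T x) (w x)) =
   cell_int T (fun x => dot (f x) (w x)) + cell_int T (fun x => dot (divm (sig T) x) (w x)) -
   cell_int T (fun x => dot (w x) (grad (pb T) x)).
  rewrite -cell_intD; last 2 first.
  - exact: cinteg_L2_dot.
  - exact: (cinteg_divm T hw (mpoly_sig nu hub cT)).
  rewrite -cell_intB; last 2 first.
  - apply: sintegD; first exact: cinteg_L2_dot.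
    exact: (cinteg_divm T hw (mpoly_sig nu hub cT)).
  - by apply: cinteg_spoly; apply: spoly_dot => //; exact: vpoly_grad (hpb cT).
  apply: eq_simplex_int => y _.
  rewrite lapv_divm; last exact: hub.
  by rewrite -dotDl (dotC (w _)) -dotBl.
rewrite (eq_bigr (fun F => face_int F (fun x =>
      nn (sig T x) (outer_normal T F) * dot (w x) (outer_normal T F)) -
    face_int F (fun x => dot (w x) (outer_normal T F) * pb T x))).
  rewrite sumrB -(green sT hw (spoly_C1 (hpb cT))).
  have -> : cell_int T (fun x => divv w x * pb T x) = 0.
    by apply: cell_int0 => [|x _]; [exact: sT.1|rewrite dw mul0r].
  by rewrite addr0 opprB !addrA subrK.
move=> F FT; rewrite -face_intB; last 2 first.
- exact: (finteg_nn hw _ _ (mpoly_sig nu hub cT)).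
- by apply: finteg_spoly; apply: spolyM; [exact: spoly_dotr|exact: hpb].
apply: eq_simplex_int => y _.
by rewrite nnB nn_scalar ?(outer_unit hM cT FT)// mulrBl [pb _ _ * _]mulrC.
Qed.

Variables (s : vtx -> mfield M).
Hypothesis hs : forall V, SigmaV k V (s V).

Let mpoly_s V T : T \in vpatch V -> mpoly (s V T).
Proof. by move=> TV; have [h _] := hs TV; exact: polym_mpoly h. Qed.

Lemma mpoly_delta T : T \in cells -> mpoly (stress_delta s T).
Proof.
move=> cT; rewrite (_ : stress_delta s T = fun x => \sum_(V in T) s V T x).
  by apply: mpoly_sum => V VT; apply: mpoly_s; rewrite inE cT.
by apply/funext => x; exact: stress_deltaE.
Qed.

Lemma mpoly_LEQ T : T \in cells -> mpoly (stress_LEQ nu ub s T).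
Proof. by move=> cT; apply: mpolyB; [exact: (mpoly_sig nu hub cT)|exact: mpoly_delta]. Qed.

Lemma cell_pairing_LEQ T w : T \in cells -> vpoly w ->
  cell_pairing T w (stress_LEQ nu ub s T) =
  cell_pairing T w (sig T) - \sum_(V in T) cell_pairing T w (s V T).
Proof.
move=> cT hw; rewrite cell_pairingB//; last 2 first.
- exact: (mpoly_sig nu hub cT).
- exact: mpoly_delta.
rewrite -(cell_pairing_sum T hw); last by move=> V VT; apply: mpoly_s; rewrite inE cT.
by congr (_ - cell_pairing _ _ _); apply/funext => x; exact: stress_deltaE.
Qed.

Hypothesis heq : forall V v vh, VV k V v -> VhatV Omega k V vh ->
  (forall T x, T \in vpatch V -> divv (v T) x = 0) ->
  pairingV Omega V (s V) v vh = residual Omega nu f k ub pb V v vh.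

Section divfree.
Variable v : vfield M.
Hypothesis hv : forall T, T \in cells -> polyv_le k (v T).
Hypothesis hdiv : has_div setT v (fun _ _ => 0).

Let pv T : T \in cells -> vpoly (v T).
Proof. by move=> cT; exact: polyv_vpoly (hv cT). Qed.

Let dv T : T \in cells -> forall i, pdeg k (fun x => v T x 0 i).
Proof. by move=> cT i; apply/pdegP; exact: hv. Qed.

Let divv0 T x : T \in cells -> divv (v T) x = 0.
Proof. exact: (div_zero hM dv hdiv). Qed.

Lemma VV_divfree V : VV k V v.
Proof.
split=> [T /vpatch_cells cT|F T1 T2 x FC t1 t2 F1 F2 hx].
  exists (v T), (fun=> 0); split; first exact: hv.
    by apply/pdegP; exact: pdeg_cst.
  by move=> x; rewrite scale0r addr0.
have Vc := @vpatch_cells _ _ _ V.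
have E := normal_continuous hM dv hdiv (Vc _ t1) (Vc _ t2)
  (facet_of_C FC t1 F1) (facet_of_C FC t2 F2) hx.
move: E; rewrite (outer_face_normal hM Vc FC t1 F1); case: eqP => // _.
by rewrite !dotNr => /oppr_inj.
Qed.

(** A removed facet lies on the boundary of [Omega], hence has a single adjacent cell, and the weak
    divergence on [setT] forces a zero normal trace. *)
Lemma normal_removed V T F x : T \in vpatch V -> F \in cell_faces T ->
  F \notin patch_faces Omega V -> hull F x -> dot (v T x) (outer_normal T F) = 0.
Proof.
move=> TV FT FV hx; have cT := vpatch_cells TV.
have [Fd sFT] := (in_cell_faces T F).1 FT.
apply: (normal_zero hM dv hdiv cT FT _ hx) => T' cT' FT'.
have F' : F \in cell_faces T' by apply/in_cell_faces.
apply: (bd_face_single hM hOmega cT cT' FT F').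
have FC : F \in faces_of (vpatch V) by apply/in_faces_of; split=> //; exists T.
by move: FV; rewrite inE FC /= negb_imply negbK => /andP[].
Qed.

(** Tested with a zero facet component. Facets missing from the patch may be added, since the normal
    trace of [v] vanishes on them. *)
Lemma local_normal_equation V :
  \sum_(T in vpatch V) cell_pairing T (v T) (s V T) =
  \sum_(T in vpatch V) cell_residual nu f ub pb T (bubble k V v T).
Proof.
have v0 : VhatV Omega k V (fun _ _ => 0).
  by move=> F _; split=> [i|x _]; [apply/pdegP; exact: pdeg_cst|exact: dot0l].
have := heq (VV_divfree V) v0 (fun T x TV => divv0 x (vpatch_cells TV)).
rewrite residualE (pairingV_cellwise hM (@mpoly_s V)); last 3 first.
- by move=> T TV; apply: pv; exact: (vpatch_cells TV).
- by move=> F _; exact: vpoly_cst.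
- exact: (VV_divfree V).2.
have z F g : F \in patch_faces Omega V -> face_int F (fun x => dot (g x) (0 : pt)) = 0.
  move=> /patch_faces_faces /in_faces_of[Fd _].
  by apply: face_int0 => // x _; exact: dot0r.
move=> E; transitivity (\sum_(T in vpatch V) (div_part (s V) v T -
   \sum_(F in cell_faces T | F \in patch_faces Omega V)
      (nn_part (s V) v T F + nt_part (s V) (fun _ _ => 0) T F))).
  apply: eq_bigr => T TV; congr (_ - _); rewrite [RHS]big_mkcondr.
  apply: eq_bigr => F FT; case: ifPn => FV.
    by rewrite [X in _ + X](z _ (fun x => nt (s V T x) _))// addr0.
  have Fd := ((in_cell_faces T F).1 FT).1.
  by apply: face_int0 => // x hx; rewrite (normal_removed TV FT FV hx) mulr0.
rewrite E; apply: eq_bigr => T TV; rewrite big1 ?subr0// => F /andP[_ FV].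
exact: (z _ (fun x => hat V T x *: nt _ _)).
Qed.

Lemma equilibrium_LEQ :
  ip_v (fun_f M f) v + pairing (stress_LEQ nu ub s) v = 0.
Proof.
rewrite (pairing_cellwise hM mpoly_LEQ pv); last first.
  by move=> T1 T2 F x c1 c2 F1 F2 hx; exact: (normal_continuous hM dv hdiv c1 c2 F1 F2 hx).
rewrite -big_split /=.
transitivity (\sum_(T in cells) (cell_residual nu f ub pb T (v T) -
    \sum_(V in T) cell_pairing T (v T) (s V T))).
  apply: eq_bigr => T cT; rewrite cell_residual_divfree//; last 2 first.
  - exact: pv.
  - by move=> x; exact: divv0.
  by rewrite -addrA -cell_pairing_LEQ//; exact: pv.
rewrite sumrB -exchange_cells_vertices (eq_bigr _ (fun V _ => local_normal_equation V)).
(* Interchanging vertices and cells brings together all bubbles of a cell, which sum up to [v]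
   there. *)
rewrite exchange_cells_vertices -sumrB big1// => T cT.
rewrite -(cell_residual_sum nu hf hub hpb cT); last first.
  by move=> V _; exact: (vpoly_bubble hM k0).
apply/eqP; rewrite subr_eq0; apply/eqP; apply: eq_cell_residual => x.
by rewrite (bubble_sum k0 (cell_simplicial hM cT))//; exact: dv.
Qed.

End divfree.
End equation.
End equilibration.

(** * Continuity of the tangential stress *)

Section tangential_jump.
Context {R : realType} {n : nat} {M : mesh R n.+1}.
Local Notation d := n.+1.
Local Notation pt := 'rV[R]_n.+1.
Local Notation vtx := (vtx M).
Local Notation pos := (@pos R n.+1 M).
Local Notation cells := (cells M).
Implicit Types (T F : {set vtx}) (V W : vtx) (x c : pt).
Variable Omega : set pt.
Hypothesis hM : triangulation M Omega.
Hypothesis hOmega : domain Omega.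

Lemma polyv_nt k (tau : pt -> 'M[R]_d) c : polym_le k tau ->
  polyv_le k (fun x => nt (tau x) c).
Proof.
move=> ht i; apply/pdegP.
pose row l x := \sum_j c 0 j * tau x l j.
have hrow l : pdeg k (row l).
  by apply: pdeg_sum => j _; apply: pdeg_scale; apply/pdegP; exact: ht.
have -> : (fun x => nt (tau x) c 0 i) = (fun x => row i x - (\sum_l c 0 l * row l x) * c 0 i).
  have E x l : (c *m (tau x)^T) 0 l = row l x.
    by rewrite mxE; apply: eq_bigr => j _; rewrite mxE.
  apply/funext => x; rewrite /nt mxE [(- (_ *: _) : 'rV__) _ _]mxE [(_ *: _ : 'rV__) _ _]mxE E.
  congr (_ - _ * _); apply: eq_bigr => l _.
  by rewrite E mulrC.
apply: pdeg_sub => //; have -> : (fun x => (\sum_l c 0 l * row l x) * c 0 i) =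
    (fun x => c 0 i * (\sum_l c 0 l * row l x)).
  by apply/funext => x; rewrite mulrC.
by apply: pdeg_scale; apply: pdeg_sum => l _; exact: pdeg_scale.
Qed.

Lemma polyv_sum k (I : finType) (P : pred I) (v : I -> pt -> pt) :
  (forall i, P i -> polyv_le k (v i)) -> polyv_le k (fun x => \sum_(i | P i) v i x).
Proof.
move=> hv j; apply/pdegP.
have -> : (fun x => (\sum_(i | P i) v i x) 0 j) = (fun x => \sum_(i | P i) v i x 0 j).
  by apply/funext => x; rewrite summxE.
by apply: pdeg_sum => i Pi; apply/pdegP; exact: hv.
Qed.

Lemma polym_sum k (I : finType) (P : pred I) (t : I -> pt -> 'M[R]_d) :
  (forall i, P i -> polym_le k (t i)) -> polym_le k (fun x => \sum_(i | P i) t i x).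
Proof.
move=> ht j l; apply/pdegP.
have -> : (fun x => (\sum_(i | P i) t i x) j l) = (fun x => \sum_(i | P i) t i x j l).
  by apply/funext => x; rewrite summxE.
by apply: pdeg_sum => i Pi; apply/pdegP; exact: ht.
Qed.

Lemma polymD k (s t : pt -> 'M[R]_d) : polym_le k s -> polym_le k t ->
  polym_le k (fun x => s x + t x).
Proof.
move=> hs ht i j; apply/pdegP.
have -> : (fun x => (s x + t x) i j) = (fun x => s x i j + t x i j).
  by apply/funext => x; rewrite !mxE.
by apply: pdeg_add; apply/pdegP.
Qed.

Lemma polymB k (s t : pt -> 'M[R]_d) : polym_le k s -> polym_le k t ->
  polym_le k (fun x => s x - t x).
Proof.
move=> hs ht i j; apply/pdegP.
have -> : (fun x => (s x - t x) i j) = (fun x => s x i j - t x i j).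
  by apply/funext => x; rewrite !mxE.
by apply: pdeg_sub; apply/pdegP.
Qed.

Lemma polym_dev k (t : pt -> 'M[R]_d) : polym_le k t -> polym_le k (fun x => dev (t x)).
Proof.
move=> ht; apply: polymB => // i j; apply/pdegP.
have -> : (fun x => (\tr (t x) / d%:R)%:M i j) =
    (fun x => ((i == j)%:R / d%:R) * \sum_l t x l l).
  by apply/funext => x; rewrite mxE -mulr_natl /mxtrace; ring.
by apply: pdeg_scale; apply: pdeg_sum => l _; apply/pdegP; exact: ht.
Qed.

Lemma tr_dev (A : 'M[R]_d) : \tr (dev A) = 0.
Proof.
rewrite /dev linearB /= mxtrace_scalar -[X in _ - X]mulr_natr divfK ?subrr//.
Qed.

(** A multiple of the identity has no tangential component. *)
Lemma nt_dev (A : 'M[R]_d) c : dot c c = 1 -> nt (dev A) c = nt A c.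
Proof. by move=> c1; rewrite ntB nt_scalar// subr0. Qed.

Lemma nt_sum (I : finType) (P : pred I) (t : I -> 'M[R]_d) c :
  nt (\sum_(i | P i) t i) c = \sum_(i | P i) nt (t i) c.
Proof.
by apply: (big_morph (fun A : 'M[R]_d => nt A c)); [move=> A B; exact: ntD|exact: nt0].
Qed.

Section equation.
Variables (nu : R) (f : pt -> pt) (k : nat) (ub : vfield M) (pb : sfield M).
Hypothesis k0 : (0 < k)%N.
Hypothesis hf : L2_v (fun_f M f).
Hypothesis hub : forall T, T \in cells -> vpoly (ub T).
Hypothesis hpb : forall T, T \in cells -> spoly (pb T).
Variables (s : vtx -> mfield M).
Hypothesis hs : forall V, SigmaV k V (s V).
Hypothesis heq : forall V v vh, VV k V v -> VhatV Omega k V vh ->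
  (forall T x, T \in vpatch V -> divv (v T) x = 0) ->
  pairingV Omega V (s V) v vh = residual Omega nu f k ub pb V v vh.
Local Notation sig := (stress_f nu ub).
Local Notation leq := (stress_LEQ nu ub s).

Let mpoly_s V T : T \in vpatch V -> mpoly (s V T).
Proof. by move=> TV; have [h _] := hs TV; exact: polym_mpoly h. Qed.

Lemma polym_delta T : T \in cells -> polym_le k (stress_delta s T).
Proof.
move=> cT; rewrite (_ : stress_delta s T = fun x => \sum_(V in T) s V T x).
  by apply: polym_sum => V VT; have [] := hs (T := T) (V := V); rewrite // inE cT.
by apply/funext => x; exact: stress_deltaE.
Qed.

(** The volume component of the test pair is zero, so that only the facet terms survive. *)
Lemma local_tangential_equation V vh : VhatV Omega k V vh ->
  \sum_(F in patch_faces Omega V) \sum_(T in vpatch V | F \subset T) nt_part (s V) vh T F =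
  \sum_(F in patch_faces Omega V) \sum_(T in vpatch V | F \subset T) nt_hat_part nu ub V vh T F.
Proof.
move=> hvh; apply: oppr_inj.
have := heq (VV_cst k V 0) hvh.
rewrite residualE (pairingV_cellwise hM (@mpoly_s V)); last 3 first.
- by move=> T _; exact: vpoly_cst.
- by move=> F FV; have [h _] := hvh F FV; exact: polyv_vpoly h.
- by [].
rewrite !exchange_patch => E; rewrite -[LHS]sumrN -[RHS]sumrN.
transitivity (\sum_(T in vpatch V) (div_part (s V) (cst_v 0) T -
   \sum_(F in cell_faces T | F \in patch_faces Omega V)
      (nn_part (s V) (cst_v 0) T F + nt_part (s V) vh T F))).
  apply: eq_bigr => T /vpatch_cells cT; have sT := cell_simplicial hM cT.
  have -> : div_part (s V) (cst_v 0) T = 0.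
    by apply: cell_int0 => [|x _]; [exact: sT.1|exact: dot0r].
  rewrite sub0r; congr (- _); apply: eq_bigr => F /andP[/in_cell_faces[Fd _] _].
  have -> : nn_part (s V) (cst_v 0) T F = 0; last by rewrite add0r.
  by apply: face_int0 => // x _; rewrite dot0l mulr0.
rewrite E; last first.
  move=> T x _; apply: big1 => i _; exact: partial_cst.
apply: eq_bigr => T /vpatch_cells cT; have sT := cell_simplicial hM cT.
have -> : cell_residual nu f ub pb T (bubble k V (cst_v 0) T) = 0; last by rewrite sub0r.
rewrite (@eq_cell_residual _ _ _ nu f ub pb T _ (fun=> 0)); last first.
  by move=> x; rewrite (bubble_zero k0 sT).
rewrite /cell_residual [X in X - _]cell_int0 ?sT.1//; last by move=> x _; exact: dot0r.
rewrite sub0r big1 ?oppr0// => F /in_cell_faces[Fd _].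
by apply: face_int0 => // x _; rewrite dot0l mulr0.
Qed.

(** Makes the tangential jump an admissible facet test function on every patch, whichever cell the
    face normal is taken from. *)
Lemma nt_outer_orthogonal (C : {set {set vtx}}) F T (tau : 'M[R]_d) :
  (forall T, T \in C -> T \in cells) -> F \in faces_of C -> T \in cells -> F \subset T ->
  dot (nt tau (outer_normal T F)) (face_normal C F) = 0.
Proof.
move=> Cc FC cT FT; have [c1 F1] := cell1P FC.
have [Fd _] := (in_faces_of C F).1 FC.
have FcT : F \in cell_faces T by apply/in_cell_faces.
have n1 := outer_unit hM cT FcT.
rewrite /face_normal; have [<-|ne] := eqVneq T (cell1 C F); first exact: dot_nt_normal.
rewrite (outer_opposite hM cT (Cc _ c1) ne FcT (facet_of_C FC c1 F1)).
by rewrite dotNr dot_nt_normal// oppr0.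
Qed.

Hypothesis hsig : Pk_m k sig.

Definition ntjump F x := \sum_(T in cells | F \subset T) nt (leq T x) (outer_normal T F).

Lemma polym_LEQ T : T \in cells -> polym_le k (leq T).
Proof. by move=> cT; apply: polymB; [exact: hsig|exact: polym_delta]. Qed.

Lemma polyv_ntjump F : polyv_le k (ntjump F).
Proof. by apply: polyv_sum => T /andP[cT _]; apply: polyv_nt; exact: polym_LEQ. Qed.

(** If [V] is opposite to [F] in an adjacent cell, the patch contains only that cell and the
    identity is one-sided. It is still available, because facets on the boundary of a patch carry
    tangential unknowns unless they lie on the boundary of the domain. *)
Lemma ntjump_vertex F V : F \in interior_faces M Omega ->
  \sum_(T in vpatch V | F \subset T)
    face_int F (fun x => dot (nt (s V T x) (outer_normal T F)) (ntjump F x)) =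
  \sum_(T in vpatch V | F \subset T)
    face_int F (fun x => dot (hat V T x *: nt (sig T x) (outer_normal T F)) (ntjump F x)).
Proof.
rewrite inE => /andP[Ff Fint].
have [Fd _] := (in_faces_of cells F).1 Ff.
have [[T TV FT]|noT] := pselect (exists2 T, T \in vpatch V & F \subset T); last first.
  by rewrite !big1// => T /andP[TV FT]; case: noT; exists T.
have FC : F \in faces_of (vpatch V) by apply/in_faces_of; split=> //; exists T.
have FV : F \in patch_faces Omega V by rewrite inE FC Fint implybT.
pose vh : vfield M := fun F' x => if F' == F then ntjump F x else 0.
have hvh : VhatV Omega k V vh.
  move=> F' F'V; rewrite /vh; case: eqP => [->|_]; last first.
    by split=> [i|x _]; [apply/pdegP; exact: pdeg_cst|exact: dot0l].
  split=> [|x _]; first exact: polyv_ntjump.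
  rewrite dot_suml big1// => T' /andP[cT' FT'].
  exact: (nt_outer_orthogonal _ (@vpatch_cells _ _ _ V)).
have := local_tangential_equation hvh.
have z F' T' (g : pt -> pt) : F' \in patch_faces Omega V -> F' != F ->
    face_int F' (fun x => dot (g x) (vh F' x)) = 0.
  move=> /patch_faces_faces /in_faces_of[F'd _] F'F.
  by apply: face_int0 => // x _; rewrite /vh (negbTE F'F) dot0r.
have pick (G : {set vtx} -> R) :
    (forall F', F' \in patch_faces Omega V -> F' != F -> G F' = 0) ->
    \sum_(F' in patch_faces Omega V) G F' = G F.
  by move=> G0; rewrite (bigD1 F)//= big1 ?addr0// => F' /andP[]; exact: G0.
rewrite pick => [|F' F'V F'F]; last first.
  by apply: big1 => T' _; exact: (z _ T' (fun x => nt _ _)).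
rewrite pick => [|F' F'V F'F]; last first.
  by apply: big1 => T' _; exact: (z _ T' (fun x => _ *: nt _ _)).
have vhF : vh F = ntjump F by apply/funext => x; rewrite /vh eqxx.
by rewrite /nt_part /nt_hat_part vhF.
Qed.

Lemma hat_sum_in T x : T \in cells -> \sum_(V in T) hat V T x = 1.
Proof.
move=> cT; have sT := cell_simplicial hM cT.
rewrite -(hat_sum sT x) [RHS](bigID (mem T)) /= [X in _ = _ + X]big1 ?addr0//.
by move=> V VT; exact: hat_off.
Qed.

(** [ntjump_vertex] is summed over all vertices, including those opposite to [F]. The hat functions
    of each cell then add up to 1, and the difference of both sides is the integral of the squared
    jump. *)
Lemma ntjump_eq0 F x : F \in interior_faces M Omega -> hull F x -> ntjump F x = 0.
Proof.
move=> Fi hx; have [Ff Fint] : F \in faces M /\ ~~ on_bd Omega F.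
  by move: Fi; rewrite inE => /andP[].
have [Fd [T0 cT0 FT0]] := (in_faces_of cells F).1 Ff.
have pj : vpoly (ntjump F) := polyv_vpoly (polyv_ntjump F).
pose A T V := face_int F (fun x =>
  dot (hat V T x *: nt (sig T x) (outer_normal T F)) (ntjump F x)).
pose B T V := face_int F (fun x => dot (nt (s V T x) (outer_normal T F)) (ntjump F x)).
have pA T V : T \in cells -> vpoly (fun x => hat V T x *: nt (sig T x) (outer_normal T F)).
  move=> cT; apply: vpolyZ; first by exists 1%N; exact: pdeg_hat (cell_simplicial hM cT) V.
  exact: vpoly_nt (mpoly_sig nu hub cT).
have pB T V : T \in cells -> V \in T -> vpoly (fun x => nt (s V T x) (outer_normal T F)).
  by move=> cT VT; apply: vpoly_nt; apply: mpoly_s; rewrite inE cT.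
have h0 : face_int F (fun x => dot (ntjump F x) (ntjump F x)) = 0.
  transitivity (\sum_(T in cells | F \subset T) \sum_(V in T) (A T V - B T V)).
    transitivity (face_int F (fun x => \sum_(T in cells | F \subset T)
        dot (nt (leq T x) (outer_normal T F)) (ntjump F x))).
      by apply: eq_simplex_int => y _; rewrite -dot_suml.
    rewrite face_int_sum; last first.
      move=> T /andP[cT _]; apply: finteg_spoly; apply: spoly_dot => //.
      exact: vpoly_nt (polym_mpoly (polym_LEQ cT)).
    apply: eq_bigr => T /andP[cT FT].
    rewrite sumrB -!face_int_sum; last 2 first.
    - by move=> V VT; apply: finteg_spoly; apply: spoly_dot => //; exact: pB.
    - by move=> V VT; apply: finteg_spoly; apply: spoly_dot => //; exact: pA.
    rewrite -face_intB; last 2 first.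
    - apply: finteg_spoly; apply: spoly_sum => V VT; apply: spoly_dot => //; exact: pA.
    - apply: finteg_spoly; apply: spoly_sum => V VT; apply: spoly_dot => //; exact: pB.
    apply: eq_simplex_int => y _; set z := simplex_param _ _.
    rewrite -!dot_suml -dotBl -scaler_suml hat_sum_in// scale1r -nt_sum.
    by rewrite /stress_LEQ ntB stress_deltaE.
  transitivity (\sum_V \sum_(T in vpatch V) (if F \subset T then A T V - B T V else 0)).
    rewrite exchange_cells_vertices big_mkcondr; apply: eq_bigr => T cT.
    by case: ifP => // _; rewrite big1.
  apply: big1 => V _; rewrite -big_mkcondr sumrB.
  by rewrite (ntjump_vertex V Fi) subrr.
have FcT : F \in cell_faces T0 by apply/in_cell_faces.
have cj : continuous (fun x => dot (ntjump F x) (ntjump F x)).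
  by apply: spoly_cont; exact: spoly_dot.
have := face_int_eq0 (cell_simplicial hM cT0) FcT cj (fun x _ => dot_ge0 _) h0 hx.
by move/eqP; rewrite dot_eq0 => /eqP.
Qed.

Lemma jump_LEQ F x : F \in interior_faces M Omega -> hull F x ->
  jump cells F (fun T => nt (leq T x) (face_normal cells F)) = 0.
Proof.
move=> Fi hx; have Ff : F \in faces M by move: Fi; rewrite inE => /andP[].
rewrite (@jump_nt _ _ _ _ hM cells F _ Ff (leq^~ x))//.
exact: ntjump_eq0.
Qed.

End equation.
End tangential_jump.

(* The trace of the LEQ stress is nu * div ub, and its degree is governed by that
   of nu * grad ub; hence it lies in Sigma_h exactly when the discrete velocity
   is exactly divergence-free with gradient in P_k. For a primal method that is
   only discretely divergence-free, its deviatoric part lies in Sigma_h. The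
   equilibrium property needs neither condition. *)
Theorem theorem7p6 (R : realType) (d : nat) (Omega : set 'rV[R]_d)
  (M : mesh R d) (nu : R) (f : 'rV[R]_d -> 'rV[R]_d) (r : nat)
  (Vb : set (vfield M)) (Qb : set (sfield M)) (Rec : vfield M -> vfield M)
  (ub : vfield M) (pb : sfield M)
  (s : vtx M -> mfield M) (u uh : vtx M -> vfield M) (p : vtx M -> sfield M)
  (hd : d = 2%N \/ d = 3%N) (hOmega : domain Omega)
  (hM : triangulation M Omega) (hnu : 0 < nu) (hf : L2_v (fun_f M f))
  (hr : (0 < r)%N)
  (hVb : fe_velocity_space Vb) (hQb : fe_pressure_space Qb)
  (hinfsup : inf_sup_stable Vb Qb) (hRec : reconstruction Omega f r Vb Qb Rec)
  (hprimal : primal_solution nu f Vb Qb Rec ub pb)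
  (hlocal : forall V : vtx M,
     local_solution Omega nu f r ub pb V (s V) (u V) (uh V) (p V)) :
  [/\ Sigma_h Omega r (stress_LEQ nu ub s) <->
        (Pk_m r (stress_f nu ub) /\
         forall T x, T \in cells M -> hull T x -> divv (ub T) x = 0),
      Pk_m r (stress_f nu ub) ->
        Sigma_h Omega r (fun T x => dev (stress_LEQ nu ub s T x))
    & forall v : vfield M, V_h r v -> has_div setT v (fun _ _ => 0) ->
        ip_v (fun_f M f) v + pairing (stress_LEQ nu ub s) v = 0].
Proof.
(* The geometry is set up in dimension [n.+1]; dimension 0 contradicts [hd]. *)
case: d => [|n] in Omega M f Vb Qb Rec ub pb s u uh p hd hOmega hM hf hVb hQb hinfsup hRec
  hprimal hlocal *.
  by case: hd.
have hub T : T \in cells M -> vpoly (ub T).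
  have [[m hm] _ _ _] := hVb; have [h _ _ _] := hprimal.
  by move=> cT; exact: polyv_vpoly (hm _ h T cT).
have hpb T : T \in cells M -> spoly (pb T).
  have [[m hm] _ _ _] := hQb; have [_ h _ _] := hprimal.
  by move=> cT; exists m; apply/pdegP; exact: hm _ h T cT.
have hs V : SigmaV r V (s V) by have [[? _] _ _ _] := hlocal V.
have heq V (v vh : vfield M) : VV r V v -> VhatV Omega r V vh ->
    (forall T x, T \in vpatch V -> divv (v T) x = 0) ->
    pairingV Omega V (s V) v vh = residual Omega nu f r ub pb V v vh.
  exact: (local_equation hM hOmega hr hf hub hpb hRec hprimal (hs V) (hlocal V)).
(* The local stresses are trace-free, and the trace of a gradient is the divergence. *)
have tr_LEQ T x : T \in cells M -> hull T x ->
    \tr (stress_LEQ nu ub s T x) = nu * divv (ub T) x.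
  move=> cT hx.
  have delta0 : \tr (stress_delta s T x) = 0.
    rewrite stress_deltaE// raddf_sum /= big1// => V VT.
    have TV : T \in vpatch V by rewrite inE cT.
    by have [_ h] := hs V T TV; exact: h.
  rewrite raddfB /= delta0 subr0 mxtraceZ; congr (_ * _).
  by apply: eq_bigr => i _; rewrite mxE.
(* The local stresses lie in P_r in any case, so the degree condition on the sum is one on the
   primal stress. *)
have degree_sig : Pk_m r (stress_LEQ nu ub s) -> Pk_m r (stress_f nu ub).
  move=> h T cT.
  have -> : stress_f nu ub T = fun x => stress_LEQ nu ub s T x + stress_delta s T x.
    by apply/funext => x; rewrite subrK.
  by apply: polymD; [exact: h|exact: polym_delta hs _ cT].
split.
- split=> [[h1 h2 h3]|[h1 h2]].
    split; first exact: degree_sig.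
    move=> T x cT hx; have := h2 T x cT hx; rewrite tr_LEQ// => /eqP.
    by rewrite mulf_eq0 (gt_eqF hnu) => /eqP.
  split=> [T cT|T x cT hx|F x Fi hx].
  + exact: (polym_LEQ hs h1 cT).
  + by rewrite tr_LEQ// h2// mulr0.
  + exact: (jump_LEQ hM hr hub hs heq h1 Fi hx).
- move=> h1; split=> [T cT|T x cT hx|F x Fi hx].
  + by apply: polym_dev; exact: (polym_LEQ hs h1 cT).
  + exact: tr_dev.
  + rewrite -[RHS](jump_LEQ hM hr hub hs heq h1 Fi hx).
    have Ff : F \in faces M by move: Fi; rewrite inE => /andP[].
    by apply: eq_bigr => T _; rewrite nt_dev// (face_normal_unit hM _ Ff).
- move=> v [hRT [_ _]] hdiv.
  (* The a priori degree of a Raviart-Thomas field is r + 1. This is enough to make the divergence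
     vanish pointwise, which in turn lowers the degree to r. *)
  have hv T : T \in cells M -> forall i, pdeg r.+1 (fun x => v T x 0 i).
    move=> cT i; have [a [b [ha hb E]]] := hRT T cT.
    have -> : (fun x => v T x 0 i) = (fun x => a x 0 i + b x * x 0 i).
      by apply/funext => x; rewrite E !mxE.
    apply: pdeg_add; first by apply: (pdeg_leq (leqnSn r)); apply/pdegP; exact: ha.
    by rewrite -[r.+1]addn1; apply: pdeg_mul; [apply/pdegP|exact: pdeg_coord].
  have hP T : T \in cells M -> polyv_le r (v T).
    move=> cT; apply: (RT_divfree hr (hRT T cT)) => x.
    exact: (div_zero hM hv hdiv).
  exact: (equilibrium_LEQ hM hOmega hr hf hub hpb hs heq hP hdiv).
Qed.
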